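(* Let $P$ be a closed PL manifold which admits a symplectic smoothing, i.e. there exist a smooth symplectic manifold $(M,\omega_M)$ and a smooth triangulation $h:P\to M$. Then $P$ supports a PL symplectic structure.
   Context: A PL manifold of dimension $m$ is a polyhedron $P=|K|$ (body of a simplicial complex $K$ of affine simplices in some $\mathbb{R}^N$; $K$ is called a triangulation of $P$) such that the star of each simplex of $K$ admits a PL embedding onto a PL ball in $\mathbb{R}^m$. A smooth triangulation $h:P\to M$ of a smooth manifold is a homeomorphism such that, for some triangulation $K$ of $P$, the restriction of $h$ to each closed simplex of $K$ is a smooth embedding. A PL symplectic structure on $P$, $\dim P=2n$, is, for some triangulation $K$ of $P$, a collection $\omega=(\omega_\sigma)_{\sigma\in K}$ of constant (in affine coordinates) $2$-forms on the simplices of $K$ with $\omega_{\sigma_1}|_{\sigma_1\cap\sigma_2}=\omega_{\sigma_2}|_{\sigma_1\cap\sigma_2}$ for all $\sigma_1,\sigma_2$, such that $\omega_\sigma$ is non-degenerate on each $2n$-simplex $\sigma$ and the forms $\omega_\sigma^n$ together induce an orientation of $P$. *)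

(* Defs.v *)
From HB Require Import structures.
From mathcomp Require Import all_boot all_order all_algebra all_fingroup.
From mathcomp Require Import finmap all_classical all_reals all_analysis.
Set Implicit Arguments. Unset Strict Implicit. Unset Printing Implicit Defensive.
Import Order.TTheory GRing.Theory Num.Theory numFieldNormedType.Exports.
Local Open Scope classical_set_scope.
Local Open Scope ring_scope.

Section Simplices.
Variables (R : realType) (N : nat).
Implicit Types (s t : {fset 'rV[R]_N}) (K : set {fset 'rV[R]_N}).
Implicit Types (P : set 'rV[R]_N).

(* A simplex is given by its finite set of vertices. *)

Definition bary_coords s (a : 'rV[R]_N -> R) : Prop :=
  (forall v, v \in s -> 0 <= a v) /\ \sum_(v <- s) a v = 1.

Definition hull s : set 'rV[R]_N :=
  [set x | exists2 a, bary_coords s a & x = \sum_(v <- s) a v *: v].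

Definition affinely_independent s : Prop :=
  forall a : 'rV[R]_N -> R,
    \sum_(v <- s) a v = 0 -> \sum_(v <- s) a v *: v = 0 ->
    forall v, v \in s -> a v = 0.

(* The tangent space of the simplex: the linear span of its edge vectors. *)
Definition direction s : {vspace 'rV[R]_N} :=
  <<[seq v - w | v <- enum_fset s, w <- enum_fset s]>>%VS.

(* Complexes may be infinite, but are locally finite.  Since hull fset0 = set0,
   the third clause covers disjoint simplices. *)
Definition simplicial_complex K : Prop :=
  [/\ forall s, K s -> s != fset0 /\ affinely_independent s,
      forall s t, K s -> (t `<=` s)%fset -> t != fset0 -> K t,
      forall s t, K s -> K t -> hull s `&` hull t = hull (s `&` t)%fset &
      forall x, (\bigcup_(s in K) hull s) x ->
        exists2 U, nbhs x U & finite_set [set s | K s /\ hull s `&` U !=set0]].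

Definition body K : set 'rV[R]_N := \bigcup_(s in K) hull s.

Definition triangulation K P : Prop := simplicial_complex K /\ body K = P.

Definition star K s : set 'rV[R]_N :=
  \bigcup_(t in [set t | K t /\ (s `<=` t)%fset]) hull t.

End Simplices.

Section PiecewiseLinear.
Variable R : realType.

Definition affine_on N p (s : {fset 'rV[R]_N}) (f : 'rV[R]_N -> 'rV[R]_p) :=
  forall a, bary_coords s a ->
    f (\sum_(v <- s) a v *: v) = \sum_(v <- s) a v *: f v.

(* Only the values of f on A matter.  Continuity on A follows from the local
   finiteness of the triangulation. *)
Definition PL_map N p (A : set 'rV[R]_N) (f : 'rV[R]_N -> 'rV[R]_p) : Prop :=
  exists2 K, triangulation K A & forall s, K s -> affine_on s f.

(* f is a PL homeomorphism of A onto B, i.e. a PL embedding of A with image B. *)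
Definition PL_homeo N p (A : set 'rV[R]_N) (B : set 'rV[R]_p)
    (f : 'rV[R]_N -> 'rV[R]_p) : Prop :=
  [/\ PL_map A f, f @` A = B &
      exists2 g : 'rV[R]_p -> 'rV[R]_N, PL_map B g & forall x, A x -> g (f x) = x].

Definition unit_cube m : set 'rV[R]_m := [set x | forall i, 0 <= x 0 i <= 1].

Definition PL_ball m (B : set 'rV[R]_m) : Prop :=
  exists f, PL_homeo (@unit_cube m) B f.

Definition PL_manifold N (m : nat) (P : set 'rV[R]_N) : Prop :=
  exists2 K, triangulation K P &
    forall s, K s -> exists (f : 'rV[R]_N -> 'rV[R]_m) (B : set 'rV[R]_m),
      PL_ball B /\ PL_homeo (star K s) B f.

(* The points of P having no neighbourhood Q in P which is PL homeomorphic to a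
   neighbourhood of a point of R^m. *)
Definition PL_boundary N (m : nat) (P : set 'rV[R]_N) : set 'rV[R]_N :=
  [set x | P x /\
    ~ exists (Q : set 'rV[R]_N) (B : set 'rV[R]_m) (f : 'rV[R]_N -> 'rV[R]_m),
        [/\ Q `<=` P, within P (nbhs x) Q, PL_homeo Q B f & nbhs (f x) B]].

Definition closed_PL_manifold N (m : nat) (P : set 'rV[R]_N) : Prop :=
  [/\ PL_manifold m P, compact P & PL_boundary m P = set0].

End PiecewiseLinear.

Section Smooth.
Variable R : realType.

(* All iterated partial derivatives of order at most k exist and are continuous
   on U, which is meant to be open. *)
Fixpoint Ck m (W : normedModType R) (k : nat) (U : set 'rV[R]_m)
    (f : 'rV[R]_m -> W) : Prop :=
  (forall x, U x -> {for x, continuous f}) /\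
  if k is k'.+1 then
    forall i : 'I_m,
      (forall x, U x -> derivable f x (delta_mx 0 i)) /\
      Ck k' U (fun x => 'D_(delta_mx 0 i) f x)
  else True.

Definition smooth m (W : normedModType R) (U : set 'rV[R]_m)
    (f : 'rV[R]_m -> W) : Prop := forall k, Ck k U f.

(* A homeomorphism from an open set of M onto an open set of R^m, with its
   inverse; the values of the two functions elsewhere are irrelevant. *)
Record chart (M : topologicalType) (m : nat) := Chart {
  chart_dom : set M;
  chart_cod : set 'rV[R]_m;
  chart_map : M -> 'rV[R]_m;
  chart_inv : 'rV[R]_m -> M;
  chart_dom_open : open chart_dom;
  chart_cod_open : open chart_cod;
  chart_map_dom : forall p, chart_dom p -> chart_cod (chart_map p);
  chart_inv_cod : forall x, chart_cod x -> chart_dom (chart_inv x);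
  chart_mapK : forall p, chart_dom p -> chart_inv (chart_map p) = p;
  chart_invK : forall x, chart_cod x -> chart_map (chart_inv x) = x;
  chart_map_cts : {within chart_dom, continuous chart_map};
  chart_inv_cts : {within chart_cod, continuous chart_inv} }.

Definition overlap M m (c d : chart M m) : set 'rV[R]_m :=
  chart_cod c `&` [set x | chart_dom d (chart_inv c x)].

Definition transition M m (c d : chart M m) : 'rV[R]_m -> 'rV[R]_m :=
  fun x => chart_map d (chart_inv c x).

Record smooth_manifold (m : nat) := SmoothManifold {
  manifold_space :> topologicalType;
  manifold_hausdorff : hausdorff_space manifold_space;
  manifold_countable : @second_countable manifold_space;
  atlas : set (chart manifold_space m);
  atlas_cover : forall p, exists2 c, atlas c & chart_dom c p;
  atlas_smooth : forall c d, atlas c -> atlas d ->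
    smooth (overlap c d) (transition c d) }.

(* The value on (u, v) of the bilinear form with matrix w. *)
Definition form_eval m (w : 'M[R]_m) (u v : 'rV[R]_m) : R :=
  (u *m w *m v^T) 0 0.

Definition alternating m (w : 'M[R]_m) : Prop := w^T = - w.

(* A 2-form is given by its matrix in each chart; the second clause says that
   the local expressions are related by pullback along the transition maps. *)
Definition two_form m (M : smooth_manifold m)
    (omega : chart M m -> 'rV[R]_m -> 'M[R]_m) : Prop :=
  (forall c, atlas c -> smooth (chart_cod c) (omega c) /\
     forall x, chart_cod c x -> alternating (omega c x)) /\
  (forall c d, atlas c -> atlas d -> forall x, overlap c d x -> forall u v,
     form_eval (omega c x) u v =
     form_eval (omega d (transition c d x))
               ('D_u (transition c d) x) ('D_v (transition c d) x)).

Definition closed_form m (M : smooth_manifold m)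
    (omega : chart M m -> 'rV[R]_m -> 'M[R]_m) : Prop :=
  forall c, atlas c -> forall x, chart_cod c x -> forall i j k : 'I_m,
    'D_(delta_mx 0 i) (fun y => omega c y j k : R) x +
    'D_(delta_mx 0 j) (fun y => omega c y k i : R) x +
    'D_(delta_mx 0 k) (fun y => omega c y i j : R) x = 0.

Definition nondegenerate_form m (M : smooth_manifold m)
    (omega : chart M m -> 'rV[R]_m -> 'M[R]_m) : Prop :=
  forall c, atlas c -> forall x, chart_cod c x -> omega c x \in unitmx.

Definition symplectic_form m (M : smooth_manifold m)
    (omega : chart M m -> 'rV[R]_m -> 'M[R]_m) : Prop :=
  [/\ two_form omega, closed_form omega & nondegenerate_form omega].

Definition homeomorphism (S T : topologicalType) (h : S -> T) : Prop :=
  continuous h /\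
  exists g : T -> S, [/\ continuous g, cancel h g & cancel g h].

(* The restriction of h : P -> M to the closed simplex s is an injective smooth
   immersion (by compactness, an embedding): near each point y of the simplex it
   is given in some chart by the restriction of a smooth map F from an open
   subset W of R^N to R^m, whose derivative at y is injective on the tangent
   space of the simplex.  That derivative depends only on h. *)
Definition smooth_embedding_on N m (P : set 'rV[R]_N) (M : smooth_manifold m)
    (h : P -> M) (s : {fset 'rV[R]_N}) : Prop :=
  (forall y z : P, hull s (val y) -> hull s (val z) -> h y = h z -> y = z) /\
  (forall y : P, hull s (val y) ->
     exists (c : chart M m) (W : set 'rV[R]_N) (F : 'rV[R]_N -> 'rV[R]_m),
       [/\ atlas c, open W /\ W (val y), smooth W F,
           forall z : P, hull s (val z) -> W (val z) ->
             chart_dom c (h z) /\ chart_map c (h z) = F (val z) &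
           forall u, u \in direction s -> 'D_u F (val y) = 0 -> u = 0]).

Definition smooth_triangulation N m (P : set 'rV[R]_N) (M : smooth_manifold m)
    (h : P -> M) : Prop :=
  homeomorphism h /\
  exists2 K, triangulation K P & forall s, K s -> smooth_embedding_on h s.

Definition admits_symplectic_smoothing N n (P : set 'rV[R]_N) : Prop :=
  exists (M : smooth_manifold n.*2)
         (omega : chart M n.*2 -> 'rV[R]_n.*2 -> 'M[R]_n.*2) (h : P -> M),
    symplectic_form omega /\ smooth_triangulation h.

End Smooth.

Section PLSymplectic.
Variable R : realType.

Lemma ord_even_subproof n (i : 'I_n) : (i.*2 < n.*2)%N.
Proof. by rewrite ltn_double. Qed.
Definition ord_even n (i : 'I_n) : 'I_n.*2 := Ordinal (ord_even_subproof i).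

Lemma ord_odd_subproof n (i : 'I_n) : (i.*2.+1 < n.*2)%N.
Proof. by rewrite ltn_Sdouble. Qed.
Definition ord_odd n (i : 'I_n) : 'I_n.*2 := Ordinal (ord_odd_subproof i).

(* The n-th exterior power of a 2-form w, evaluated on 2n vectors, normalised so
   that (a /\ b)(x, y) = a(x) b(y) - a(y) b(x) for 1-forms a and b. *)
Definition wedge_power N n (w : 'M[R]_N) (u : 'I_n.*2 -> 'rV[R]_N) : R :=
  (2 ^+ n)^-1 * \sum_(p : 'S_n.*2) (-1) ^+ p *
    \prod_(i < n) form_eval w (u (p (ord_even i))) (u (p (ord_odd i))).

(* A constant 2-form on the simplex s is represented by the matrix w s of an
   alternating form on R^N, of which only the restriction to direction s
   matters. *)
Definition PL_two_form N (K : set {fset 'rV[R]_N})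
    (w : {fset 'rV[R]_N} -> 'M[R]_N) : Prop :=
  (forall s, K s -> alternating (w s)) /\
  (forall s t, K s -> K t ->
     forall u v, u \in direction (s `&` t)%fset -> v \in direction (s `&` t)%fset ->
       form_eval (w s) u v = form_eval (w t) u v).

Definition nondegenerate_on N (s : {fset 'rV[R]_N}) (w : 'M[R]_N) : Prop :=
  forall u, u \in direction s ->
    (forall v, v \in direction s -> form_eval w u v = 0) -> u = 0.

(* The orientations of the 2n-simplices by w^n are coherent: whenever two of
   them, with vertices a, t_0, ..., t_{2n-1} and b, t_0, ..., t_{2n-1}, share the
   (2n-1)-face t, they induce opposite orientations on t.  The requirement K t
   excludes the empty face when n = 0. *)
Definition induces_orientation N n (K : set {fset 'rV[R]_N})
    (w : {fset 'rV[R]_N} -> 'M[R]_N) : Prop :=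
  forall (t : (n.*2).-tuple 'rV[R]_N) (a b : 'rV[R]_N),
    let sa := [fset v in a :: t]%fset in
    let sb := [fset v in b :: t]%fset in
    uniq [:: a, b & t] -> K [fset v in tval t]%fset -> K sa -> K sb ->
    wedge_power (w sa) (fun i => tnth t i - a) *
    wedge_power (w sb) (fun i => tnth t i - b) < 0.

Definition PL_symplectic_structure N n (K : set {fset 'rV[R]_N})
    (w : {fset 'rV[R]_N} -> 'M[R]_N) : Prop :=
  [/\ PL_two_form K w,
      forall s, K s -> #|` s| = n.*2.+1 -> nondegenerate_on s (w s) &
      induces_orientation n K w].

Definition supports_PL_symplectic N n (P : set 'rV[R]_N) : Prop :=
  exists2 K, triangulation K P &
    exists w : {fset 'rV[R]_N} -> 'M[R]_N, PL_symplectic_structure n K w.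

End PLSymplectic.

(* Main.v *)
(** Inside a chart, give a small triple (a, b, c) of points of a simplex of the triangulation
half the value of the symplectic form at the centroid of h a, h b, h c on the edges
h b - h a and h c - h a. Iterated midpoint subdivision of this 2-cochain converges, since one
subdivision of a triangle of size l changes it by o(l^2); the limit is the symplectic area of
the curved triangle. It does not depend on the chart, it is a cocycle because the form is
closed (on a tetrahedron of size l the coboundary is o(l^3)), and near a point p of the simplex
it differs by o(l^2) from the area for the constant form W_p, the pullback by the derivative
of h at p.

On the vertices of an affine simplex a cocycle is the area cochain of exactly one constant
form; hence every triangulation finer than the given one acquires constant forms that agree on
common faces. For Freudenthal's subdivision with L parts per edge, only finitely many shapes
of simplices occur up to the factor L, so when L is large the constant forms are close enough
to W_p for their Gram matrices to be invertible and for their Pfaffians to have the sign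
prescribed by W_p. Finally, the derivatives of h on two top-dimensional simplices with a common
facet place them on opposite sides of that facet, since otherwise the contraction principle
would produce a common value of h at distinct points. *)

Require Import Defs.
From HB Require Import structures.
From mathcomp Require Import all_boot all_order all_algebra all_fingroup.
From mathcomp Require Import finmap all_classical all_reals all_analysis.
From mathcomp Require Import ring lra zify.
Set Implicit Arguments. Unset Strict Implicit. Unset Printing Implicit Defensive.
Import Defs Order.TTheory GRing.Theory Num.Theory numFieldNormedType.Exports.
Local Open Scope classical_set_scope.
Local Open Scope ring_scope.

(** * Strict differentiability *)

Section StrictDifferentiability.
Variable R : realType.

(** The pullback of [omega] varies along a simplex, and freezing it at one point of each small
    simplex gives constant forms that disagree on common faces. Prescribing the areas of 2-faces
    removes this obstacle: an area depends on three vertices only, so agreement is automatic and the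
    price is the cocycle identity. The limit needs no integration theory: subdivision turns a
    triangle into 4 and a tetrahedron into 8 of half the size, so bounds [e * l ^+ 2] on 2-cochains
    and [e * l ^+ 3] on coboundaries reproduce themselves exactly. Since [h] is smooth only along
    closed simplices, its derivatives are strict derivatives relative to a closed simplex,
    determined only on its direction space. Signs are accessible because [wedge_power] is a multiple
    of the Pfaffian of a Gram matrix and a congruence multiplies it by a determinant; for two
    simplices with a common facet the comparison comes down to two determinants in one chart at the
    barycentre of the facet. *)

Lemma mx_entry_le m n (M : 'M[R]_(m, n)) i j : `|M i j| <= `|M|.
Proof.
rewrite [leRHS]/Num.Def.normr/= mx_normrE.
exact: (le_bigmax _ (fun k : 'I_m * 'I_n => `|M k.1 k.2|) (i, j)).
Qed.

Lemma mx_norm_le m n (M : 'M[R]_(m, n)) e :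
  0 <= e -> (forall i j, `|M i j| <= e) -> `|M| <= e.
Proof.
by move=> e0 h; rewrite [leLHS]/Num.Def.normr/= mx_normrE (bigmax_le _ e0).
Qed.

Lemma mulmx_norm_le m n p (A : 'M[R]_(m, n)) (B : 'M[R]_(n, p)) :
  `|A *m B| <= n%:R * `|A| * `|B|.
Proof.
apply: mx_norm_le => [|i j]; first by rewrite !mulr_ge0.
rewrite mxE (le_trans (ler_norm_sum _ _ _))//.
rewrite -[leRHS]mulrA mulr_natl -[X in _ *+ X](card_ord n) -sumr_const.
by apply: ler_sum => k _; rewrite normrM ler_pM// mx_entry_le.
Qed.

Lemma trmx_norm m n (A : 'M[R]_(m, n)) : `|A^T| = `|A|.
Proof.
apply/eqP; rewrite eq_le; apply/andP; split; apply: mx_norm_le => // i j.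
  by rewrite mxE mx_entry_le.
by rewrite -(mxE trmx_key (fun i j => A j i)) mx_entry_le.
Qed.

Lemma form_eval_le m (w : 'M[R]_m) u v :
  `|form_eval w u v| <= (m%:R * m%:R) * `|w| * `|u| * `|v|.
Proof.
rewrite /form_eval (le_trans (mx_entry_le _ _ _))//.
rewrite (le_trans (mulmx_norm_le _ _))// trmx_norm ler_wpM2r//.
rewrite -!mulrA ler_wpM2l// (le_trans (mulmx_norm_le _ _))//.
by rewrite -mulrA (mulrC `|u|).
Qed.

(** Strict differentiability along [A]: both points vary, because the edges of a small triangle near
    [p] need not start at [p]. Taking [A] to be a closed simplex allows [p] on its boundary.
    Linearity of [L] is asked for only where it is used. *)
Definition sdiff (V W : normedModType R) (A : set V) (p : V) (f L : V -> W) :=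
  forall e, 0 < e -> exists2 d, 0 < d & forall x y, A x -> A y ->
    `|x - p| < d -> `|y - p| < d -> `|f x - f y - L (x - y)| <= e * `|x - y|.

Lemma mean_value_le (g dg : R -> R) (a b d e : R) :
  (forall t, Num.min a b <= t <= Num.max a b -> is_derive t 1 g (dg t)) ->
  (forall t, Num.min a b <= t <= Num.max a b -> `|dg t - d| <= e) ->
  `|g a - g b - d * (a - b)| <= e * `|a - b|.
Proof.
wlog ab : a b / a <= b.
  move=> H h1 h2; case: (leP a b) => [/H|/ltW ba]; first exact.
  have -> : g a - g b - d * (a - b) = - (g b - g a - d * (b - a)) by ring.
  by rewrite normrN [in leRHS]distrC; apply: H => //; rewrite minC maxC.
rewrite (min_idPl ab) (max_idPr ab) => h1 h2.
have [||c cab E] := @MVT_segment _ g dg a b ab; last first.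
- move: cab; rewrite in_itv/= => cab.
  rewrite -normrN -[leRHS](congr1 (fun z => e * z) (normrN _)).
  have -> : - (g a - g b - d * (a - b)) = (dg c - d) * - (a - b).
    have -> : g a - g b = - (dg c * (b - a)) by rewrite -E opprB.
    ring.
  by rewrite normrM ler_wpM2r// h2.
- apply: derivable_within_continuous => t; rewrite in_itv/= => /h1 h.
  exact: ex_derive.
- by move=> t; rewrite in_itv/= => /andP[/ltW ? /ltW ?]; apply: h1; apply/andP.
Qed.

Lemma is_derive_line (V : normedModType R) (f : V -> R) (z v : V) (a t : R) :
  derivable f (z + (t - a) *: v) v ->
  is_derive t (1 : R) (fun s => f (z + (s - a) *: v)) ('D_v f (z + (t - a) *: v)).
Proof.
move=> h; rewrite /derivable /derive.
have E : (fun s : R => s^-1 *: ((f \o shift (z + (t - a) *: v)) (s *: v) -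
     f (z + (t - a) *: v))) =
   (fun s : R => s^-1 *: (((fun s => f (z + (s - a) *: v)) \o shift t) (s *: 1) -
     f (z + (t - a) *: v))).
  apply/funext => s /=; congr (_ *: (f _ - _)).
  by rewrite [s *: 1]mulr1 addrCA -scalerDl addrA.
by apply: DeriveDef; rewrite /derivable /derive -E.
Qed.

(** Walk from [y] to [x] changing one coordinate at a time. In the supremum norm the whole walk
    stays in the ball around [p], where each partial derivative is within [eta] of its value at [p],
    and the mean value theorem applies to every step. *)
Lemma C1_sdiff_real N (U : set 'rV[R]_N) (f : 'rV[R]_N -> R) df p :
  open U -> U p ->
  (forall i : 'I_N, (forall x, U x -> derivable f x (delta_mx 0 i) /\
       'D_(delta_mx 0 i) f x = df i x) /\ {for p, continuous (df i)}) ->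
  sdiff setT p f (fun v => \sum_i v 0 i * df i p).
Proof.
move=> oU Up hf e e0.
pose eta := e / N.+1%:R.
have eta0 : 0 < eta by rewrite divr_gt0.
have : \forall x \near p, U x /\
    forall i : 'I_N, `|df i p - df i x| <= eta.
  apply: filterI; first exact: open_nbhs_nbhs.
  pose B (i : 'I_N) := [set x : 'rV[R]_N | `|df i p - df i x| <= eta].
  apply: (@filter_forall _ _ B (nbhs p) (nbhs_filter p)).
  move=> i.
  by have [_ /cvgrPdist_le] := hf i; apply.
move=> /nbhs_normP[d /= d0 hd]; exists d => // x y _ _ xp yp.
have hd' z : `|z - p| < d -> U z /\
    forall i : 'I_N, `|df i z - df i p| <= eta.
  move=> zp; have [|? h] := hd z; first by rewrite /= distrC.
  by split => // i; rewrite distrC.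
pose z k : 'rV[R]_N := \row_j (if (j < k)%N then x 0 j else y 0 j).
have z0 : z 0%N = y by apply/rowP => j; rewrite mxE.
have zN : z N = x by apply/rowP => j; rewrite mxE ltn_ord.
have step (k : 'I_N) : `|f (z k.+1) - f (z k) -
    df k p * (x 0 k - y 0 k)| <= eta * `|x - y|.
  pose g s := f (z k + (s - y 0 k) *: delta_mx 0 k).
  have coordE s j : (z k + (s - y 0 k) *: delta_mx 0 k) 0 j =
     if (j < k)%N then x 0 j else if j == k then s else y 0 j.
    rewrite !mxE eqxx/=; case: (eqVneq j k) => [->|jk].
      by rewrite ltnn mulr1 addrC subrK.
    by rewrite mulr0 addr0.
  have zS : f (z k.+1) = g (x 0 k).
    congr f; apply/rowP => j; rewrite coordE mxE ltnS leq_eqVlt.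
    case: (ltnP j k) => jk; first by rewrite orbT.
    by rewrite orbF; case: eqVneq => [/val_inj ->|]; rewrite -?val_eqE; case: eqP.
  have zk : f (z k) = g (y 0 k).
    congr f; apply/rowP => j; rewrite coordE mxE.
    by case: (ltnP j k) => // jk; case: eqP => // ->.
  have inball s : Num.min (x 0 k) (y 0 k) <= s <= Num.max (x 0 k) (y 0 k) ->
     `|z k + (s - y 0 k) *: delta_mx 0 k - p| < d.
    move=> hs; apply: (@le_lt_trans _ _ (Num.max `|x - p| `|y - p|)); last first.
      by rewrite gt_max xp yp.
    apply: mx_norm_le => [|i j]; first by rewrite le_max normr_ge0.
    rewrite ord1; move: (z k + _) (coordE s j) => w wE.
    rewrite !mxE wE; case: ifP => _.
      by rewrite le_max (le_trans _ (mx_entry_le _ 0 j)) // !mxE.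
    case: eqP => [->|_]; last first.
      by rewrite le_max orbC (le_trans _ (mx_entry_le _ 0 j)) // !mxE.
    have hx := mx_entry_le (x - p) 0 k; have hy := mx_entry_le (y - p) 0 k.
    rewrite !mxE in hx hy.
    have Hx : `|x 0 k - p 0 k| <= Num.max `|x - p| `|y - p| by rewrite le_max hx.
    have Hy : `|y 0 k - p 0 k| <= Num.max `|x - p| `|y - p| by rewrite le_max hy orbT.
    move: Hx Hy hs; move: (Num.max `|x - p| `|y - p|) => M.
    rewrite !ler_norml => /andP[? ?] /andP[? ?].
    by case: (leP (x 0 k) (y 0 k)) => ? /andP[? ?]; apply/andP; split; lra.
  rewrite zS zk; apply: le_trans (@mean_value_le g
    (fun t => df k (z k + (t - y 0 k) *: delta_mx 0 k)) _ _ _ _ _ _) _.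
  - move=> t /inball/hd'[Ut _]; have [dr <-] := (hf k).1 _ Ut.
    exact: is_derive_line.
  - by move=> t /inball/hd'[_ /(_ k)]; exact.
  - have := mx_entry_le (x - y) 0 k; rewrite !mxE => hxy.
    by apply: ler_wpM2l hxy; rewrite ltW.
have -> : f x - f y - \sum_i (x - y) 0 i * df i p =
   \sum_(k < N) (f (z k.+1) - f (z k) - df k p * (x 0 k - y 0 k)).
  rewrite sumrB -[X in _ = X - _](big_mkord xpredT (fun k => f (z k.+1) - f (z k))).
  rewrite telescope_sumr// z0 zN; congr (_ - _); apply: eq_bigr => i _.
  by rewrite !mxE mulrC.
rewrite (le_trans (ler_norm_sum _ _ _))// (le_trans (ler_sum _ (fun k _ => step k)))//.
rewrite sumr_const card_ord -mulr_natl mulrA ler_wpM2r//.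
rewrite /eta mulrCA -[leRHS]mulr1 ler_wpM2l ?ltW//.
by rewrite ltr_pdivrMr// mul1r ltr_nat.
Qed.

Lemma fin_delta (I : finType) (P : I -> R -> Prop) :
  (forall i, exists2 d, 0 < d & P i d) ->
  (forall i d d', d' <= d -> P i d -> P i d') ->
  exists2 d, 0 < d & forall i, P i d.
Proof.
move=> h mono.
have /choice[d hd] : forall i, exists d, 0 < d /\ P i d.
  by move=> i; have [d d0 Pd] := h i; exists d.
exists (\big[Num.min/1]_i d i) => [|i]; first by rewrite lt_bigmin// => i _; case: (hd i).
by apply: (mono _ (d i)); [exact: bigmin_le|case: (hd i)].
Qed.

Lemma Ck1_sdiff N p q (U : set 'rV[R]_N) (f : 'rV[R]_N -> 'M[R]_(p, q)) x :
  open U -> U x -> Ck 1 U f ->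
  sdiff setT x f (fun v => \sum_i v 0 i *: 'D_(delta_mx 0 i) f x).
Proof.
move=> oU Ux [_ hf] e e0.
have [d d0 hd] : exists2 d, 0 < d & forall k : 'I_p * 'I_q,
    forall y z, `|y - x| < d -> `|z - x| < d ->
    `|f y k.1 k.2 - f z k.1 k.2 -
       \sum_i (y - z) 0 i * 'D_(delta_mx 0 i) f x k.1 k.2| <= e * `|y - z|.
  apply: fin_delta => [[a b]/=|k d d' dd' h y z yx zx]; last first.
    by apply: h; apply: lt_le_trans dd'.
  have [|d d0 hd] := @C1_sdiff_real N U (fun y => f y a b)
     (fun i y => 'D_(delta_mx 0 i) f y a b) x oU Ux _ e e0; last first.
    by exists d => // y z yx zx; apply: hd.
  move=> i; have [h1 h2] := hf i; split.
    move=> y Uy; have := h1 y Uy => /[dup] /derivable_mxP dab df; split => //.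
    by rewrite derive_mx// mxE.
  have [h3 _] := h2; have {}h3 := h3 x Ux.
  exact: (continuous_comp h3 (@coord_continuous _ _ _ a b _)).
exists d => // y z _ _ yx zx.
apply: mx_norm_le => [|i j]; first by rewrite mulr_ge0// ltW.
have := hd (i, j) y z yx zx; congr (`| _ | <= _).
rewrite !mxE summxE; congr (_ - _); apply: eq_bigr => k _; by rewrite !mxE.
Qed.

Definition lin_bound (V W : normedModType R) (L : V -> W) (C : R) :=
  forall v, `|L v| <= C * `|v|.

Lemma sdiff_lip (V W : normedModType R) (A : set V) p (f L : V -> W) C :
  lin_bound L C -> sdiff A p f L ->
  exists2 d, 0 < d & forall x y, A x -> A y -> `|x - p| < d -> `|y - p| < d ->
    `|f x - f y| <= (C + 1) * `|x - y|.
Proof.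
move=> LC /(_ 1 ltr01)[d d0 h]; exists d => // x y Ax Ay xp yp.
rewrite -[f x - f y](subrK (L (x - y))) (le_trans (ler_normD _ _))//.
by rewrite addrC mulrDl lerD// h.
Qed.

Lemma sdiff_near (V W : normedModType R) (A : set V) p (f L : V -> W) C :
  lin_bound L C -> 0 <= C -> A p -> sdiff A p f L ->
  forall e, 0 < e -> exists2 d, 0 < d & forall x, A x -> `|x - p| < d ->
    `|f x - f p| < e.
Proof.
move=> LC C0 Ap /(sdiff_lip LC)[d d0 h] e e0.
have C1 : 0 < C + 1 by rewrite ltr_wpDl.
exists (Num.min d (e / (C + 1))) => [|x Ax].
  by rewrite lt_min d0 divr_gt0.
rewrite lt_min => /andP[xd xe]; rewrite (le_lt_trans (h _ _ _ _ _ _))//.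
  by rewrite subrr normr0.
by rewrite mulrC -ltr_pdivlMr.
Qed.

Lemma sdiff_comp (V W X : normedModType R) (A : set V) (B : set W) p
    (f L : V -> W) (g M : W -> X) C C' :
  lin_bound L C -> 0 <= C -> lin_bound M C' -> 0 <= C' ->
  (forall x y, M (x - y) = M x - M y) -> A p ->
  (exists2 d, 0 < d & forall x, A x -> `|x - p| < d -> B (f x)) ->
  sdiff A p f L -> sdiff B (f p) g M -> sdiff A p (g \o f) (M \o L).
Proof.
move=> LC C0 MC C'0 Mlin Ap [d0 d00 hB] fL gM e e0.
have [d1 d10 h1] := sdiff_lip LC fL.
have e1 : 0 < e / (2 * (C + 1)) by rewrite divr_gt0// mulr_gt0// ltr_wpDl.
have e2 : 0 < e / (2 * (C' + 1)) by rewrite divr_gt0// mulr_gt0// ltr_wpDl.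
have [r r0 hg] := gM _ e1.
have [d2 d20 h2] := sdiff_near LC C0 Ap fL r0.
have [d3 d30 h3] := fL _ e2.
exists (Num.min (Num.min d0 d1) (Num.min d2 d3)) => [|x y Ax Ay].
  by rewrite !lt_min d00 d10 d20.
rewrite !lt_min => /andP[/andP[x0 x1] /andP[x2 x3]] /andP[/andP[y0 y1] /andP[y2 y3]].
(* The error splits into the error of [g] between [f x] and [f y] and the image under [M] of the
   error of [f]; [e1] and [e2] make each at most half of the allowance. *)
rewrite /= -[X in `|X - _|](subrK (M (f x - f y))).
rewrite -addrA -Mlin (le_trans (ler_normD _ _))//.
have A1 : `|g (f x) - g (f y) - M (f x - f y)| <= e / 2 * `|x - y|.
  apply: (le_trans (hg _ _ (hB _ Ax x0) (hB _ Ay y0) (h2 _ Ax x2) (h2 _ Ay y2))).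
  apply: le_trans (ler_wpM2l (ltW e1) (h1 _ _ Ax Ay x1 y1)) _.
  by rewrite mulrA invfM mulrA mulrVK// unitfE gt_eqF// ltr_wpDl.
have A2 : `|M (f x - f y - L (x - y))| <= e / 2 * `|x - y|.
  apply: (le_trans (MC _)).
  apply: le_trans (ler_wpM2l C'0 (h3 _ _ Ax Ay x3 y3)) _.
  rewrite mulrA ler_wpM2r// mulrC invfM -!mulrA mulrA ler_piMr//; first by rewrite divr_ge0// ltW.
  by rewrite mulrC ler_pdivrMr ?ltr_wpDl// mul1r lerDl.
by rewrite [e]splitr mulrDl lerD.
Qed.

(* Only the derivative along segments of A issuing from p is determined. *)
Lemma sdiff_uniq (V W : normedModType R) (A : set V) p (f L L' : V -> W) v :
  (forall (t : R) v, L (t *: v) = t *: L v) ->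
  (forall (t : R) v, L' (t *: v) = t *: L' v) ->
  A p -> (forall t, 0 <= t <= 1 -> A (p + t *: v)) ->
  sdiff A p f L -> sdiff A p f L' -> L v = L' v.
Proof.
move=> Llin L'lin Ap Av fL fL'; apply/eqP; rewrite -subr_eq0 -normr_le0.
apply/ler_addgt0Pl => e e0; rewrite addr0.
have e1 : 0 < e / (2 * (`|v| + 1)) by rewrite divr_gt0// mulr_gt0// ltr_wpDl.
have [d d0 h] := fL _ e1; have [d' d'0 h'] := fL' _ e1.
pose t := Num.min 1 ((Num.min d d') / (`|v| + 1) / 2).
have v1 : 0 < `|v| + 1 by rewrite ltr_wpDl.
have t0 : 0 < t by rewrite lt_min ltr01 !divr_gt0// lt_min d0.
have tv : `|p + t *: v - p| < Num.min d d'.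
  rewrite addrC addKr normrZ gtr0_norm//.
  apply: (@le_lt_trans _ _ (Num.min d d' / (`|v| + 1) / 2 * (`|v| + 1))).
    by rewrite ler_pM ?(ltW t0)// ?lerDl// ge_min lexx orbT.
  rewrite mulrAC divfK ?gt_eqF// ltr_pdivrMr// ltr_pMr ?ltr1n//.
  by rewrite lt_min d0.
have pp : `|p - p| < Num.min d d' by rewrite subrr normr0 lt_min d0.
have At : A (p + t *: v) by apply: Av; rewrite ltW//= ge_min lexx.
move: tv pp; rewrite !lt_min => /andP[tv tv'] /andP[pp pp'].
have := h _ _ At Ap tv pp; have := h' _ _ At Ap tv' pp'.
rewrite [p + _ - p]addrAC subrr add0r Llin L'lin => H' H.
have : t * `|L v - L' v| <= t * e.
  rewrite -[X in X * `|_|](gtr0_norm t0) -normrZ scalerBr.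
  rewrite -[t *: L v](subrK (f (p + t *: v) - f p)) -addrA.
  apply: (le_trans (ler_normD _ _)); rewrite -normrN opprB.
  apply: (le_trans (lerD H H')); rewrite -mulrDl normrZ gtr0_norm//.
  have -> : (e / (2 * (`|v| + 1)) + e / (2 * (`|v| + 1))) * (t * `|v|) =
      t * (e * (`|v| / (`|v| + 1))) by field; rewrite gt_eqF.
  rewrite ler_wpM2l ?(ltW t0)// ler_piMr ?(ltW e0)//.
  by rewrite ler_pdivrMr// mul1r lerDl.
by rewrite ler_pM2l.
Qed.

Lemma sdiff_derive (V W : normedModType R) p (f L : V -> W) v :
  (forall (t : R) v, L (t *: v) = t *: L v) ->
  sdiff setT p f L -> 'D_v f p = L v.
Proof.
move=> Llin fL; apply: cvg_lim => //; apply/cvgrPdist_le => e e0.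
have v1 : 0 < `|v| + 1 by rewrite ltr_wpDl.
have [d d0 h] := fL _ (divr_gt0 e0 v1).
near=> t.
have tn0 : t != 0 by near: t; exact: nbhs_dnbhs_neq.
have tp : 0 < `|t| by rewrite normr_gt0.
have := h (t *: v + p) p I I; rewrite addrK subrr normr0 => /(_ _ d0).
rewrite Llin => {}h.
have -> : L v - t^-1 *: (f (t *: v + p) - f p) =
    - (t^-1 *: (f (t *: v + p) - f p - t *: L v)).
  by rewrite [in RHS]scalerBr scalerA mulVf// scale1r opprB.
rewrite normrN normrZ normfV ler_pdivrMl//.
apply: le_trans (h _) _.
  rewrite normrZ (@le_lt_trans _ _ (`|t| * (`|v| + 1)))//.
    by rewrite ler_wpM2l// lerDl.
  rewrite -ltr_pdivlMr//; near: t; apply: dnbhs0_lt.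
  by rewrite divr_gt0.
rewrite normrZ mulrCA ler_wpM2l// mulrAC -mulrA ler_piMr ?(ltW e0)//.
by rewrite ler_pdivrMr// mul1r lerDl.
Unshelve. all: by end_near. Qed.

Lemma mulmx_lin_bound m n (A : 'M[R]_(m, n)) :
  lin_bound (fun v : 'rV[R]_m => v *m A) (m%:R * `|A|).
Proof. by move=> v; rewrite (le_trans (mulmx_norm_le _ _))// mulrAC. Qed.

Lemma sum_delta_mulmx m n (D : 'I_m -> 'rV[R]_n) (v : 'rV[R]_m) :
  \sum_i v 0 i *: D i = v *m \matrix_i D i.
Proof.
by rewrite mulmx_sum_row; apply: eq_bigr => i _; rewrite rowK.
Qed.

End StrictDifferentiability.

(** * Pfaffians *)

Section Pfaffian.
Variable R : realType.

(** For alternating matrices this is the usual Pfaffian times the factorial of [n], the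
    normalisation of [wedge_power]; only its sign will matter. *)
Definition pf n (G : 'M[R]_n.*2) : R :=
  (2 ^+ n)^-1 * \sum_(p : 'S_n.*2) (-1) ^+ p *
    \prod_(i < n) G (p (ord_even i)) (p (ord_odd i)).

Lemma wedge_powerE N n (w : 'M[R]_N) (u : 'I_n.*2 -> 'rV[R]_N) :
  wedge_power w u = pf (\matrix_(i, j) form_eval w (u i) (u j)).
Proof.
congr (_ * _); apply: eq_bigr => p _; congr (_ * _).
by apply: eq_bigr => i _; rewrite mxE.
Qed.

Lemma prod_nat_double (n : nat) (F : nat -> R) :
  \prod_(j < n.*2) F j = \prod_(i < n) (F i.*2 * F i.*2.+1).
Proof.
by elim: n => [|n IH]; rewrite ?big_ord0// doubleS !big_ord_recr/= IH mulrA.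
Qed.

Lemma prod_ord_double (n : nat) (F : 'I_n.*2 -> R) :
  \prod_j F j = \prod_i (F (ord_even i) * F (ord_odd i)).
Proof.
pose F' k := if insub k is Some j then F j else 1.
have F'E j : F' (nat_of_ord j) = F j by rewrite /F' valK.
transitivity (\prod_(j < n.*2) F' j); first by apply: eq_bigr => j _; rewrite F'E.
rewrite prod_nat_double; apply: eq_bigr => i _.
by rewrite -(F'E (ord_even i)) -(F'E (ord_odd i)).
Qed.

Lemma half_ord_subproof n (j : 'I_n.*2) : (j./2 < n)%N.
Proof. by rewrite ltn_half_double. Qed.
Definition half_ord n (j : 'I_n.*2) : 'I_n := Ordinal (half_ord_subproof j).

Lemma half_ord_even n (i : 'I_n) : half_ord (ord_even i) = i.
Proof. by apply: val_inj => /=; rewrite doubleK. Qed.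

Lemma half_ord_odd n (i : 'I_n) : half_ord (ord_odd i) = i.
Proof. by apply: val_inj => /=; rewrite uphalf_double. Qed.

Lemma ord_evenK n (j : 'I_n.*2) : ~~ odd j -> ord_even (half_ord j) = j.
Proof. by move=> oj; apply: val_inj => /=; rewrite even_halfK. Qed.

Lemma ord_oddK n (j : 'I_n.*2) : odd j -> ord_odd (half_ord j) = j.
Proof. by move=> oj; apply: val_inj => /=; rewrite odd_halfK//; case: (nat_of_ord j) oj. Qed.

Lemma det_colsel n (A : 'M[R]_n) (s : 'S_n) :
  \det (\matrix_(i, j) A i (s j)) = (-1) ^+ s * \det A.
Proof.
rewrite (_ : (\matrix_(i, j) _) = col_perm s A); last by apply/matrixP => i j; rewrite !mxE.
by rewrite col_permE det_mulmx det_perm odd_permV mulrC.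
Qed.

(** As in the proof that determinants multiply: expanding the products gives a sum over all maps [f]
    of the index set, and summing over [p] first produces the determinant of the columns of [A]
    selected by [f]. It vanishes unless [f] is a permutation, and then it is [\det A] up to sign. *)
Lemma pf_congr n (A G : 'M[R]_n.*2) : pf (A *m G *m A^T) = \det A * pf G.
Proof.
rewrite /pf mulrCA; congr (_ * _).
pose I := 'I_n.*2; pose F := {ffun I -> I}.
have S1 (p : 'S_n.*2) :
    \prod_(i < n) (A *m G *m A^T) (p (ord_even i)) (p (ord_odd i)) =
    \sum_(f : F) \prod_(i < n) G (f (ord_even i)) (f (ord_odd i)) *
       \prod_j A (p j) (f j).
  pose T i (kl : I * I) := A (p (ord_even i)) kl.1 * G kl.1 kl.2 *
     A (p (ord_odd i)) kl.2.
  transitivity (\prod_(i < n) \sum_kl T i kl).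
    apply: eq_bigr => i _; rewrite mxE.
    rewrite -(pair_bigA _ (fun k l => T i (k, l)))/= exchange_big/=.
    apply: eq_bigr => l _; rewrite !mxE mulr_suml.
    by apply: eq_bigr => k _.
  (* A choice of two indices for each of the [n] factors is a map on [2n] indices, read two at a
     time. *)
  rewrite bigA_distr_bigA/= (reindex (fun f : F => [ffun i => (f (ord_even i), f (ord_odd i))]))/=.
    apply: eq_bigr => f _; rewrite prod_ord_double -big_split/=.
    by apply: eq_bigr => i _; rewrite ffunE /T/=; ring.
  exists (fun g : {ffun 'I_n -> I * I} =>
      [ffun j : 'I_n.*2 => if odd j then (g (half_ord j)).2 else (g (half_ord j)).1]).
    move=> f _; apply/ffunP => j; rewrite !ffunE/=.
    by case: ifPn => oj; [rewrite ord_oddK|rewrite ord_evenK].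
  move=> g _; apply/ffunP => i; rewrite !ffunE/= odd_double/=.
  by rewrite half_ord_even half_ord_odd -surjective_pairing.
under eq_bigr => p _ do rewrite S1 mulr_sumr.
rewrite exchange_big/=.
have S2 (f : F) : \sum_(p : 'S_n.*2) (-1) ^+ p *
    (\prod_(i < n) G (f (ord_even i)) (f (ord_odd i)) * \prod_j A (p j) (f j)) =
    \prod_(i < n) G (f (ord_even i)) (f (ord_odd i)) * \det (\matrix_(i, j) A i (f j)).
  rewrite -det_tr /determinant mulr_sumr; apply: eq_bigr => p _.
  rewrite mulrCA; congr (_ * (_ * _)).
  by apply: eq_bigr => j _; rewrite !mxE.
under eq_bigr => f _ do rewrite S2.
rewrite (bigID (fun f : F => injectiveb f)) /= addrC big1 ?add0r => [|f Uf]; last first.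
  case/injectivePn: Uf => i1 [i2 Di12 Ef12].
  rewrite -det_tr (determinant_alternate Di12) ?mulr0// => j.
  by rewrite !mxE Ef12.
rewrite (reindex (@pval _)) /=; last first.
  pose in_Sn := insubd (1%g : 'S_n.*2).
  by exists in_Sn => /= f Uf; first apply: val_inj; apply: insubdK.
rewrite mulr_sumr; apply: eq_big => /= [s | s _]; rewrite ?(valP s) //.
have -> : (\matrix_(i, j) A i (pval s j)) = \matrix_(i, j) A i (s j).
  by apply/matrixP => i j; rewrite !mxE pvalE.
rewrite det_colsel mulrA mulrC; congr (_ * _); rewrite mulrC; congr (_ * _).
by apply: eq_bigr => i _; rewrite pvalE.
Qed.

(* The entries of the standard symplectic matrix. *)
Definition Jent (i j : nat) : R :=
  if i./2 == j./2 then (odd j)%:R - (odd i)%:R else 0.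

(** Separates the pairs inside one block [{2i, 2i+1}] from the four pairs joining two blocks, the
    grouping in which the sign of a Vandermonde product can be read off. *)
Lemma prod_lt_double n (F : 'I_n.*2 -> 'I_n.*2 -> R) :
  \prod_(a < n.*2) \prod_(b < n.*2 | (a < b)%N) F a b =
  \prod_(i < n) (F (ord_even i) (ord_odd i) * \prod_(k < n | (i < k)%N)
    ((F (ord_even i) (ord_even k) * F (ord_even i) (ord_odd k)) *
     (F (ord_odd i) (ord_even k) * F (ord_odd i) (ord_odd k)))).
Proof.
rewrite prod_ord_double; apply: eq_bigr => i _.
rewrite big_split/= mulrA.
have even_part : \prod_(b < n.*2 | (ord_even i < b)%N) F (ord_even i) b =
    F (ord_even i) (ord_odd i) * \prod_(k < n | (i < k)%N)
    (F (ord_even i) (ord_even k) * F (ord_even i) (ord_odd k)).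
  rewrite big_mkcond prod_ord_double/= (bigD1 i)//= ltnn ltnSn mul1r; congr (_ * _).
  rewrite big_mkcond [RHS]big_mkcond; apply: eq_bigr => k _/=.
  case: (eqVneq k i) => [->|ki]; first by rewrite (ltnn i).
  have kin : k != i :> nat by rewrite val_eqE.
  case: (ltnP i k) => ik; first by rewrite !ifT//; lia.
  by rewrite ifN ?ifN ?mulr1//; lia.
have odd_part : \prod_(b < n.*2 | (ord_odd i < b)%N) F (ord_odd i) b =
    \prod_(k < n | (i < k)%N) (F (ord_odd i) (ord_even k) * F (ord_odd i) (ord_odd k)).
  rewrite big_mkcond prod_ord_double/= [RHS]big_mkcond; apply: eq_bigr => k _/=.
  case: (ltnP i k) => ik; first by rewrite !ifT//; lia.
  by rewrite ifN ?ifN ?mulr1//; lia.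
by rewrite even_part odd_part.
Qed.

(* The sign of [p] is that of its Vandermonde product; when the Jent product does not vanish,
   [p] permutes the pairs {2k, 2k+1}, so the factors of that product coming from two distinct
   pairs multiply to a square. *)
Lemma Jterm_ge0 n (p : 'S_n.*2) :
  0 <= (-1) ^+ p * \prod_(i < n) Jent (p (ord_even i)) (p (ord_odd i)).
Proof.
have [/existsP[i /eqP J0]|] := boolP [exists i : 'I_n,
   Jent (p (ord_even i)) (p (ord_odd i)) == 0].
  by rewrite (bigD1 i)//= J0 mul0r mulr0.
rewrite negb_exists => /forallP hJ.
have hp i : (p (ord_even i))./2 = (p (ord_odd i))./2.
  by apply/eqP; move: (hJ i); apply: contraNT; rewrite /Jent => /negbTE ->.
pose x : 'rV[R]_n.*2 := \row_j j%:R.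
pose V := \prod_(a < n.*2) \prod_(b < n.*2 | (a < b)%N) (x 0 b - x 0 a).
have V0 : 0 < V.
  by apply: prodr_gt0 => a _; apply: prodr_gt0 => b ab; rewrite !mxE subr_gt0 ltr_nat.
have VE : (-1) ^+ p * V = \prod_(a < n.*2) \prod_(b < n.*2 | (a < b)%N)
    ((p b)%:R - (p a)%:R).
  rewrite /V -det_Vandermonde -det_colsel.
  pose y : 'rV[R]_n.*2 := \row_j (p j)%:R.
  rewrite (_ : (\matrix_(i, j) _) = Vandermonde n.*2 y); last first.
    by apply/matrixP => i j; rewrite !mxE.
  rewrite det_Vandermonde; apply: eq_bigr => a _; apply: eq_bigr => b _.
  by rewrite !mxE.
rewrite -(pmulr_lge0 _ V0) mulrAC VE prod_lt_double -big_split/=.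
apply: prodr_ge0 => i _; rewrite mulrAC; apply: mulr_ge0.
  rewrite /Jent hp eqxx.
  have : p (ord_even i) != p (ord_odd i).
    by rewrite (inj_eq perm_inj) -val_eqE/= neq_ltn ltnSn.
  rewrite -val_eqE/=.
  rewrite -(odd_double_half (p (ord_even i))) -(odd_double_half (p (ord_odd i))) hp.
  rewrite !oddD !odd_double !addbF !oddb eqn_add2r.
  case: (odd _); case: (odd _) => //= _; rewrite ?add1n ?add0n -natr1.
    by rewrite opprD addrA subrr !sub0r mulrNN mulr1 ler01.
  by rewrite addrAC subrr add0r subr0 mulr1 ler01.
apply: prodr_ge0 => k ik.
set a := nat_of_ord (p (ord_even i)); set b := nat_of_ord (p (ord_odd i)).
set c := nat_of_ord (p (ord_even k)); set d := nat_of_ord (p (ord_odd k)).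
have ac : a./2 <> c./2.
  have ne (u v : 'I_n.*2) : u != v :> nat -> p u <> p v :> nat.
    by move=> uv /eqP; rewrite val_eqE (inj_eq perm_inj) -val_eqE (negbTE uv).
  have h1 : a <> b by apply: ne; rewrite /=; lia.
  have h2 : a <> c by apply: ne; rewrite /=; lia.
  have h3 : b <> c by apply: ne; rewrite /=; lia.
  have := hp i; rewrite -/a -/b; lia.
have ab : a./2 = b./2 by exact: hp.
have cd : c./2 = d./2 by exact: hp.
have [lt|gt] : (a < c /\ a < d /\ b < c /\ b < d)%N \/ (c < a /\ c < b /\ d < a /\ d < b)%N.
  lia.
- by rewrite !mulr_ge0// subr_ge0 ler_nat ltnW//; case: lt => ? [? []].
- by rewrite mulr_ge0// mulr_le0// subr_le0 ler_nat ltnW//; case: gt => ? [? []].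
Qed.

(** No term is negative by [Jterm_ge0], and the identity contributes 1. *)
Lemma pfJ_gt0 n : 0 < pf (\matrix_(i < n.*2, j < n.*2) Jent i j).
Proof.
rewrite /pf mulr_gt0 ?invr_gt0 ?exprn_gt0// (bigD1 1%g)//= ltr_pwDl//.
  rewrite odd_perm1 expr0 mul1r; apply: prodr_gt0 => i _.
  by rewrite !mxE !perm1 /Jent/= uphalf_double doubleK eqxx/= odd_double subr0 ltr01.
apply: sumr_ge0 => p _; have := Jterm_ge0 p.
by under [X in _ -> 0 <= _ * X]eq_bigr => i _ do rewrite mxE.
Qed.

Section FormEval.
Variables (m : nat) (w : 'M[R]_m).
Implicit Types u v : 'rV[R]_m.

Lemma form_evalDr u v v' : form_eval w u (v + v') = form_eval w u v + form_eval w u v'.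
Proof. by rewrite /form_eval linearD mulmxDr mxE. Qed.

Lemma form_evalZl a u v : form_eval w (a *: u) v = a * form_eval w u v.
Proof. by rewrite /form_eval -!scalemxAl mxE. Qed.

Lemma form_evalZr a u v : form_eval w u (a *: v) = a * form_eval w u v.
Proof. by rewrite /form_eval linearZ -scalemxAr mxE. Qed.

Lemma form_evalBl u u' v : form_eval w (u - u') v = form_eval w u v - form_eval w u' v.
Proof. by rewrite /form_eval !mulmxBl !mxE. Qed.

Lemma form_evalBr u v v' : form_eval w u (v - v') = form_eval w u v - form_eval w u v'.
Proof. by rewrite /form_eval linearB mulmxBr !mxE. Qed.

Lemma form_eval0l v : form_eval w 0 v = 0.
Proof. by rewrite /form_eval !mul0mx mxE. Qed.

Lemma form_eval_suml I (s : seq I) (F : I -> 'rV[R]_m) v :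
  form_eval w (\sum_(i <- s) F i) v = \sum_(i <- s) form_eval w (F i) v.
Proof. by rewrite /form_eval !mulmx_suml summxE. Qed.

Lemma form_eval_sumr I (s : seq I) (F : I -> 'rV[R]_m) u :
  form_eval w u (\sum_(i <- s) F i) = \sum_(i <- s) form_eval w u (F i).
Proof. by rewrite /form_eval linear_sum mulmx_sumr summxE. Qed.

Lemma form_evalC u v : alternating w -> form_eval w v u = - form_eval w u v.
Proof.
move=> aw; rewrite /form_eval -[v *m w *m u^T]trmxK mxE !trmx_mul trmxK aw.
by rewrite mulNmx mulmxN mulmxA mxE.
Qed.

Lemma form_evalxx u : alternating w -> form_eval w u u = 0.
Proof. by move=> aw; have := form_evalC u u aw; lra. Qed.

End FormEval.

Lemma form_eval_mul k m (A : 'M[R]_(k, m)) (w : 'M[R]_m) u v :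
  form_eval (A *m w *m A^T) u v = form_eval w (u *m A) (v *m A).
Proof. by rewrite /form_eval trmx_mul !mulmxA. Qed.

Lemma gram_mx k m (A : 'M[R]_(k, m)) (w : 'M[R]_m) :
  A *m w *m A^T = \matrix_(i, j) form_eval w (row i A) (row j A).
Proof.
apply/matrixP => i j; rewrite [RHS]mxE /form_eval -row_mul tr_row !mxE.
by apply: eq_bigr => l _; rewrite !mxE.
Qed.

Definition partner (l : nat) : nat := if odd l then l.-1 else l.+1.

Lemma JentN i j : Jent j i = - Jent i j.
Proof. by rewrite /Jent eq_sym; case: eqP => _; rewrite ?oppr0 ?opprB. Qed.

(** Symplectic Gram-Schmidt process, adding a pair [x], [z] at each step. *)
Lemma symplectic_family m (w : 'M[R]_m) k :
  alternating w -> w \in unitmx -> (k.*2 <= m)%N ->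
  exists u : nat -> 'rV[R]_m, forall i j, (i < k.*2)%N -> (j < k.*2)%N ->
    form_eval w (u i) (u j) = Jent i j.
Proof.
move=> aw uw; elim: k => [|k IH] km; first by exists (fun=> 0).
have [|u hu] := IH; first by rewrite (leq_trans _ km)// doubleS; lia.
pose B : 'M[R]_(m, k.*2) := w *m (\matrix_(j < k.*2) u j)^T.
(* Fewer than [m] linear conditions leave a nonzero vector orthogonal to all the [u j]. *)
have /rowV0Pn[x /sub_kermxP xB x0] : kermx B != 0.
  rewrite -mxrank_eq0 mxrank_ker subn_eq0 -ltnNge.
  by rewrite (leq_ltn_trans (rank_leq_col _))// (leq_trans _ km)// doubleS; lia.
have xu j : (j < k.*2)%N -> form_eval w x (u j) = 0.
  move=> jk; have /rowP/(_ (Ordinal jk)) := xB.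
  rewrite /B mulmxA !mxE => xB0; rewrite /form_eval mxE -[RHS]xB0.
  by apply: eq_bigr => l _; rewrite !mxE.
have ux j : (j < k.*2)%N -> form_eval w (u j) x = 0.
  by move=> jk; rewrite form_evalC// xu// oppr0.
have [j xwj] : exists j, (x *m w) 0 j != 0.
  apply/existsP; apply: contraNT x0; rewrite negb_exists => /forallP h.
  rewrite -(mulmxK uw x) (_ : x *m w = 0) ?mul0mx//.
  by apply/rowP => j; have /negPn/eqP -> := h j; rewrite mxE.
pose z0 : 'rV[R]_m := ((x *m w) 0 j)^-1 *: delta_mx 0 j.
have xz0 : form_eval w x z0 = 1.
  rewrite form_evalZr /form_eval trmx_delta -colE.
  by rewrite [col _ _ _ _]mxE mulVf.
(* Against [u i] only the summand of index [partner i] survives, and the sign in [c] makes it cancel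
   [form_eval w (u i) z0]. *)
pose c l : R := (-1) ^+ l * form_eval w (u (partner l)) z0.
pose z := z0 + \sum_(l < k.*2) c l *: u l.
have uz i : (i < k.*2)%N -> form_eval w (u i) z = 0.
  move=> ik; have pik : (partner i < k.*2)%N.
    by rewrite /partner; case: ifP => oi; lia.
  rewrite form_evalDr form_eval_sumr (bigD1 (Ordinal pik))//= big1 => [|l lp].
    rewrite form_evalZr hu// addr0 /c.
    have -> : partner (partner i) = i by rewrite /partner; do 2!case: ifP; lia.
    rewrite /Jent /partner -[X in X ^+ _]/(-1) -signr_odd; case: ifP => oi.
      have -> : (i./2 == i.-1./2) by apply/eqP; lia.
      have -> : odd i.-1 = false by lia.
      by rewrite ?oi /= ?expr0 ?expr1; lra.
    have -> : (i./2 == i.+1./2) by apply/eqP; lia.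
    have -> : odd i.+1 = true by lia.
    by rewrite ?oi /= ?expr0 ?expr1; lra.
  rewrite form_evalZr hu// /Jent; case: eqP => [il|]; last by rewrite mulr0.
  have -> : odd l = odd i; last by rewrite subrr mulr0.
  move: lp; rewrite -val_eqE/= /partner; case: ifP => oi; lia.
have zu i : (i < k.*2)%N -> form_eval w z (u i) = 0.
  by move=> ik; rewrite form_evalC// uz// oppr0.
have xz : form_eval w x z = 1.
  rewrite form_evalDr xz0 form_eval_sumr big1 ?addr0// => l _.
  by rewrite form_evalZr xu// mulr0.
pose u' i := if (i < k.*2)%N then u i else if i == k.*2 then x else z.
exists u' => a b; rewrite doubleS => ak bk; rewrite /u'.
have J0 i j' : (i < k.*2)%N -> (k.*2 <= j')%N -> Jent i j' = 0.
  by move=> ik jk; rewrite /Jent ifN//; lia.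
case: (ltnP a k.*2) => a2; case: (ltnP b k.*2) => b2.
- exact: hu.
- by rewrite J0//; case: ifP => _; [exact: ux|exact: uz].
- by rewrite JentN J0// oppr0; case: ifP => _; [exact: xu|exact: zu].
have [->|->] : a = k.*2 \/ a = k.*2.+1 by lia.
  have [->|->] : b = k.*2 \/ b = k.*2.+1 by lia.
    by rewrite eqxx form_evalxx// /Jent eqxx subrr.
  rewrite eqxx ifN; last by lia.
  by rewrite xz /Jent/= uphalf_double doubleK eqxx/= odd_double subr0.
have [->|->] : b = k.*2 \/ b = k.*2.+1 by lia.
  rewrite eqxx ifN; last by lia.
  rewrite form_evalC// xz /Jent/= uphalf_double doubleK eqxx/= odd_double.
  by rewrite sub0r.
rewrite ifN; last by lia.
by rewrite form_evalxx// /Jent eqxx subrr.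
Qed.

(** A symplectic basis turns [w] into the standard matrix, where the value is positive; [pf_congr]
    carries this back, without comparing the Pfaffian with the determinant of [w]. *)
Lemma pf_neq0 n (w : 'M[R]_n.*2) : alternating w -> w \in unitmx -> pf w != 0.
Proof.
move=> aw uw; have [u hu] := symplectic_family aw uw (leqnn _).
pose A : 'M[R]_n.*2 := \matrix_i u i.
have := pf_congr A w; rewrite gram_mx.
have -> : \matrix_(i, j) form_eval w (row i A) (row j A) =
    \matrix_(i < n.*2, j < n.*2) Jent i j.
  by apply/matrixP => i j; rewrite !mxE !rowK hu.
by move=> e; apply/eqP => w0; have := pfJ_gt0 n; rewrite e w0 mulr0 ltxx.
Qed.

End Pfaffian.

(** * Integration over triangles by midpoint subdivision *)

Section TriangleIntegral.
Variables (R : realType) (V : normedModType R).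
Implicit Types (A : set V) (Phi Psi : V -> V -> V -> R) (a b c d p x y : V).

(** Lebesgue's lemma for radii [r p] that need not depend continuously on [p]. Halving the radii of
    the cover leaves room for the ball around [x]. *)
Lemma lebesgue_number A (r : V -> R) :
  compact A -> (forall p, A p -> 0 < r p) ->
  exists2 d0, 0 < d0 & forall x, A x ->
    exists2 p, A p & forall y, `|y - x| < d0 -> `|y - p| < r p.
Proof.
move=> /compact_near_coveringP cA r0.
pose P (d : R) x := exists2 p, A p & forall y, `|y - x| < d -> `|y - p| < r p.
have : \forall d \near 0^'+, A `<=` P d.
  apply: cA => p Ap.
  exists ([set x | `|p - x| < r p / 2], [set d : R | d < r p / 2]).
    split=> /=; first by apply/nbhs_normP; exists (r p / 2); rewrite /= ?divr_gt0 ?r0.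
    by apply: nbhs_right_lt; rewrite divr_gt0// r0.
  move=> [x d] /= [xp dp]; exists p => // y yx.
  rewrite -(subrK x y) -addrA (le_lt_trans (ler_normD _ _))// [r p]splitr.
  by rewrite ltrD// ?(lt_trans yx)// distrC.
move=> h; have [d [d0 hd]] : exists d : R, 0 < d /\ A `<=` P d.
  by apply: (@filter_ex _ (0^'+ : set_system R)); apply: filterI => //; exact: nbhs_right_gt.
by exists d => // x /hd.
Qed.

Definition mid x y : V := 2^-1 *: (x + y).

Lemma midC x y : mid x y = mid y x. Proof. by rewrite /mid addrC. Qed.

Lemma midBl x y z : mid x y - mid x z = 2^-1 *: (y - z).
Proof. by rewrite /mid -scalerBr opprD addrACA subrr add0r. Qed.

Lemma midBr x y z : mid y x - mid z x = 2^-1 *: (y - z).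
Proof. by rewrite !(midC _ x) midBl. Qed.

Lemma midx x : mid x x = x.
Proof. by rewrite /mid scalerDr -scalerDl -div1r -splitr scale1r. Qed.

Lemma midB1 x y : mid x y - x = 2^-1 *: (y - x).
Proof. by rewrite -{2}(midx x) midBl. Qed.

Lemma midB2 x y : y - mid x y = 2^-1 *: (y - x).
Proof. by rewrite -{1}(midx y) midBr. Qed.

Definition midB := (midBl, midBr, midB1, midB2).

Definition mid_closed A := forall x y, A x -> A y -> A (mid x y).

(** The order [ab, ac, bc] of the central triangle gives it steps that are halves of [c - b] and
    [b - a]; this order reverses its orientation, whence the minus sign. *)
Definition subdiv Phi a b c :=
  Phi a (mid a b) (mid a c) + Phi (mid a b) b (mid b c) +
  Phi (mid a c) (mid b c) c - Phi (mid a b) (mid a c) (mid b c).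

(* All triangles and tetrahedra are listed along an edge path, whose steps are
   halved by the subdivision; hence the shapes do not degenerate. *)
Definition path2_le (l : R) a b c := `|b - a| <= l /\ `|c - b| <= l.
Definition path3_le (l : R) a b c d := path2_le l a b c /\ `|d - c| <= l.

Lemma half_norm_le (l : R) x : `|x| <= l -> `|2^-1 *: x| <= l / 2.
Proof. by move=> h; rewrite normrZ gtr0_norm// mulrC ler_wpM2r. Qed.

(** Four triangles of half the size give [4 * (l / 2) ^+ 2 = l ^+ 2]: a quadratic bound known at
    small scale holds, with the same constant, for the subdivision of a large triangle. *)
Lemma iter_subdiv_le A Phi (e l0 : R) k (l : R) a b c :
  mid_closed A ->
  (forall a b c l, A a -> A b -> A c -> l <= l0 -> path2_le l a b c ->
     `|Phi a b c| <= e * l ^+ 2) ->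
  A a -> A b -> A c -> l <= l0 * 2 ^+ k -> path2_le l a b c ->
  `|iter k subdiv Phi a b c| <= e * l ^+ 2.
Proof.
move=> mA h; elim: k l a b c => [|k IH] l a b c Aa Ab Ac.
  by rewrite expr0 mulr1 => ll0; exact: h.
move=> ll0 [ab bc] /=.
have hl : l / 2 <= l0 * 2 ^+ k by rewrite ler_pdivrMr// -mulrA -exprSr.
have Aab := mA _ _ Aa Ab; have Aac := mA _ _ Aa Ac; have Abc := mA _ _ Ab Ac.
have E : e * l ^+ 2 = e * (l / 2) ^+ 2 + e * (l / 2) ^+ 2 + e * (l / 2) ^+ 2 +
  e * (l / 2) ^+ 2 by field.
rewrite /subdiv E (le_trans (ler_normB _ _))// lerD//; last first.
  by apply: IH => //; split; rewrite ?midB half_norm_le.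
rewrite (le_trans (ler_normD _ _))// lerD//; last first.
  by apply: IH => //; split; rewrite ?midB half_norm_le.
rewrite (le_trans (ler_normD _ _))// lerD//.
  by apply: IH => //; split; rewrite ?midB half_norm_le.
by apply: IH => //; split; rewrite ?midB half_norm_le.
Qed.

Lemma iter_subdivB Phi Psi k a b c :
  iter k subdiv (fun a b c => Phi a b c - Psi a b c) a b c =
  iter k subdiv Phi a b c - iter k subdiv Psi a b c.
Proof.
elim: k a b c => // k IH a b c; rewrite /= /subdiv !IH; ring.
Qed.

Lemma iter_subdiv_id (B : V -> V -> V -> R) k :
  (forall a b c, subdiv B a b c = B a b c) -> iter k subdiv B = B.
Proof.
move=> h; elim: k => //= k ->.
by apply/funext => a; apply/funext => b; apply/funext => c.
Qed.

Definition cobd Phi a b c d := Phi b c d - Phi a c d + Phi a b d - Phi a b c.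

(* Freudenthal's subdivision of a tetrahedron with the interior edge joining
   the midpoints of ac and bd. *)
Lemma cobd_subdiv Phi a b c d :
  let ab := mid a b in let ac := mid a c in let ad := mid a d in
  let bc := mid b c in let bd := mid b d in let cd := mid c d in
  cobd (subdiv Phi) a b c d =
  cobd Phi a ab ac ad + cobd Phi ab b bc bd + cobd Phi ac bc c cd +
  cobd Phi ad bd cd d + cobd Phi ab ac ad bd - cobd Phi ab ac bc bd +
  cobd Phi ac ad bd cd - cobd Phi ac bc bd cd.
Proof. rewrite /cobd /subdiv /=; ring. Qed.

Lemma norm_sum8 (x1 x2 x3 x4 x5 x6 x7 x8 E : R) :
  `|x1| <= E -> `|x2| <= E -> `|x3| <= E -> `|x4| <= E ->
  `|x5| <= E -> `|x6| <= E -> `|x7| <= E -> `|x8| <= E ->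
  `|x1 + x2 + x3 + x4 + x5 - x6 + x7 - x8| <= E + E + E + E + E + E + E + E.
Proof.
rewrite !ler_norml => /andP[? ?] /andP[? ?] /andP[? ?] /andP[? ?].
move=> /andP[? ?] /andP[? ?] /andP[? ?] /andP[? ?].
by apply/andP; split; lra.
Qed.

(** The same invariance one dimension higher, with eight tetrahedra and
    [8 * (l / 2) ^+ 3 = l ^+ 3]. *)
Lemma iter_cobd_le A Phi (e l0 : R) k (l : R) a b c d :
  mid_closed A ->
  (forall a b c d l, A a -> A b -> A c -> A d -> l <= l0 -> path3_le l a b c d ->
     `|cobd Phi a b c d| <= e * l ^+ 3) ->
  A a -> A b -> A c -> A d -> l <= l0 * 2 ^+ k -> path3_le l a b c d ->
  `|cobd (iter k subdiv Phi) a b c d| <= e * l ^+ 3.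
Proof.
move=> mA h; elim: k l a b c d => [|k IH] l a b c d Aa Ab Ac Ad.
  by rewrite expr0 mulr1 => ll0; exact: h.
move=> ll0 [[ab bc] cd] /=; rewrite cobd_subdiv.
have hl : l / 2 <= l0 * 2 ^+ k by rewrite ler_pdivrMr// -mulrA -exprSr.
have Aab := mA _ _ Aa Ab; have Aac := mA _ _ Aa Ac; have Abc := mA _ _ Ab Ac.
have Aad := mA _ _ Aa Ad; have Abd := mA _ _ Ab Ad; have Acd := mA _ _ Ac Ad.
pose E := e * (l / 2) ^+ 3.
have -> : e * l ^+ 3 = E + E + E + E + E + E + E + E by rewrite /E; field.
have K a' b' c' d' : A a' -> A b' -> A c' -> A d' ->
    `|b' - a'| <= l / 2 -> `|c' - b'| <= l / 2 -> `|d' - c'| <= l / 2 ->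
    `|cobd (iter k subdiv Phi) a' b' c' d'| <= E.
  by move=> *; apply: IH.
by apply: norm_sum8; apply: K => //; rewrite ?midB half_norm_le.
Qed.

Definition tri_int Phi a b c := limn (fun k => iter k subdiv Phi a b c).

Definition loc_approx A Phi (B : V -> V -> V -> V -> R) :=
  forall p, A p -> forall e, 0 < e -> exists2 r, 0 < r &
    forall a b c, A a -> A b -> A c -> `|a - p| < r -> `|b - p| < r ->
    `|c - p| < r -> forall l, path2_le l a b c -> `|Phi a b c - B p a b c| <= e * l ^+ 2.

Definition loc_closed A Phi :=
  forall p, A p -> forall e, 0 < e -> exists2 r, 0 < r &
    forall a b c d, A a -> A b -> A c -> A d -> `|a - p| < r -> `|b - p| < r ->
    `|c - p| < r -> `|d - p| < r ->
    forall l, path3_le l a b c d -> `|cobd Phi a b c d| <= e * l ^+ 3.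

Lemma mid_closed_ball A p r :
  mid_closed A -> mid_closed [set x | A x /\ `|x - p| < r].
Proof.
move=> mA x y [Ax xp] [Ay yp]; split; first exact: mA.
have -> : mid x y - p = 2^-1 *: (x - p) + 2^-1 *: (y - p).
  by rewrite -scalerDr addrACA -opprD scalerBr -/(mid p p) midx.
rewrite (le_lt_trans (ler_normD _ _))// !normrZ gtr0_norm// -mulrDr.
by rewrite mulrC ltr_pdivrMr// mulr_natr mulr2n ltrD.
Qed.

(** [B] is fixed by [subdiv], which is linear, so the error itself is being subdivided; balls are
    stable under midpoints, so the subdivision never leaves the region where the error is
    controlled. *)
Lemma iter_subdiv_near A Phi B p (e r : R) k (l : R) a b c :
  mid_closed A -> (forall a b c, subdiv B a b c = B a b c) ->
  (forall a b c, A a -> A b -> A c -> `|a - p| < r -> `|b - p| < r ->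
    `|c - p| < r -> forall l, path2_le l a b c -> `|Phi a b c - B a b c| <= e * l ^+ 2) ->
  A a -> A b -> A c -> `|a - p| < r -> `|b - p| < r -> `|c - p| < r ->
  path2_le l a b c -> `|iter k subdiv Phi a b c - B a b c| <= e * l ^+ 2.
Proof.
move=> mA hB h Aa Ab Ac ap bp cp lp.
rewrite -[B in X in _ - X](iter_subdiv_id k hB) -iter_subdivB.
(* The threshold is the absolute value of [l], so the smallness condition holds for every [k]. *)
apply: (@iter_subdiv_le _ _ e (`|l|) k l a b c (mid_closed_ball (p := p) (r := r) mA)) => //.
  by move=> a' b' c' l' [? ?] [? ?] [? ?] _; exact: h.
by rewrite (le_trans (ler_norm _))// ler_peMr// exprn_ege1// ler1n.
Qed.

Section Compact.
Variables (A : set V) (B : V -> V -> V -> V -> R).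
Hypotheses (cA : compact A) (mA : mid_closed A).
Hypothesis hB : forall p, A p -> forall a b c, subdiv (B p) a b c = B p a b c.

Lemma loc_approx_uniform Phi Psi (e : R) : 0 < e ->
  loc_approx A Phi B -> loc_approx A Psi B ->
  exists2 l0, 0 < l0 & forall a, A a -> exists2 p, A p & forall b c k l, A b -> A c ->
    l <= l0 -> path2_le l a b c ->
    `|iter k subdiv Phi a b c - B p a b c| <= e * l ^+ 2 /\
    `|iter k subdiv Psi a b c - B p a b c| <= e * l ^+ 2.
Proof.
move=> e0 h h'.
pose good Phi p r := forall a b c, A a -> A b -> A c -> `|a - p| < r ->
    `|b - p| < r -> `|c - p| < r ->
    forall l, path2_le l a b c -> `|Phi a b c - B p a b c| <= e * l ^+ 2.
have /choice[r hr] : forall p, exists r, A p -> 0 < r /\ good Phi p r /\ good Psi p r.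
  move=> p; have [Ap|] := pselect (A p); last by exists 0.
  have [r r0 hr] := h p Ap e e0; have [r' r'0 hr'] := h' p Ap e e0.
  exists (Num.min r r') => _; split; first by rewrite lt_min r0.
  by split=> a b c Aa Ab Ac; rewrite !lt_min => /andP[? ?] /andP[? ?] /andP[? ?];
    [apply: hr|apply: hr'].
have [|d0 d00 hd] := @lebesgue_number A r cA; first by move=> p /hr[].
(* Two steps of length at most [d0 / 3] stay within the Lebesgue number of [a], so one model point
   [p], chosen from [a] alone, serves all three vertices. *)
exists (d0 / 3) => [|a Aa]; first by rewrite divr_gt0.
have [p Ap hp] := hd a Aa; exists p => // b c k l Ab Ac ll0 lp.
have [ab bc] := lp; have [_ [hr1 hr2]] := hr p Ap.
have l1 : l < d0 / 2.
  by apply: le_lt_trans ll0 _; rewrite ltr_pM2l// ltf_pV2 ?posrE// ltr_nat.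
have l2 : l < d0 by rewrite (lt_trans l1)// ltr_pdivrMr// ltr_pMr// ltr1n.
have ap : `|a - p| < r p by apply: hp; rewrite subrr normr0.
have bp : `|b - p| < r p by apply: hp; rewrite (le_lt_trans ab).
have cp : `|c - p| < r p.
  apply: hp; rewrite -(subrK b c) -addrA (le_lt_trans (ler_normD _ _))//.
  by rewrite [d0]splitr ltrD// (le_lt_trans _ l1).
by split; apply: (iter_subdiv_near (r := r p) (p := p) (A := A)) => //; exact: hB.
Qed.

Lemma pow2_large (l l0 : R) : 0 < l0 -> exists k0, forall k, (k0 <= k)%N -> l <= l0 * 2 ^+ k.
Proof.
move=> l00.
have [k0 hk0] : exists k0 : nat, l / l0 <= k0%:R.
  exists (Num.truncn `|l / l0|).+1; rewrite (le_trans (ler_norm _))//.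
  by rewrite ltW// truncnS_gt.
exists k0 => k kk0; rewrite mulrC -ler_pdivrMr// (le_trans hk0)//.
rewrite -natrX ler_nat (leq_trans kk0)// ltnW//; exact: ltn_expl.
Qed.

(** Write [iter i] as [iter k] applied to [iter (i - k)]. After [k] halvings the triangles are small
    enough for both inner iterates to be close to the same model [B p], and [iter_subdiv_le] brings
    the bound back to the large triangle. With [Phi = Psi] this is the Cauchy property; with two
    chart expressions it is the independence of the chart. *)
Lemma subdiv_diff_small Phi Psi : loc_approx A Phi B -> loc_approx A Psi B ->
  forall (e l : R) a b c, 0 < e -> A a -> A b -> A c -> path2_le l a b c ->
  exists k0, forall i j, (k0 <= i)%N -> (k0 <= j)%N ->
    `|iter i subdiv Phi a b c - iter j subdiv Psi a b c| <= e * l ^+ 2.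
Proof.
move=> hPhi hPsi e l a b c e0 Aa Ab Ac lp.
have e20 : 0 < e / 2 by rewrite divr_gt0.
have [l0 l00 h] := loc_approx_uniform e20 hPhi hPsi.
have [k hk] := pow2_large l l00; exists k => i j ki kj.
rewrite -(subnKC ki) -(subnKC kj) !iterD -iter_subdivB.
apply: (@iter_subdiv_le A _ e l0) => //; last exact: hk.
move=> a' b' c' l' Aa' Ab' Ac' l'0 lp'.
have [p Ap hp] := h a' Aa'.
have [h1 _] := hp b' c' (i - k)%N l' Ab' Ac' l'0 lp'.
have [_ h2] := hp b' c' (j - k)%N l' Ab' Ac' l'0 lp'.
rewrite -(subrKA (B p a' b' c')) (le_trans (ler_normD _ _))//.
by rewrite [e]splitr mulrDl lerD// distrC.
Qed.

Lemma path2_max a b c : path2_le (Num.max `|b - a| `|c - b|) a b c.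
Proof. by rewrite /path2_le !le_max !lexx orbT. Qed.

Lemma subdiv_diff_lt Phi Psi : loc_approx A Phi B -> loc_approx A Psi B ->
  forall (e : R) a b c, 0 < e -> A a -> A b -> A c ->
  exists k0, forall i j, (k0 <= i)%N -> (k0 <= j)%N ->
    `|iter i subdiv Phi a b c - iter j subdiv Psi a b c| < e.
Proof.
move=> hPhi hPsi e a b c e0 Aa Ab Ac; have lp := path2_max a b c.
set l := Num.max _ _ in lp.
have l1 : 0 < l ^+ 2 + 1 by rewrite ltr_wpDl// sqr_ge0.
have [k0 hk0] := subdiv_diff_small hPhi hPsi (divr_gt0 e0 l1) Aa Ab Ac lp.
exists k0 => i j ki kj; rewrite (le_lt_trans (hk0 i j ki kj))//.
by rewrite mulrAC ltr_pdivrMr// ltr_pM2l// ltrDl.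
Qed.

Lemma subdiv_cvg Phi a b c : loc_approx A Phi B -> A a -> A b -> A c ->
  (fun k => iter k subdiv Phi a b c) @ \oo --> tri_int Phi a b c.
Proof.
move=> h Aa Ab Ac; apply/cauchy_cvgP/cauchy_exP => e e0.
have [k0 hk0] := subdiv_diff_lt h h e0 Aa Ab Ac.
exists (iter k0 subdiv Phi a b c); exists k0 => // k /= kk0.
by rewrite /ball/=; apply: hk0.
Qed.

Lemma tri_int_lim Phi a b c (e : R) : loc_approx A Phi B -> A a -> A b -> A c ->
  0 < e -> exists k0, forall k, (k0 <= k)%N ->
    `|iter k subdiv Phi a b c - tri_int Phi a b c| < e.
Proof.
move=> h Aa Ab Ac e0.
have /cvgrPdist_lt/(_ e e0)[k0 _ hk] := subdiv_cvg h Aa Ab Ac.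
by exists k0 => k kk0; rewrite distrC; apply: hk.
Qed.

Lemma tri_int_eq Phi Psi a b c : loc_approx A Phi B -> loc_approx A Psi B ->
  A a -> A b -> A c -> tri_int Phi a b c = tri_int Psi a b c.
Proof.
move=> hPhi hPsi Aa Ab Ac; apply/eqP; rewrite -subr_eq0 -normr_le0.
apply/ler_addgt0Pl => e e0; have e3 : 0 < e / 3 by rewrite divr_gt0.
have [k1 h1] := tri_int_lim hPhi Aa Ab Ac e3.
have [k2 h2] := tri_int_lim hPsi Aa Ab Ac e3.
have [k3 h3] := subdiv_diff_lt hPhi hPsi e3 Aa Ab Ac.
pose k := maxn k1 (maxn k2 k3).
have H1 := h1 k (leq_maxl _ _).
have H2 : `|iter k subdiv Psi a b c - tri_int Psi a b c| < e / 3.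
  by apply: h2; rewrite !leq_max leqnn ?orbT.
have H3 : `|iter k subdiv Phi a b c - iter k subdiv Psi a b c| < e / 3.
  by apply: h3; rewrite !leq_max leqnn ?orbT.
move: H1 H2 H3; move: (iter _ _ _ _ _ _) (iter _ _ _ _ _ _) (tri_int _ _ _ _) (tri_int _ _ _ _).
move=> x y z t; rewrite addr0 !ltr_norml ler_norml => /andP[? ?] /andP[? ?] /andP[? ?].
by apply/andP; split; lra.
Qed.

Lemma tri_int_near Phi p (e r : R) :
  A p -> loc_approx A Phi B ->
  (forall a b c, A a -> A b -> A c -> `|a - p| < r -> `|b - p| < r ->
    `|c - p| < r -> forall l, path2_le l a b c -> `|Phi a b c - B p a b c| <= e * l ^+ 2) ->
  forall a b c, A a -> A b -> A c -> `|a - p| < r -> `|b - p| < r ->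
    `|c - p| < r -> forall l, path2_le l a b c ->
    `|tri_int Phi a b c - B p a b c| <= e * l ^+ 2.
Proof.
move=> Ap h hr a b c Aa Ab Ac ap bp cp l lp.
apply/ler_addgt0Pr => e' e'0.
have [k hk] := tri_int_lim h Aa Ab Ac e'0.
rewrite -(subrKA (iter k subdiv Phi a b c)) (le_trans (ler_normD _ _))// addrC lerD//.
  by apply: (iter_subdiv_near (r := r) (p := p) (A := A)) => //; exact: hB.
by rewrite distrC ltW// hk.
Qed.

Lemma iter_subdiv_swap12 Phi k :
  (forall a b c, A a -> A b -> A c -> Phi b a c = - Phi a b c) ->
  (forall a b c, A a -> A b -> A c -> Phi a c b = - Phi a b c) ->
  (forall a b c, A a -> A b -> A c ->
     iter k subdiv Phi b a c = - iter k subdiv Phi a b c) /\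
  (forall a b c, A a -> A b -> A c ->
     iter k subdiv Phi a c b = - iter k subdiv Phi a b c).
Proof.
move=> h1 h2; elim: k => [|k [IH1 IH2]]; first by split.
split=> a b c Aa Ab Ac; rewrite /= /subdiv;
  have Aab := mA Aa Ab; have Aac := mA Aa Ac; have Abc := mA Ab Ac.
- rewrite (midC b a) (IH1 (mid a b) b)// (IH1 a (mid a b))//.
  rewrite (IH1 (mid a c) (mid b c) c)// (IH2 (mid a b) (mid a c))//; ring.
- rewrite (midC c b) (IH2 a (mid a b) (mid a c))// (IH2 (mid a c) (mid b c) c)//.
  rewrite (IH2 (mid a b) b (mid b c))// (IH1 (mid a b) (mid a c))//; ring.
Qed.

Lemma lim_anti (u v : nat -> R) (x y : R) :
  (forall e, 0 < e -> exists k0, forall k, (k0 <= k)%N -> `|u k - x| < e) ->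
  (forall e, 0 < e -> exists k0, forall k, (k0 <= k)%N -> `|v k - y| < e) ->
  (forall k, v k = - u k) -> y = - x.
Proof.
move=> hu hv uv; apply/eqP; rewrite -subr_eq0 opprK -normr_le0.
apply/ler_addgt0Pl => e e0; have e2 : 0 < e / 2 by rewrite divr_gt0.
have [k1 h1] := hu _ e2; have [k2 h2] := hv _ e2.
have := h1 _ (leq_maxl k1 k2); have := h2 _ (leq_maxr k1 k2); rewrite uv.
rewrite addr0 !ltr_norml ler_norml => /andP[? ?] /andP[? ?].
by apply/andP; split; lra.
Qed.

Lemma tri_int_swap Phi : loc_approx A Phi B ->
  (forall a b c, A a -> A b -> A c -> Phi b a c = - Phi a b c) ->
  (forall a b c, A a -> A b -> A c -> Phi a c b = - Phi a b c) ->
  forall a b c, A a -> A b -> A c -> tri_int Phi b a c = - tri_int Phi a b c /\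
    tri_int Phi a c b = - tri_int Phi a b c.
Proof.
move=> h h1 h2 a b c Aa Ab Ac.
split; apply: (lim_anti (fun e => @tri_int_lim Phi a b c e h Aa Ab Ac)).
- by move=> e; exact: tri_int_lim.
- by move=> k; have [+ _] := iter_subdiv_swap12 k h1 h2; apply.
- by move=> e; exact: tri_int_lim.
- by move=> k; have [_] := iter_subdiv_swap12 k h1 h2; apply.
Qed.

(** A discrete Stokes theorem: for any prescribed [eta], the coboundary of a fine enough subdivision
    is at most [eta * l ^+ 3] on the original tetrahedron. *)
Lemma tri_int_cocycle Phi : loc_approx A Phi B -> loc_closed A Phi ->
  forall a b c d, A a -> A b -> A c -> A d -> cobd (tri_int Phi) a b c d = 0.
Proof.
move=> h hc a b c d Aa Ab Ac Ad.
apply/eqP; rewrite -normr_le0; apply/ler_addgt0Pl => e e0; rewrite addr0.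
pose l := Num.max (Num.max `|b - a| `|c - b|) `|d - c|.
have l0 : 0 <= l by rewrite !le_max normr_ge0.
have lp : path3_le l a b c d by rewrite /path3_le /path2_le !le_max !lexx !orbT.
have l1 : 0 < l ^+ 3 + 1 by rewrite ltr_wpDl// exprn_ge0.
have eta0 : 0 < e / 2 / (l ^+ 3 + 1) by rewrite !divr_gt0.
have /choice[r hr] : forall p, exists r, A p -> 0 < r /\
    forall a b c d, A a -> A b -> A c -> A d -> `|a - p| < r -> `|b - p| < r ->
    `|c - p| < r -> `|d - p| < r ->
    forall l', path3_le l' a b c d -> `|cobd Phi a b c d| <= e / 2 / (l ^+ 3 + 1) * l' ^+ 3.
  move=> p; have [Ap|] := pselect (A p); last by exists 0.
  by have [r r0 hr] := hc p Ap _ eta0; exists r.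
have [|d0 d00 hd] := @lebesgue_number A r cA; first by move=> p /hr[].
have fine k : l <= d0 / 4 * 2 ^+ k ->
    `|cobd (iter k subdiv Phi) a b c d| <= e / 2 / (l ^+ 3 + 1) * l ^+ 3.
  (* A path of three steps of length at most [d0 / 4] stays within the Lebesgue number of its first
     vertex. *)
  move=> lk; apply: (@iter_cobd_le A _ _ (d0 / 4)) => //.
  move=> a' b' c' d' l' Aa' Ab' Ac' Ad' ll lp'.
  have [p Ap hp] := hd a' Aa'; have [_] := hr p Ap; apply=> //; case: lp' => [[ab bc] cd].
  - by apply: hp; rewrite subrr normr0.
  - by apply: hp; rewrite (le_lt_trans ab)//; lra.
  - apply: hp; have -> : c' - a' = (c' - b') + (b' - a') by rewrite addrA subrK.
    by rewrite (le_lt_trans (ler_normD _ _))//; lra.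
  - apply: hp; have -> : d' - a' = (d' - c') + ((c' - b') + (b' - a')).
      by rewrite (addrA (c' - b')) subrK addrA subrK.
    rewrite (le_lt_trans (ler_normD _ _))//.
    have := ler_normD (c' - b') (b' - a'); lra.
have [k0 hk0] := pow2_large l (divr_gt0 d00 (ltr0Sn _ 3)).
have e8 : 0 < e / 8 by rewrite divr_gt0.
have [k1 h1] := tri_int_lim h Ab Ac Ad e8.
have [k2 h2] := tri_int_lim h Aa Ac Ad e8.
have [k3 h3] := tri_int_lim h Aa Ab Ad e8.
have [k4 h4] := tri_int_lim h Aa Ab Ac e8.
pose k := maxn k0 (maxn k1 (maxn k2 (maxn k3 k4))).
have H : `|cobd (iter k subdiv Phi) a b c d| <= e / 2.
  apply: le_trans (fine k _) _; first by apply: hk0; rewrite !leq_max leqnn ?orbT.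
  rewrite -mulrA ler_piMr ?divr_ge0 ?(ltW e0)// mulrC ler_pdivrMr// mul1r.
  by rewrite lerDl.
have H1 : `|iter k subdiv Phi b c d - tri_int Phi b c d| < e / 8.
  by apply: h1; rewrite !leq_max leqnn ?orbT.
have H2 : `|iter k subdiv Phi a c d - tri_int Phi a c d| < e / 8.
  by apply: h2; rewrite !leq_max leqnn ?orbT.
have H3 : `|iter k subdiv Phi a b d - tri_int Phi a b d| < e / 8.
  by apply: h3; rewrite !leq_max leqnn ?orbT.
have H4 : `|iter k subdiv Phi a b c - tri_int Phi a b c| < e / 8.
  by apply: h4; rewrite !leq_max leqnn ?orbT.
move: H H1 H2 H3 H4; rewrite /cobd.
move: (iter k _ _ b c d) (iter k _ _ a c d) (iter k _ _ a b d) (iter k _ _ a b c).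
move: (tri_int _ b c d) (tri_int _ a c d) (tri_int _ a b d) (tri_int _ a b c).
move=> x1 x2 x3 x4 y1 y2 y3 y4; rewrite !ltr_norml !ler_norml.
move=> /andP[? ?] /andP[? ?] /andP[? ?] /andP[? ?] /andP[? ?].
by apply/andP; split; lra.
Qed.

End Compact.
End TriangleIntegral.

(** * Freudenthal's subdivision *)

Section Hulls.
Variables (R : realType) (N : nat).
Implicit Types (s t : {fset 'rV[R]_N}) (v x : 'rV[R]_N).

Lemma sum_fibre (T : eqType) (s : seq T) (W : lmodType R) (q : T -> 'rV[R]_N) t (c : T -> R)
    (G : 'rV[R]_N -> W) : (forall i, i \in s -> c i != 0 -> q i \in t) ->
  \sum_(v <- t) (\sum_(i <- s | q i == v) c i) *: G v = \sum_(i <- s) c i *: G (q i).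
Proof.
move=> h; under eq_bigr => v _ do rewrite scaler_suml big_mkcond.
rewrite exchange_big/= big_seq [RHS]big_seq; apply: eq_bigr => i si.
have [c0|c0] := eqVneq (c i) 0.
  by rewrite c0 scale0r big1// => v _; case: ifP => // _; rewrite scale0r.
have qt := h i si c0; rewrite (big_fsetD1 (q i))//= eqxx big_seq big1 ?addr0//.
by move=> v; rewrite !inE => /andP[vq _]; rewrite eq_sym (negbTE vq).
Qed.

Lemma hull_vertex s v : v \in s -> hull s v.
Proof.
move=> vs; exists (fun w => if w == v then 1 else 0).
  split=> [w _|]; first by case: ifP.
  rewrite (big_fsetD1 v)//= eqxx big_seq big1 ?addr0// => w.
  by rewrite !inE => /andP[/negbTE -> _].
rewrite (big_fsetD1 v)//= eqxx scale1r big_seq big1 ?addr0// => w.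
by rewrite !inE => /andP[/negbTE -> _]; rewrite scale0r.
Qed.

Lemma hull_conv (T : eqType) (r : seq T) (c : T -> R) (q : T -> 'rV[R]_N) s :
  (forall i, i \in r -> 0 <= c i) -> \sum_(i <- r) c i = 1 ->
  (forall i, i \in r -> c i != 0 -> hull s (q i)) ->
  hull s (\sum_(i <- r) c i *: q i).
Proof.
move=> c0 c1 h.
have /choice[a ha] : forall i, exists a, i \in r -> c i != 0 ->
    bary_coords s a /\ q i = \sum_(v <- s) a v *: v.
  move=> i; have [ir|] := boolP (i \in r); last by exists (fun=> 0).
  have [ci0|ci0] := boolP (c i != 0); last by exists (fun=> 0).
  by have [a ? ?] := h i ir ci0; exists a.
exists (fun v => \sum_(i <- r) c i * a i v); first split.
- move=> v vs; rewrite big_seq sumr_ge0// => i ir.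
  have [->|ci0] := eqVneq (c i) 0; first by rewrite mul0r.
  by rewrite mulr_ge0 ?c0//; have [[+ _] _] := ha i ir ci0; apply.
- rewrite exchange_big/= -[RHS]c1 big_seq [RHS]big_seq; apply: eq_bigr => i ir.
  rewrite -mulr_sumr; have [->|ci0] := eqVneq (c i) 0; first by rewrite mul0r.
  by have [[_ ->] _] := ha i ir ci0; rewrite mulr1.
- under [RHS]eq_bigr => v _ do rewrite scaler_suml.
  rewrite exchange_big/= big_seq [RHS]big_seq; apply: eq_bigr => i ir.
  have [->|ci0] := eqVneq (c i) 0.
    by rewrite scale0r big1// => v _; rewrite mul0r scale0r.
  have [_ ->] := ha i ir ci0; rewrite scaler_sumr; apply: eq_bigr => v _.
  by rewrite scalerA.
Qed.

Lemma hull_sub s t : (forall v, v \in s -> hull t v) -> hull s `<=` hull t.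
Proof.
move=> h x [a [a0 a1] ->]; apply: hull_conv => // v vs _; exact: h.
Qed.

Lemma hull_segment s x y (e : R) : hull s x -> hull s y -> 0 <= e <= 1 ->
  hull s (x + e *: (y - x)).
Proof.
move=> hx hy /andP[e0 e1].
have := @hull_conv bool [:: true; false] (fun b => if b then e else 1 - e)
  (fun b => if b then y else x) s.
rewrite !big_cons !big_nil !addr0.
have -> : e *: y + (1 - e) *: x = x + e *: (y - x).
  by rewrite scalerBl scale1r scalerBr addrCA.
by apply=> [[] _ //=| |[] _ _ //]; rewrite ?subr_ge0// addrC subrK.
Qed.

Lemma hull_nonempty s x : hull s x -> s != fset0.
Proof.
move=> [a [_ a1] _]; apply/eqP => s0; move: a1; rewrite s0 big_seq_fset0.
by move/eqP; rewrite eq_sym oner_eq0.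
Qed.

Lemma direction_sub s v w : v \in s -> w \in s -> v - w \in direction s.
Proof.
by move=> vs ws; apply: memv_span; apply/allpairsP; exists (v, w).
Qed.

Lemma hull_direction s x y : hull s x -> hull s y -> x - y \in direction s.
Proof.
move=> [a [a0 a1] ->] [b [b0 b1] ->].
have [->|/fset0Pn[w ws]] := eqVneq s fset0.
  by rewrite !big_seq_fset0 subrr mem0v.
have E c : \sum_(v <- s) c v = 1 ->
    \sum_(v <- s) c v *: v = w + \sum_(v <- s) c v *: (v - w).
  move=> c1; under [in RHS]eq_bigr => v _ do rewrite scalerBr.
  by rewrite sumrB -scaler_suml c1 scale1r addrC subrK.
rewrite (E a a1) (E b b1) opprD addrACA subrr add0r -sumrB big_seq.
by apply: memv_suml => v vs; rewrite memvB// memvZ// direction_sub.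
Qed.

Lemma direction_span s w u : w \in s -> u \in direction s ->
  exists c : 'rV[R]_N -> R, u = \sum_(v <- s) c v *: (v - w).
Proof.
move=> ws us; pose X := in_tuple [seq v - w | v <- enum_fset s, w <- enum_fset s].
have uX : u \in <<X>>%VS by [].
have /choice[c hc] : forall i, exists c : 'rV[R]_N -> R,
    X`_i = \sum_(v <- s) c v *: (v - w).
  move=> i; have [si|si] := ltnP i (size X); last first.
    exists (fun=> 0); rewrite nth_default// big1// => v _; by rewrite scale0r.
  have /allpairsP[[y z] /= [ys zs ->]] := mem_nth 0 si.
  exists (fun v => (v == y)%:R - (v == z)%:R).
  under eq_bigr => v _ do rewrite scalerBl.
  rewrite sumrB (big_fsetD1 y)//= eqxx scale1r big_seq big1 => [|v]; last first.
    by rewrite !inE => /andP[/negbTE -> _]; rewrite scale0r.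
  rewrite (big_fsetD1 z)//= eqxx scale1r big_seq big1 => [|v]; last first.
    by rewrite !inE => /andP[/negbTE -> _]; rewrite scale0r.
  by rewrite !addr0 opprB addrA subrK.
exists (fun v => \sum_i coord X i u * c i v).
under [RHS]eq_bigr => v _ do rewrite scaler_suml.
rewrite exchange_big/= [LHS](coord_span uX); apply: eq_bigr => i _.
by rewrite hc scaler_sumr; apply: eq_bigr => v _; rewrite scalerA.
Qed.

End Hulls.

(** * Chains of lattice points in partial-sum coordinates *)

Section TightChains.
Variables (R : realType) (r : nat).
Local Notation I := {ffun 'I_r -> nat}.

Definition psum (a : I) (j : 'I_r) : nat := (\sum_(i < r | (i <= j)%N) a i)%N.

(* In the coordinates [psum], Freudenthal's triangulation cuts the unit cubes into chains
   of vertices for the product order. *)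
Definition adj (a b : I) := forall j, (psum a j <= psum b j <= (psum a j).+1)%N.

Definition tight (A : I -> Prop) := forall a b, A a -> A b -> adj a b \/ adj b a.

Lemma psum_inj a b : (forall j, psum a j = psum b j) -> a = b.
Proof.
move=> h; apply/ffunP => -[j]; elim/ltn_ind: j => j IH jr.
have := h (Ordinal jr); rewrite /psum (bigD1 (Ordinal jr))//= [RHS](bigD1 (Ordinal jr))//=.
rewrite (eq_bigr b); first by move/addIn.
move=> [i ir] /andP[/= ij]; rewrite -val_eqE/= => ij'.
by apply: IH; rewrite ltn_neqAle ij'.
Qed.

Lemma seq_argmax (T : eqType) (s : seq T) (P : pred T) (h : T -> nat) x0 :
  x0 \in s -> P x0 -> exists x, [/\ x \in s, P x & forall y, y \in s -> P y -> (h y <= h x)%N].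
Proof.
move=> x0s Px0.
pose Q m := has (fun x => P x && (h x == m)) s.
have exQ : exists m, Q m.
  by exists (h x0); apply/hasP; exists x0 => //; rewrite Px0 eqxx.
have ubQ m : Q m -> (m <= \sum_(x <- s) h x)%N.
  by move=> /hasP[x xs /andP[_ /eqP <-]]; rewrite (big_rem x)//= leq_addr.
case: (ex_maxnP exQ ubQ) => m /hasP[x xs /andP[Px /eqP hx]] mmax.
exists x; split=> // y ys Py; rewrite hx; apply: mmax.
by apply/hasP; exists y => //; rewrite Py eqxx.
Qed.

(** A tight set is a chain for the product order of partial sums; an element with the largest total
    of partial sums is its maximum. *)
Lemma tight_top (u : seq I) (al : I -> R) a0 :
  tight (fun a => a \in u /\ al a != 0) -> a0 \in u -> al a0 != 0 ->
  exists a, [/\ a \in u, al a != 0 & forall b, b \in u -> al b != 0 -> adj b a].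
Proof.
move=> tA a0u a0n.
have [a [au an amax]] :=
  @seq_argmax _ u (fun a => al a != 0) (fun a => \sum_j psum a j)%N a0 a0u a0n.
exists a; split=> // b bu bn; have [//|ab] := tA b a (conj bu bn) (conj au an).
suff -> : b = a by move=> j; rewrite leqnn leqnSn.
apply: psum_inj => j; apply/eqP; rewrite eq_sym eqn_leq.
have [-> /= _] := andP (ab j).
have hle := amax b bu bn; rewrite leqNgt; apply/negP => lt.
move: hle; rewrite leqNgt => /negP; apply.
rewrite (bigD1 j)//= [X in (_ < X)%N](bigD1 j)//= -addSn leq_add//.
by apply: leq_sum => i _; case/andP: (ab i).
Qed.

(** Were the maximum [b] of the second support larger at [j], the function [psum c j - q] with
    [q = psum b j - 1] would be nonpositive on the support of [al], nonnegative on that of [be] and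
    equal to 1 at [b], against the equality of the moments. *)
Lemma top_le (u : seq I) (al be : I -> R) a b j :
  (forall c, c \in u -> 0 <= al c) -> (forall c, c \in u -> 0 <= be c) ->
  \sum_(c <- u) al c = \sum_(c <- u) be c ->
  \sum_(c <- u) al c * (psum c j)%:R = \sum_(c <- u) be c * (psum c j)%:R ->
  b \in u -> be b != 0 ->
  (forall c, c \in u -> al c != 0 -> adj c a) ->
  (forall c, c \in u -> be c != 0 -> adj c b) ->
  (psum b j <= psum a j)%N.
Proof.
move=> al0 be0 m1 m2 bu bn ha hb; rewrite leqNgt; apply/negP => lt.
pose q : R := (psum b j)%:R - 1.
suff : \sum_(c <- u) al c * ((psum c j)%:R - q) < \sum_(c <- u) be c * ((psum c j)%:R - q).
  under eq_bigr => c _ do rewrite mulrBr.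
  under [X in _ < X]eq_bigr => c _ do rewrite mulrBr.
  by rewrite !sumrB -!mulr_suml m1 m2 ltxx.
apply: (@le_lt_trans _ _ 0).
  rewrite big_seq sumr_le0// => c cu; have [->|cn] := eqVneq (al c) 0; first by rewrite mul0r.
  rewrite mulr_ge0_le0 ?al0// /q.
  have /andP[ca _] := ha c cu cn j.
  have : ((psum c j).+1 <= psum b j)%N by rewrite (leq_ltn_trans ca lt).
  by rewrite -(ler_nat R) -natr1; lra.
rewrite (big_rem b)//= ltr_pwDl//.
  by rewrite /q opprB addrC subrK mulr1 lt_neqAle eq_sym bn be0.
rewrite big_seq sumr_ge0// => c /mem_rem cu.
have [->|cn] := eqVneq (be c) 0; first by rewrite mul0r.
rewrite mulr_ge0 ?be0// /q.
have /andP[_] := hb c cu cn j.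
rewrite -(ler_nat R) -natr1; lra.
Qed.

(** After subtracting the common part [Num.min (al c) (be c)] no vertex carries both weights, yet
    [top_le] in both directions makes the two maxima coincide. The supports are tight separately,
    not jointly, so the lemma gives affine independence as well as the intersection property. *)
Lemma tight_unique (u : seq I) (al be : I -> R) :
  (forall c, c \in u -> 0 <= al c) -> (forall c, c \in u -> 0 <= be c) ->
  tight (fun a => a \in u /\ al a != 0) -> tight (fun a => a \in u /\ be a != 0) ->
  \sum_(c <- u) al c = \sum_(c <- u) be c ->
  (forall j, \sum_(c <- u) al c * (psum c j)%:R = \sum_(c <- u) be c * (psum c j)%:R) ->
  forall a, a \in u -> al a = be a.
Proof.
move=> al0 be0 tal tbe m1 m2.
pose al' c := al c - Num.min (al c) (be c); pose be' c := be c - Num.min (al c) (be c).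
have al'0 c : c \in u -> 0 <= al' c by rewrite subr_ge0 ge_min lexx.
have be'0 c : c \in u -> 0 <= be' c by rewrite subr_ge0 ge_min lexx orbT.
have al'n c : c \in u -> al' c != 0 -> al c != 0.
  move=> cu; apply: contra => /eqP c0; rewrite /al' c0 (min_idPl (be0 c cu)).
  by rewrite subrr.
have be'n c : c \in u -> be' c != 0 -> be c != 0.
  move=> cu; apply: contra => /eqP c0; rewrite /be' c0 (min_idPr (al0 c cu)).
  by rewrite subrr.
have tal' : tight (fun a => a \in u /\ al' a != 0).
  by move=> a b [au an] [bu bn]; apply: tal; split=> //; [apply: al'n|apply: al'n].
have tbe' : tight (fun a => a \in u /\ be' a != 0).
  by move=> a b [au an] [bu bn]; apply: tbe; split=> //; [apply: be'n|apply: be'n].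
have m1' : \sum_(c <- u) al' c = \sum_(c <- u) be' c by rewrite !sumrB m1.
have m2' j : \sum_(c <- u) al' c * (psum c j)%:R = \sum_(c <- u) be' c * (psum c j)%:R.
  under eq_bigr => c _ do rewrite mulrBl.
  under [RHS]eq_bigr => c _ do rewrite mulrBl.
  by rewrite !sumrB m2.
have zero (f : I -> R) : (forall c, c \in u -> 0 <= f c) -> \sum_(c <- u) f c = 0 ->
    forall c, c \in u -> f c = 0.
  move=> f0 fs c cu; apply/eqP; rewrite eq_le f0// andbT -fs (big_rem c)//=.
  by rewrite lerDl big_seq sumr_ge0// => d /mem_rem; exact: f0.
suff al'z : forall c, c \in u -> al' c = 0.
  have be'z : forall c, c \in u -> be' c = 0.
    apply: zero => //; rewrite -m1' big_seq big1// => c; exact: al'z.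
  move=> a au; have := al'z a au; have := be'z a au; rewrite /al' /be'.
  by move=> /subr0_eq <- /subr0_eq.
move=> a0 a0u; apply/eqP; apply/negPn/negP => a0n.
have [a [au an ha]] := tight_top tal' a0u a0n.
have [b0 [b0u b0n]] : exists b0, b0 \in u /\ be' b0 != 0.
  apply: contrapT => nb; move/negP: a0n; apply; apply/eqP.
  apply: zero a0u => //; rewrite m1' big_seq big1// => c cu.
  by apply/eqP; apply/negPn/negP => cn; apply: nb; exists c.
have [b [bu bn hb]] := tight_top tbe' b0u b0n.
have ab : a = b.
  apply: psum_inj => j; apply/eqP; rewrite eqn_leq.
  rewrite (top_le be'0 al'0 (esym m1') (esym (m2' j)) au an hb ha).
  by rewrite (top_le al'0 be'0 m1' (m2' j) bu bn ha hb).
move: an bn; rewrite -ab /al' /be'; case: (leP (al a) (be a)) => _;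
by rewrite ?subrr ?eqxx.
Qed.

End TightChains.

(** Induction on the number of positive values: peel off the smallest one, [mu], as a multiple of
    the indicator of the set [J] where [z] is positive. The sets obtained are nested upper level
    sets. *)
Lemma layer_cake (R : realType) (I : finType) (z : I -> R) (M : R) :
  0 <= M -> (forall i, 0 <= z i <= M) ->
  exists c : {set I} -> R, [/\ forall S, 0 <= c S, \sum_S c S = M,
    forall i, \sum_(S : {set I} | i \in S) c S = z i,
    forall S T : {set I}, c S != 0 -> c T != 0 -> S \subset T \/ T \subset S &
    forall (S : {set I}) i j, c S != 0 -> i \in S -> 0 < z i /\ (z i <= z j -> j \in S)].
Proof.
have [m] := ubnP #|[pred i | 0 < z i]|.
elim: m z M => // m IH z M zm M0 hz.
have [/existsP[i0 zi0]|] := boolP [exists i, 0 < z i]; last first.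
  rewrite negb_exists => /forallP z0.
  have {}z0 i : z i = 0.
    apply/eqP; rewrite eq_le; have /andP[-> _] := hz i.
    by rewrite andbT leNgt z0.
  (* The empty set absorbs the remaining mass, so that the weights add up to [M] without affecting
     [z]. *)
  exists (fun S : {set I} => if S == finset.set0 then M else 0); split.
  - by move=> S; case: ifP.
  - by rewrite (bigD1 finset.set0)//= eqxx big1 ?addr0// => S /negbTE ->.
  - move=> i; rewrite z0 big1// => S; case: eqP => // ->; by rewrite inE.
  - move=> S T; case: (eqVneq S finset.set0) => [->|]; rewrite ?eqxx// => _ _.
    by left; exact: finset.sub0set.
  - by move=> S i j; case: (eqVneq S finset.set0) => [->|]; rewrite ?eqxx// inE.
have [i1 zi1 zmin] : exists2 i1, 0 < z i1 & forall i, 0 < z i -> z i1 <= z i.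
  by case: (@arg_minP _ _ _ i0 (fun i => 0 < z i) z zi0) => i1 h1 h2; exists i1.
pose mu := z i1; pose J := [set i | 0 < z i]%SET.
pose z' i := if 0 < z i then z i - mu else 0.
have [|||c [c0 cM cz cT cS]] := IH z' (M - mu).
- rewrite ltnS in zm; apply: leq_trans zm; apply: proper_card; apply/properP; split.
    by apply/fintype.subsetP => i; rewrite !inE /z'; case: ifP; rewrite ?ltxx.
  by exists i1; rewrite !inE// /z' zi1 subrr ltxx.
- by rewrite subr_ge0; case/andP: (hz i1).
- move=> i; rewrite /z'; case: ifP => zi.
    by rewrite subr_ge0 zmin// lerB//; case/andP: (hz i).
  by rewrite lexx subr_ge0; case/andP: (hz i1).
have cJ S : c S != 0 -> S \subset J.
  move=> Sn; apply/fintype.subsetP => i iS; have [+ _] := cS S i i Sn iS.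
  by rewrite /z' inE; case: ifP; rewrite ?ltxx.
exists (fun S : {set I} => c S + (if S == J then mu else 0)).
have cc S : c S + (if S == J then mu else 0) != 0 -> c S != 0 \/ S = J.
  by case: (eqVneq S J) => [->|_]; [right|rewrite addr0; left].
split.
- by move=> S; rewrite addr_ge0//; case: ifP => // _; exact: ltW.
- rewrite big_split/= cM (bigD1 J)//= eqxx [X in _ + (_ + X)]big1 ?addr0 ?subrK//.
  by move=> S /negbTE ->.
- move=> i; rewrite big_split/= cz /z'; case: ifP => zi.
    rewrite (bigD1 J)/= ?inE// eqxx [X in _ + (_ + X)]big1 ?addr0 ?subrK//.
    by move=> S /andP[_ /negbTE ->].
  rewrite add0r big1.
    by apply/eqP; rewrite eq_le [X in _ && X]leNgt zi andbT; case/andP: (hz i).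
  by move=> S iS; case: eqP iS => // ->; rewrite inE zi.
- move=> S T /cc[Sn|->] /cc[Tn|->].
  + exact: cT.
  + by left; exact: cJ.
  + by right; exact: cJ.
  + by left.
- move=> S i j /cc[Sn|->] iS; last first.
    by move: iS; rewrite !inE => zi; split=> // ; exact: lt_le_trans.
  have [zi' h] := cS S i j Sn iS.
  have zi : 0 < z i by move: zi'; rewrite /z'; case: ifP; rewrite ?ltxx.
  split=> // ij; apply: h; rewrite /z' zi (lt_le_trans zi ij); exact: lerB.
Qed.

(** * The subdivision of a simplicial complex with ordered vertices *)

Section Freudenthal.
Variables (R : realType) (N : nat) (K : set {fset 'rV[R]_N}).
Hypothesis hK : simplicial_complex K.
Variables (r : nat) (vs : 'I_r -> 'rV[R]_N).
Hypothesis vs_inj : injective vs.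
Hypothesis vs_cov : forall s, K s -> forall v, v \in s -> exists i, vs i = v.
Variables (L : nat) (L0 : (0 < L)%N).
Local Notation I := {ffun 'I_r -> nat}.
Local Notation V := 'rV[R]_N.
Implicit Types (s t : {fset V}) (lam mu : 'I_r -> R).

Definition supported lam s := forall i, lam i != 0 -> vs i \in s.

Lemma sum_supported (W : lmodType R) s lam (G : V -> W) : K s -> supported lam s ->
  \sum_(v <- s) (\sum_(i | vs i == v) lam i) *: G v = \sum_i lam i *: G (vs i).
Proof.
by move=> Ks h; apply: (sum_fibre (s := index_enum 'I_r)) => i _; exact: h.
Qed.

Lemma sum_supported1 s lam : K s -> supported lam s ->
  \sum_(v <- s) (\sum_(i | vs i == v) lam i) = \sum_i lam i.
Proof.
move=> Ks h; have := sum_supported (W := R^o) (fun=> 1) Ks h.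
by under eq_bigr => v _ do rewrite [_ *: _]mulr1;
   under [X in _ = X -> _]eq_bigr => v _ do rewrite [_ *: _]mulr1.
Qed.

Lemma fibre_vs lam i : \sum_(j | vs j == vs i) lam j = lam i.
Proof.
rewrite (bigD1 i)//= big1 ?addr0// => j /andP[/eqP/vs_inj -> ].
by rewrite eqxx.
Qed.

Lemma coords_free s lam : K s -> supported lam s -> \sum_i lam i = 0 ->
  \sum_i lam i *: vs i = 0 -> forall i, lam i = 0.
Proof.
move=> Ks h s0 v0 i; have [hs _ _ _] := hK; have [_ aff] := hs s Ks.
have [//|li] := eqVneq (lam i) 0.
have := aff (fun v => \sum_(i | vs i == v) lam i).
rewrite sum_supported1// (sum_supported id)// => /(_ s0 v0 (vs i) (h i li)).
by rewrite fibre_vs => /eqP; rewrite (negbTE li).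
Qed.

Definition weights lam := (forall i, 0 <= lam i) /\ \sum_i lam i = 1.

Lemma hull_coords s x : K s -> hull s x ->
  exists lam, [/\ weights lam, supported lam s & x = \sum_i lam i *: vs i].
Proof.
move=> Ks [a [a0 a1] ->].
pose lam i := if vs i \in s then a (vs i) else 0.
have sl : supported lam s by move=> i; rewrite /lam; case: ifP => //; rewrite eqxx.
have E v : v \in s -> \sum_(i | vs i == v) lam i = a v.
  by move=> vs'; have [i vsi] := vs_cov Ks vs'; rewrite -vsi in vs' *; rewrite fibre_vs /lam ifT.
exists lam; split=> //; first split.
- by move=> i; rewrite /lam; case: ifP => // /a0.
- by rewrite -(sum_supported1 Ks sl) -[RHS]a1 big_seq [RHS]big_seq; apply: eq_bigr => v /E.
- rewrite -(sum_supported id Ks sl) big_seq [RHS]big_seq; apply: eq_bigr => v vs'.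
  by rewrite E.
Qed.

Lemma coords_hull s lam : K s -> weights lam -> supported lam s ->
  hull s (\sum_i lam i *: vs i).
Proof.
move=> Ks [l0 l1] sl; apply: hull_conv => //= i _ /sl; exact: hull_vertex.
Qed.

(** Both tuples equal the one obtained in the common face, which belongs to [K]. Barycentric
    coordinates are thus functions on the whole body, which makes pieces of different simplices of
    [K] comparable. *)
Lemma coords_unique s t lam mu : K s -> K t -> weights lam -> weights mu ->
  supported lam s -> supported mu t ->
  \sum_i lam i *: vs i = \sum_i mu i *: vs i -> forall i, lam i = mu i.
Proof.
move=> Ks Kt wl wm sl sm e i.
have [_ hf hI _] := hK.
have hx : hull (s `&` t)%fset (\sum_i lam i *: vs i).
  by rewrite -hI//; split; [exact: coords_hull|rewrite e; exact: coords_hull].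
have Kst : K (s `&` t)%fset.
  by apply: (hf s) => //; [exact: fsubsetIl|exact: hull_nonempty hx].
have [nu [wn sn en]] := hull_coords Kst hx.
have D (s' : {fset V}) la : K s' -> (s `&` t `<=` s')%fset -> weights la -> supported la s' ->
    \sum_i la i *: vs i = \sum_i nu i *: vs i -> la i = nu i.
  move=> Ks' sub [_ la1] sla e'; apply/eqP; rewrite -subr_eq0; apply/eqP.
  apply: (coords_free (s := s') (lam := fun i => la i - nu i)) => //.
  - move=> j; apply: contraR => /= js.
    have [->|/sla] := eqVneq (la j) 0; last by rewrite (negbTE js).
    have [->|/sn jst] := eqVneq (nu j) 0; first by rewrite subrr.
    by rewrite (fsubsetP sub _ jst) in js.
  - by rewrite sumrB la1 (proj2 wn) subrr.
  - by under eq_bigr => j _ do rewrite scalerBl; rewrite sumrB e' subrr.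
rewrite (D s lam) ?fsubsetIl//; symmetry; apply: (D t) => //; first exact: fsubsetIr.
by rewrite -e.
Qed.

Definition lat (a : I) (i : 'I_r) : R := (a i)%:R / L%:R.
Definition pos (a : I) : V := \sum_i lat a i *: vs i.

Definition lattice (a : I) s := (\sum_i a i = L)%N /\ forall i, (a i != 0)%N -> vs i \in s.

Lemma LR0 : L%:R != 0 :> R. Proof. by rewrite pnatr_eq0 -lt0n. Qed.

Lemma lat_weights a s : lattice a s -> weights (lat a).
Proof.
move=> [aL _]; split=> [i|]; first by rewrite divr_ge0.
by rewrite -mulr_suml -natr_sum aL divff// LR0.
Qed.

Lemma lat_supported a s : lattice a s -> supported (lat a) s.
Proof.
by move=> [_ h] i; rewrite mulf_eq0 pnatr_eq0 negb_or => /andP[/h].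
Qed.

Lemma pos_hull a s : K s -> lattice a s -> hull s (pos a).
Proof.
by move=> Ks la; apply: coords_hull => //; [exact: lat_weights la|exact: lat_supported].
Qed.

Lemma pos_inj a b s t : K s -> K t -> lattice a s -> lattice b t -> pos a = pos b -> a = b.
Proof.
move=> Ks Kt la lb e; apply/ffunP => i.
have := coords_unique Ks Kt (lat_weights la) (lat_weights lb) (lat_supported la)
  (lat_supported lb) e i.
by move/(mulIf (invr_neq0 LR0))/eqP; rewrite eqr_nat => /eqP.
Qed.

(** Vertices are kept as numerators over the common denominator [L]. Partial sums follow [vs], one
    enumeration for all vertices of [K]; hence the subdivisions of two simplices agree on their
    common face. *)
Definition lsimplex (A : {fset I}) s :=
  [/\ K s, A != fset0, forall a, a \in A -> lattice a s &
      tight (fun a => a \in A)].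

Definition freudenthal : set {fset V} :=
  [set t | exists A s, lsimplex A s /\ t = [fset pos a | a in A]%fset].

Lemma lsimplex_inj A s : lsimplex A s -> {in A &, injective pos}.
Proof.
by move=> [Ks _ hl _] a b aA bA; apply: (pos_inj Ks Ks); exact: hl.
Qed.

Lemma sum_pos (W : nmodType) A s (F : V -> W) : lsimplex A s ->
  \sum_(v <- [fset pos a | a in A]%fset) F v = \sum_(a <- A) F (pos a).
Proof. by move=> /lsimplex_inj h; rewrite big_imfset. Qed.

Lemma sum_posE (T : Type) (A : seq T) (q : T -> I) (al : T -> R) :
  \sum_(a <- A) al a *: pos (q a) = \sum_i (\sum_(a <- A) al a * lat (q a) i) *: vs i.
Proof.
under [RHS]eq_bigr => i _ do rewrite scaler_suml.
rewrite exchange_big/=; apply: eq_bigr => a _; rewrite scaler_sumr.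
by apply: eq_bigr => i _; rewrite scalerA.
Qed.

Lemma posE (A : seq I) (al : I -> R) :
  \sum_(a <- A) al a *: pos a = \sum_i (\sum_(a <- A) al a * lat a i) *: vs i.
Proof. exact: (sum_posE A id). Qed.

Lemma comb_supported (A : seq I) (al : I -> R) s :
  (forall a, a \in A -> al a != 0 -> lattice a s) ->
  supported (fun i => \sum_(a <- A) al a * lat a i) s.
Proof.
move=> h i; apply: contraR => iS; rewrite big_seq big1// => a aA.
have [->|an] := eqVneq (al a) 0; first by rewrite mul0r.
have [_ /(_ i)] := h a aA an; rewrite /lat.
by case: eqP => [->|_ /(_ isT)]; rewrite ?mul0r ?mulr0// (negbTE iS).
Qed.

Lemma comb_sum (A : seq I) (al : I -> R) s :
  (forall a, a \in A -> al a != 0 -> lattice a s) ->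
  \sum_i (\sum_(a <- A) al a * lat a i) = \sum_(a <- A) al a.
Proof.
move=> h; rewrite exchange_big/= big_seq [RHS]big_seq; apply: eq_bigr => a aA.
rewrite -mulr_sumr; have [->|an] := eqVneq (al a) 0; first by rewrite mul0r.
by have [_ ->] := lat_weights (h a aA an); rewrite mulr1.
Qed.

Lemma psum_comb (A : seq I) (al : I -> R) j :
  \sum_(a <- A) al a * (psum a j)%:R =
  L%:R * \sum_(i < r | (i <= j)%N) \sum_(a <- A) al a * lat a i.
Proof.
rewrite exchange_big/= mulr_sumr; apply: eq_bigr => a _.
rewrite /psum natr_sum -mulr_sumr mulrCA; congr (_ * _).
by rewrite mulr_sumr; apply: eq_bigr => i _; rewrite mulrC divfK ?LR0.
Qed.

(** An affine relation has vanishing barycentric coordinates, so its positive and negative parts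
    have the same partial-sum moments; both are supported in the tight set [A], and [tight_unique]
    makes them equal. *)
Lemma freudenthal_aff A s : lsimplex A s -> affinely_independent [fset pos a | a in A]%fset.
Proof.
move=> lA al; rewrite !(sum_pos _ lA) => s0.
pose be a := al (pos a).
have [Ks _ hl tA] := lA.
have hl' a : a \in A -> be a != 0 -> lattice a s by move=> aA _; apply: hl.
rewrite (posE A be) => v0 _ /imfsetP[a0 /= a0A ->].
have c0 := coords_free Ks (comb_supported hl') _ v0.
have {}c0 i : \sum_(a <- A) be a * lat a i = 0 by apply: c0; rewrite (comb_sum hl').
pose bp a := Num.max (be a) 0; pose bn a := Num.max (- be a) 0.
have bE a : bp a - bn a = be a.
  by rewrite /bp /bn; case: (leP (be a) 0); case: (leP (- be a) 0); lra.
have : bp a0 = bn a0.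
  apply: (tight_unique (u := A)) => //.
  - by move=> c _; rewrite le_max lexx orbT.
  - by move=> c _; rewrite le_max lexx orbT.
  - by move=> a b [aA _] [bA _]; apply: tA.
  - by move=> a b [aA _] [bA _]; apply: tA.
  - by apply/eqP; rewrite -subr_eq0 -sumrB; under eq_bigr => c _ do rewrite bE; rewrite s0.
  - move=> j; apply/eqP; rewrite -subr_eq0 -sumrB.
    under eq_bigr => c _ do rewrite -mulrBl bE.
    by rewrite psum_comb big1 ?mulr0// => i _.
by rewrite -/(be a0) -[be a0]bE => ->; rewrite subrr.
Qed.

Lemma freudenthal_face s t : freudenthal s -> (t `<=` s)%fset -> t != fset0 -> freudenthal t.
Proof.
move=> [A [s' [[Ks' A0 hl tA] ->]]] ts t0.
exists [fset a in A | pos a \in t]%fset, s'.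
have tE : t = [fset pos a | a in [fset a in A | pos a \in t]%fset]%fset.
  apply/fsetP => v; apply/idP/imfsetP => /= [vt|[a]].
    have /imfsetP[a /= aA va] := fsubsetP ts _ vt.
    by exists a => //; rewrite !inE aA -va.
  by rewrite !inE => /andP[_ ?] ->.
split=> //; split=> //.
- apply: contra t0 => /eqP A'0; rewrite tE A'0; apply/eqP/fsetP => v.
  by apply/imfsetP => -[/= a]; rewrite inE.
- by move=> a; rewrite !inE => /andP[/hl].
- by move=> a b; rewrite !inE => /andP[aA _] /andP[bA _]; apply: tA.
Qed.

Lemma freudenthal_hull_sub A s : lsimplex A s ->
  hull [fset pos a | a in A]%fset `<=` hull s.
Proof.
move=> [Ks _ hl _]; apply: hull_sub => v /imfsetP[a /= aA ->].
by apply: pos_hull => //; exact: hl.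
Qed.

(** A common point has one tuple of barycentric coordinates by [coords_unique], hence one tight
    representation by [tight_unique] on the union of [A] and [B]; its vertices of nonzero weight
    therefore belong to both. *)
Lemma freudenthal_capI s t : freudenthal s -> freudenthal t ->
  hull s `&` hull t = hull (s `&` t)%fset.
Proof.
move=> [A [s' [lA ->]]] [B [t' [lB ->]]].
apply/seteqP; split; last first.
  by move=> x hx; split; move: x hx; apply: hull_sub => v; rewrite inE => /andP[? ?];
     apply: hull_vertex.
move=> x [[al [al0 al1]]]; rewrite (sum_pos _ lA) => xa [be [be0 be1]].
rewrite (sum_pos _ lB) => xb.
rewrite (sum_pos _ lA) in al1; rewrite (sum_pos _ lB) in be1.
have [Ks' A0 hlA tA] := lA; have [Kt' B0 hlB tB] := lB.
pose u := (A `|` B)%fset.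
pose al' a := if a \in A then al (pos a) else 0.
pose be' a := if a \in B then be (pos a) else 0.
have ext (C : {fset I}) (W : lmodType R) (g : I -> R) (f : I -> W) : (C `<=` u)%fset ->
    \sum_(a <- u) (if a \in C then g a else 0) *: f a = \sum_(a <- C) g a *: f a.
  move=> Cu; rewrite (big_fsetID _ (fun a => a \in C))/= [X in _ + X]big_seq.
  rewrite [X in _ + X]big1 ?addr0.
    rewrite [RHS]big_seq.
    have -> : [fset x0 in u | x0 \in C]%fset = C.
      apply/fsetP => a; rewrite !inE; case aC: (a \in C); rewrite ?andbF ?andbT//.
      by have := fsubsetP Cu _ aC; rewrite !inE.
    by rewrite big_seq; apply: eq_bigr => a ->.
  by move=> a; rewrite !inE => /andP[_ /negbTE ->]; rewrite scale0r.
have extA := ext A; have extB := ext B.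
have Au : (A `<=` u)%fset := fsubsetUl A B.
have Bu : (B `<=` u)%fset := fsubsetUr A B.
have al'0 a : a \in u -> 0 <= al' a.
  by move=> _; rewrite /al'; case: ifP => // aA; apply: al0; exact: in_imfset.
have be'0 a : a \in u -> 0 <= be' a.
  by move=> _; rewrite /be'; case: ifP => // aA; apply: be0; exact: in_imfset.
have al'A a : al' a != 0 -> a \in A by rewrite /al'; case: ifP => //; rewrite eqxx.
have be'B a : be' a != 0 -> a \in B by rewrite /be'; case: ifP => //; rewrite eqxx.
have hlA' a : a \in u -> al' a != 0 -> lattice a s' by move=> _ /al'A; exact: hlA.
have hlB' a : a \in u -> be' a != 0 -> lattice a t' by move=> _ /be'B; exact: hlB.
have al'1 : \sum_(a <- u) al' a = 1.
  rewrite -al1; have := extA R^o (fun a => al (pos a)) (fun=> 1) Au.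
  by under eq_bigr do rewrite [_ *: _]mulr1;
     under [X in _ = X -> _]eq_bigr do rewrite [_ *: _]mulr1.
have be'1 : \sum_(a <- u) be' a = 1.
  rewrite -be1; have := extB R^o (fun a => be (pos a)) (fun=> 1) Bu.
  by under eq_bigr do rewrite [_ *: _]mulr1;
     under [X in _ = X -> _]eq_bigr do rewrite [_ *: _]mulr1.
have xa' : x = \sum_(a <- u) al' a *: pos a by rewrite xa extA.
have xb' : x = \sum_(a <- u) be' a *: pos a by rewrite xb extB.
have W (ga : I -> R) s0 : (forall a, a \in u -> 0 <= ga a) -> \sum_(a <- u) ga a = 1 ->
    (forall a, a \in u -> ga a != 0 -> lattice a s0) ->
    weights (fun i => \sum_(a <- u) ga a * lat a i).
  move=> g0 g1 gl; split; last by rewrite (comb_sum gl).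
  by move=> i; rewrite big_seq sumr_ge0// => a au; rewrite mulr_ge0 ?g0// divr_ge0.
have cE := coords_unique Ks' Kt' (W _ _ al'0 al'1 hlA') (W _ _ be'0 be'1 hlB')
  (comb_supported hlA') (comb_supported hlB').
have {}cE i := cE (etrans (esym (posE u al')) (etrans (esym xa') (etrans xb' (posE u be')))) i.
have abE : forall a, a \in u -> al' a = be' a.
  apply: tight_unique => //.
  - by move=> a b [_ /al'A aA] [_ /al'A bA]; apply: tA.
  - by move=> a b [_ /be'B aA] [_ /be'B bA]; apply: tB.
  - by rewrite al'1 be'1.
  - by move=> j; rewrite !psum_comb; congr (_ * _); apply: eq_bigr => i _.
rewrite xa'; apply: hull_conv => // a au an; apply: hull_vertex.
have h1 : pos a \in [fset pos a | a in A]%fset by apply: in_imfset; exact: al'A.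
have h2 : pos a \in [fset pos a | a in B]%fset.
  by apply: in_imfset; apply: be'B; rewrite -abE.
by rewrite in_fsetI h1 h2.
Qed.

Lemma freudenthal_finite : finite_set freudenthal.
Proof.
pose T := {set {ffun 'I_r -> 'I_L.+1}}.
pose up (f : {ffun 'I_r -> 'I_L.+1}) : I := [ffun i => nat_of_ord (f i)].
pose g (S : T) : {fset V} := [fset pos a | a in [fset up f | f in S]%fset]%fset.
apply: (@sub_finite_set _ _ (range g)); last by apply: finite_image; exact: finite_finset.
move=> t [A [s [[Ks A0 hl tA] ->]]].
exists [set f | up f \in A]%SET => //; rewrite /g.
suff -> : [fset up f | f in [set f | up f \in A]%SET]%fset = A by [].
apply/fsetP => a; apply/imfsetP/idP => /= [[f]|aA]; first by rewrite inE => ? ->.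
have aL i : (a i < L.+1)%N.
  by have [<- _] := hl a aA; rewrite ltnS (bigD1 i)//= leq_addr.
exists [ffun i => Ordinal (aL i)].
  by rewrite inE (_ : up _ = a)//; apply/ffunP => i; rewrite !ffunE.
by apply/ffunP => i; rewrite !ffunE.
Qed.

(** The partial sums of two vertices differ by 0 or 1, always in the same direction, so each
    numerator, a difference of consecutive partial sums, differs by at most 1. Up to the factor [L]
    this bounds the number of edge vectors independently of [L]. *)
Lemma freudenthal_shape A s a b : lsimplex A s -> a \in A -> b \in A ->
  exists e : {ffun 'I_r -> 'I_3}, L%:R *: (pos a - pos b) = \sum_i ((e i)%:R - 1) *: vs i.
Proof.
move=> [Ks A0 hl tA] aA bA.
have step (c d : I) : adj c d -> forall i, ((c i <= (d i).+1) && (d i <= (c i).+1))%N.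
  move=> cd i; have [i0|i0] := posnP i.
    have E (f : I) : psum f i = f i.
      rewrite /psum (bigD1 i)//= big1 ?addn0// => j /andP[].
      by rewrite i0 leqn0 -i0 => /eqP /val_inj ->; rewrite eqxx.
    by have := cd i; rewrite !E; lia.
  have ir : (i.-1 < r)%N by rewrite (leq_ltn_trans (leq_pred _)).
  have E (f : I) : psum f i = (f i + psum f (Ordinal ir))%N.
    rewrite /psum (bigD1 i)//=; congr (_ + _)%N; apply: eq_bigl => j.
    by rewrite -val_eqE/=; apply/idP/idP; lia.
  by have := cd i; have := cd (Ordinal ir); rewrite !E; lia.
have ab i : ((a i <= (b i).+1) && (b i <= (a i).+1))%N.
  by have [/step/(_ i)|/step/(_ i)] := tA a b aA bA; rewrite 1?andbC.
(* The differences -1, 0, 1 are stored as 0, 1, 2; the truncated subtraction is exact because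
   [b i <= a i + 1]. *)
exists [ffun i => inord (a i + 1 - b i)%N].
rewrite -sumrB scaler_sumr; apply: eq_bigr => i _; rewrite ffunE inordK; last first.
  by have := ab i; lia.
rewrite -scalerBl scalerA; congr (_ *: _).
rewrite /lat -mulrBl mulrC divfK ?LR0// natrB ?natrD; last by have := ab i; lia.
by rewrite addrAC addrK.
Qed.

(** Let [Y] be [L] times the partial sums of the coordinates, with integer parts [f] and fractional
    parts [z]. [layer_cake] writes [z] through indicators of nested sets [S]; rounding [Y] up on [S]
    gives a lattice point, and nestedness makes these points tight. *)
Lemma freudenthal_cover s x : K s -> hull s x ->
  exists A, lsimplex A s /\ hull [fset pos a | a in A]%fset x.
Proof.
move=> Ks /(hull_coords Ks)[lam [[lam0 lam1] slam ->]].
pose Y k : R := L%:R * \sum_(i < r | (i < k)%N) lam i.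
pose f k := Num.truncn (Y k).
pose z (k : 'I_r.+1) : R := Y k - (f k)%:R.
have Y0 k : 0 <= Y k by rewrite mulr_ge0// sumr_ge0.
have fY k : (f k)%:R <= Y k < (f k).+1%:R by exact: truncn_itv.
have YS (i : 'I_r) : Y i.+1 = Y i + L%:R * lam i.
  rewrite /Y -mulrDr; congr (_ * _); rewrite (bigD1 i)//= addrC; congr (_ + _).
  by apply: eq_bigl => j; rewrite ltnS -val_eqE/= andbC -ltn_neqAle.
have Yr : Y r = L%:R.
  by rewrite /Y (eq_bigl xpredT) => [|i]; rewrite ?lam1 ?mulr1// ltn_ord.
have [||c [c0 c1 cz cT cS]] := @layer_cake R 'I_r.+1 z 1.
- exact: ler01.
- by move=> k; have /andP[h1 h2] := fY k; rewrite /z subr_ge0 h1/= lerBlDr addrC natr1 ltW.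
pose y (S : {set 'I_r.+1}) k := (f k + (inord k \in S))%N.
have zE k : (k <= r)%N -> z (inord k) = Y k - (f k)%:R by move=> kr; rewrite /z inordK.
have mono (S : {set 'I_r.+1}) (i : 'I_r) : c S != 0 -> (y S i <= y S i.+1)%N.
  move=> Sn; have le1 : Y i <= Y i.+1 by rewrite YS lerDl mulr_ge0.
  have : (f i <= f i.+1)%N by apply: le_truncn.
  (* Where the integer part jumps there is room for rounding up the smaller value; where it does
     not, [z] does not decrease and [S] is an upper level set. *)
  rewrite /y leq_eqVlt => /predU1P[fe|lt]; last by case: (inord i \in S); lia.
  rewrite fe leq_add2l; case iS: (inord i \in S) => //.
  have [_ ->//] := cS S (inord i) (inord i.+1) Sn iS.
  by rewrite !zE// ?fe ?lerB// ltnW.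
pose a (S : {set 'I_r.+1}) : I := [ffun i : 'I_r => y S i.+1 - y S i]%N.
(* [Y 0 = 0] and [Y r = L] are integers, so a set of nonzero weight contains neither extreme index,
   and the numerators [a S] add up to exactly [L]. *)
have y0 S : c S != 0 -> y S 0%N = 0%N.
  move=> Sn; have Y00 : Y 0%N = 0 by rewrite /Y big_pred0 ?mulr0.
  rewrite /y /f Y00 truncn0 add0n; case iS: (_ \in S) => //.
  have [+ _] := cS S _ (inord 0) Sn iS; by rewrite zE// /f Y00 truncn0 subrr ltxx.
have psumE S k : c S != 0 -> (k <= r)%N -> (\sum_(i < r | (i < k)%N) a S i = y S k)%N.
  move=> Sn; elim: k => [|k IH] kr; first by rewrite big_pred0 ?y0.
  rewrite (bigD1 (Ordinal kr))//= (eq_bigl (fun i : 'I_r => (i < k)%N)); last first.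
    by move=> j; rewrite ltnS -val_eqE/= andbC -ltn_neqAle.
  by rewrite IH ?(ltnW kr)// ffunE subnK//; have := mono S (Ordinal kr) Sn.
have lata S : c S != 0 -> lattice (a S) s.
  move=> Sn; split.
    have -> : (\sum_i a S i = y S r)%N.
      by rewrite -(psumE S r)//; apply: eq_bigl => i; rewrite ltn_ord.
    rewrite /y /f Yr natrK; case iS: (_ \in S); last by rewrite addn0.
    have [+ _] := cS S _ (inord 0) Sn iS; by rewrite zE// /f Yr natrK subrr ltxx.
  (* If [lam i = 0] then [Y] is equal at [i] and [i.+1], so [S] contains [i] as soon as it contains
     [i.+1], and the numerator at [i] is 0. *)
  move=> i ai; apply: slam; apply: contra ai => /eqP li.
  have Ye : Y i.+1 = Y i by rewrite YS li mulr0 addr0.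
  rewrite ffunE /y /f Ye -/(f i) subn_eq0 leq_add2l.
  case iS: (inord i.+1 \in S) => //.
  have [_ ->//] := cS S (inord i.+1) (inord i) Sn iS.
  by rewrite !zE// ?Ye /f ?Ye// ltnW.
pose A := [fset a S | S in [set S | c S != 0]%SET]%fset.
have aA S : c S != 0 -> a S \in A by move=> Sn; apply: in_imfset; rewrite /= inE.
exists A; split; first split=> //.
- apply/eqP => A0; have : \sum_S c S = 0.
    rewrite big1// => S _; apply/eqP/negPn/negP => Sn.
    by have := aA S Sn; rewrite A0.
  by rewrite c1 => /eqP; rewrite oner_eq0.
- by move=> b /imfsetP[S /=]; rewrite inE => Sn ->; exact: lata.
- have K1 (S T : {set 'I_r.+1}) : c S != 0 -> c T != 0 -> S \subset T -> adj (a S) (a T).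
    move=> Sn Tn /fintype.subsetP ST j; rewrite /psum (psumE S j.+1)// (psumE T j.+1)//.
    rewrite /y -addnS !leq_add2l; case iS: (_ \in S); first by rewrite ST.
    by case: (_ \in T).
  move=> b b' /imfsetP[S /=]; rewrite inE => Sn -> /imfsetP[T /=]; rewrite inE => Tn ->.
  by have [ST|TS] := cT S T Sn Tn; [left|right]; exact: K1.
have yE k : (k <= r)%N -> \sum_S c S * (y S k)%:R = Y k.
  move=> kr; under eq_bigr => S _ do rewrite natrD mulrDr.
  rewrite big_split/= -mulr_suml c1 mul1r -[RHS](subrK (f k)%:R) -zE// addrC.
  congr (_ + _); rewrite -cz [RHS]big_mkcond; apply: eq_bigr => S _.
  by case: ifP; rewrite ?mulr1 ?mulr0.
have -> : \sum_i lam i *: vs i = \sum_S c S *: pos (a S).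
  rewrite sum_posE; apply: eq_bigr => i _; congr (_ *: _); apply: (mulfI LR0).
  rewrite mulr_sumr; transitivity (Y i.+1 - Y i); first by rewrite YS addrAC subrr add0r.
  rewrite -!yE ?(ltnW (ltn_ord i))// -sumrB; apply: eq_bigr => S _.
  have [->|Sn] := eqVneq (c S) 0; first by rewrite !mul0r mulr0 subrr.
  rewrite -mulrBr mulrCA /lat [_ / _]mulrC mulVKf ?LR0// ffunE natrB//.
  exact: mono.
apply: hull_conv => // S _ Sn; apply: hull_vertex; apply: in_imfset; exact: aA.
Qed.

Lemma freudenthal_complex : simplicial_complex freudenthal.
Proof.
split.
- move=> t [A [s [lA ->]]]; split; last exact: freudenthal_aff lA.
  have [_ /fset0Pn[a aA] _ _] := lA.
  by apply/fset0Pn; exists (pos a); apply: in_imfset.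
- exact: freudenthal_face.
- exact: freudenthal_capI.
- move=> x _; exists setT; first exact: filterT.
  by apply: sub_finite_set freudenthal_finite => t [].
Qed.

Lemma freudenthal_body : body freudenthal = body K.
Proof.
apply/seteqP; split=> x.
  move=> [t [A [s [lA ->]]] hx]; exists s; first by case: lA.
  exact: freudenthal_hull_sub lA _ hx.
move=> [s Ks hx]; have [A [lA hA]] := freudenthal_cover Ks hx.
by exists [fset pos a | a in A]%fset => //; exists A, s.
Qed.

End Freudenthal.

(** * Local estimates *)

Section LocalEstimates.
Variable R : realType.

Lemma form_evalDm m (w w' : 'M[R]_m) u v :
  form_eval (w + w') u v = form_eval w u v + form_eval w' u v.
Proof. by rewrite /form_eval mulmxDr mulmxDl mxE. Qed.

Lemma form_evalBm m (w w' : 'M[R]_m) u v :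
  form_eval (w - w') u v = form_eval w u v - form_eval w' u v.
Proof. by rewrite /form_eval mulmxBr mulmxBl !mxE. Qed.

Lemma form_evalZm m a (w : 'M[R]_m) u v : form_eval (a *: w) u v = a * form_eval w u v.
Proof. by rewrite /form_eval -scalemxAr -scalemxAl mxE. Qed.

Lemma form_evalNl m (w : 'M[R]_m) u v : form_eval w (- u) v = - form_eval w u v.
Proof. by rewrite -scaleN1r form_evalZl mulN1r. Qed.

Lemma form_evalE m (w : 'M[R]_m) u v :
  form_eval w u v = \sum_j \sum_k u 0 j * v 0 k * w j k.
Proof.
rewrite /form_eval mxE exchange_big/=; apply: eq_bigr => k _.
rewrite !mxE mulr_suml; apply: eq_bigr => j _; ring.
Qed.

Definition lin_mx m (T : 'I_m -> 'M[R]_m) (x : 'rV[R]_m) := \sum_i x 0 i *: T i.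

Lemma lin_mxD m (T : 'I_m -> 'M[R]_m) x y : lin_mx T (x + y) = lin_mx T x + lin_mx T y.
Proof.
by rewrite -big_split/=; apply: eq_bigr => i _; rewrite mxE scalerDl.
Qed.

Lemma lin_mxZ m (T : 'I_m -> 'M[R]_m) a x : lin_mx T (a *: x) = a *: lin_mx T x.
Proof. by rewrite scaler_sumr; apply: eq_bigr => i _; rewrite mxE scalerA. Qed.

Lemma closed_cyclic m (T : 'I_m -> 'M[R]_m) :
  (forall i j k, T i j k + T j k i + T k i j = 0) ->
  forall u v w, form_eval (lin_mx T u) v w + form_eval (lin_mx T v) w u +
    form_eval (lin_mx T w) u v = 0.
Proof.
move=> hT u v w.
have E x y z : form_eval (lin_mx T x) y z =
    \sum_i \sum_j \sum_k x 0 i * y 0 j * z 0 k * T i j k.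
  rewrite form_evalE; under eq_bigr => j _ do under eq_bigr => k _ do
    rewrite summxE mulr_sumr.
  under eq_bigr => j _ do rewrite exchange_big/=.
  rewrite exchange_big/=; apply: eq_bigr => i _; apply: eq_bigr => j _.
  by apply: eq_bigr => k _; rewrite mxE; ring.
have E2 : form_eval (lin_mx T v) w u =
    \sum_i \sum_j \sum_k u 0 i * v 0 j * w 0 k * T j k i.
  rewrite E; under eq_bigr => j _ do rewrite exchange_big/=.
  rewrite exchange_big/=; apply: eq_bigr => i _; apply: eq_bigr => j _.
  by apply: eq_bigr => k _; ring.
have E3 : form_eval (lin_mx T w) u v =
    \sum_i \sum_j \sum_k u 0 i * v 0 j * w 0 k * T k i j.
  rewrite E exchange_big/=; apply: eq_bigr => i _.
  rewrite exchange_big/=; apply: eq_bigr => j _.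
  by apply: eq_bigr => k _; ring.
rewrite E E2 E3 -!big_split/= big1// => i _; rewrite -!big_split/= big1// => j _.
by rewrite -!big_split/= big1// => k _; rewrite -!mulrDr hT mulr0.
Qed.

(* Stokes on the tetrahedron 0uvw: an affine form on a triangle has the same integral as
   the constant form equal to its value at the centroid. *)
Lemma affine_stokes m (w0 : 'M[R]_m) (T : 'I_m -> 'M[R]_m) u v w :
  alternating w0 -> (forall x, alternating (lin_mx T x)) ->
  (forall i j k, T i j k + T j k i + T k i j = 0) ->
  form_eval (w0 + lin_mx T (3^-1 *: (u + v + w))) (v - u) (w - u)
  - form_eval (w0 + lin_mx T (3^-1 *: (v + w))) v w
  + form_eval (w0 + lin_mx T (3^-1 *: (u + w))) u w
  - form_eval (w0 + lin_mx T (3^-1 *: (u + v))) u v = 0.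
Proof.
move=> a0 aT hT; have cyc := closed_cyclic hT u v w.
rewrite !form_evalDm !form_evalBl !form_evalBr !lin_mxZ !form_evalZm !lin_mxD.
rewrite !form_evalDm !form_evalxx// !(form_evalC u v)//.
move: cyc; rewrite (form_evalC u w)//; lra.
Qed.

(** Evaluation at the centroid is exact for affine forms, as [affine_stokes] expresses; a value at a
    vertex would leave a coboundary of order [l ^+ 3], too large to disappear in the limit. *)
Definition tri_form N m (w : 'rV[R]_m -> 'M[R]_m) (f : 'rV[R]_N -> 'rV[R]_m) a b c : R :=
  2^-1 * form_eval (w (3^-1 *: (f a + f b + f c))) (f b - f a) (f c - f a).

Definition flat_form N (W : 'M[R]_N) (a b c : 'rV[R]_N) : R :=
  2^-1 * form_eval W (b - a) (c - a).

Lemma flat_form_subdiv N (W : 'M[R]_N) a b c : alternating W ->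
  subdiv (flat_form W) a b c = flat_form W a b c.
Proof.
move=> aW; rewrite /subdiv /flat_form.
have -> : mid b c - mid a b = 2^-1 *: (c - a) by rewrite (midC a) midBl.
rewrite !midB.
have -> : c - b = (c - a) - (b - a) by rewrite opprB addrA subrK.
move: (b - a) (c - a) => u v.
rewrite !form_evalZl !form_evalZr !form_evalBl !form_evalxx//; by field.
Qed.

Lemma tri_form_swap12 N m (w : 'rV[R]_m -> 'M[R]_m) (f : 'rV[R]_N -> 'rV[R]_m) a b c :
  alternating (w (3^-1 *: (f a + f b + f c))) ->
  tri_form w f b a c = - tri_form w f a b c.
Proof.
move=> aw; rewrite /tri_form (addrC (f b)).
have -> : f c - f b = (f c - f a) - (f b - f a) by rewrite opprB addrA subrK.
rewrite -(opprB (f b)); move: (f b - f a) (f c - f a) => u v.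
rewrite form_evalNl form_evalBr form_evalxx//; ring.
Qed.

Lemma tri_form_swap23 N m (w : 'rV[R]_m -> 'M[R]_m) (f : 'rV[R]_N -> 'rV[R]_m) a b c :
  alternating (w (3^-1 *: (f a + f b + f c))) ->
  tri_form w f a c b = - tri_form w f a b c.
Proof.
move=> aw; rewrite /tri_form addrAC form_evalC//; ring.
Qed.

Lemma centroid_near m (q x y z : 'rV[R]_m) (e : R) :
  `|x - q| < e -> `|y - q| < e -> `|z - q| < e -> `|3^-1 *: (x + y + z) - q| < e.
Proof.
move=> hx hy hz.
have -> : 3^-1 *: (x + y + z) - q = 3^-1 *: ((x - q) + (y - q) + (z - q)).
  by apply/rowP => i; rewrite !mxE; field.
rewrite normrZ gtr0_norm ?invr_gt0// mulrC ltr_pdivrMr//.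
have := ler_normD (x - q + (y - q)) (z - q); have := ler_normD (x - q) (y - q); lra.
Qed.

Lemma norm_sum4 (x1 x2 x3 x4 k : R) : `|x1| <= 4 * k -> `|x2| <= k -> `|x3| <= k ->
  `|x4| <= k -> `|x1 - x2 + x3 - x4| <= k * 7.
Proof.
rewrite !ler_norml => /andP[? ?] /andP[? ?] /andP[? ?] /andP[? ?].
by apply/andP; split; lra.
Qed.

Lemma half_sum4 (x1 x2 x3 x4 y1 y2 y3 y4 : R) : y1 - y2 + y3 - y4 = 0 ->
  2^-1 * (y1 + x1) - 2^-1 * (y2 + x2) + 2^-1 * (y3 + x3) - 2^-1 * (y4 + x4) =
   2^-1 * (x1 - x2 + x3 - x4).
Proof. by move=> *; lra. Qed.

Section Estimates.
Variables (N m : nat) (A : set 'rV[R]_N) (p : 'rV[R]_N).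
Variables (f : 'rV[R]_N -> 'rV[R]_m) (Lf : 'M[R]_(N, m)) (w : 'rV[R]_m -> 'M[R]_m).
Variable T : 'I_m -> 'M[R]_m.
Hypotheses (Ap : A p) (fL : sdiff A p f (fun v => v *m Lf)).
Hypothesis wT : sdiff setT (f p) w (lin_mx T).

Let C : R := N%:R * `|Lf| + 1.
Let C1 : 1 <= C. Proof. by rewrite lerDr mulr_ge0. Qed.

Lemma w_near (e : R) : 0 < e -> exists2 d, 0 < d &
  forall x, `|x - f p| < d -> `|w x - w (f p)| <= e.
Proof.
move=> e0.
have lb : lin_bound (lin_mx T) (\sum_i `|T i|).
  move=> v; rewrite (le_trans (ler_norm_sum _ _ _))// mulr_suml.
  by apply: ler_sum => i _; rewrite normrZ mulrC ler_wpM2l// mx_entry_le.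
have [d d0 h] := sdiff_near lb (sumr_ge0 _ (fun i _ => normr_ge0 (T i))) I wT e0.
by exists d => // x xd; rewrite ltW// h.
Qed.

Lemma f_lip : exists2 d, 0 < d & forall x y, A x -> A y ->
  `|x - p| < d -> `|y - p| < d -> `|f x - f y| <= C * `|x - y|.
Proof. exact: sdiff_lip (mulmx_lin_bound Lf) fL. Qed.

Lemma f_near (e : R) : 0 < e -> exists2 d, 0 < d & forall x, A x -> `|x - p| < d ->
  `|f x - f p| < e.
Proof. by move=> e0; apply: sdiff_near (mulmx_lin_bound Lf) _ Ap fL e e0; rewrite mulr_ge0. Qed.

Lemma path2_13 (l : R) (a b c : 'rV[R]_N) : path2_le l a b c -> `|c - a| <= 2 * l.
Proof.
move=> [ab bc]; rewrite -(subrK b c) -addrA (le_trans (ler_normD _ _))//.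
lra.
Qed.

(** The form, the first edge and the second edge are replaced in turn by their values in the linear
    model at [p]. *)
Lemma tri_form_flat (e : R) : 0 < e -> exists2 r, 0 < r &
  forall a b c, A a -> A b -> A c -> `|a - p| < r -> `|b - p| < r -> `|c - p| < r ->
  forall l, path2_le l a b c ->
  `|tri_form w f a b c - flat_form (Lf *m w (f p) *m Lf^T) a b c| <= e * l ^+ 2.
Proof.
(* [Q - 1] collects the coefficients of the three errors, so the final bound is [e * ((Q - 1) / Q)]
   times [l ^+ 2]. *)
move=> e0; pose Q : R := (m%:R * m%:R) * (C ^+ 2 + 2 * `|w (f p)| * C) + 1.
have C0 : 0 < C by rewrite (lt_le_trans ltr01).
have Q1 : 0 < Q by rewrite ltr_wpDl// !(mulr_ge0, addr_ge0, exprn_ge0)// ltW.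
have eta0 : 0 < e / Q by rewrite divr_gt0.
have [d1 d10 h1] := w_near eta0.
have [d2 d20 h2] := f_near d10.
have [d3 d30 h3] := fL eta0.
have [d4 d40 h4] := f_lip.
exists (Num.min (Num.min d2 d3) d4); first by rewrite !lt_min d20 d30.
move=> a b c Aa Ab Ac; rewrite !lt_min => /andP[/andP[a2 a3] a4] /andP[/andP[b2 b3] b4].
move=> /andP[/andP[c2 c3] c4] l lp; have [ab bc] := lp; have ac := path2_13 lp.
have l0 : 0 <= l by exact: le_trans ab.
rewrite /tri_form /flat_form -mulrBr form_eval_mul.
set x := 3^-1 *: _; set u := f b - f a; set v := f c - f a.
set u0 := (b - a) *m Lf; set v0 := (c - a) *m Lf.
have hx : `|w x - w (f p)| <= e / Q by apply: h1; apply: centroid_near; apply: h2.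
have hu : `|u| <= C * l by rewrite (le_trans (h4 _ _ _ _ _ _))// ler_wpM2l// ltW.
have hv : `|v| <= 2 * C * l.
  by rewrite (le_trans (h4 _ _ _ _ _ _))// -mulrA mulrCA ler_wpM2l// ltW.
have hu0 : `|u0| <= C * l.
  rewrite (le_trans (mulmx_lin_bound Lf _))// ler_pM// ?mulr_ge0//.
  by rewrite /C lerDl.
have du : `|u - u0| <= e / Q * l.
  by rewrite (le_trans (h3 _ _ _ _ _ _))// ler_wpM2l// ltW.
have dv : `|v - v0| <= e / Q * (2 * l).
  by rewrite (le_trans (h3 _ _ _ _ _ _))// ler_wpM2l// ltW.
move: hx hu hv hu0 du dv; move: x u v u0 v0 => x u v u0 v0 hx hu hv hu0 du dv.
have -> : form_eval (w x) u v - form_eval (w (f p)) u0 v0 =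
    form_eval (w x - w (f p)) u v + form_eval (w (f p)) (u - u0) v +
    form_eval (w (f p)) u0 (v - v0).
  rewrite form_evalBm form_evalBl form_evalBr; ring.
have M (w' : 'M[R]_m) u' v' k1 k2 k3 : `|w'| <= k1 -> `|u'| <= k2 -> `|v'| <= k3 ->
    `|form_eval w' u' v'| <= (m%:R * m%:R) * (k1 * k2 * k3).
  move=> hw' hu' hv'; rewrite (le_trans (form_eval_le _ _ _))// -!mulrA.
  by rewrite !(ler_wpM2l, ler_pM, mulr_ge0)//.
have B1 := M _ _ _ _ _ _ hx hu hv.
have B2 := M _ _ _ _ _ _ (lexx `|w (f p)|) du hv.
have B3 := M _ _ _ _ _ _ (lexx `|w (f p)|) hu0 dv.
rewrite normrM gtr0_norm ?invr_gt0//.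
apply: (@le_trans _ _ (2^-1 * ((m%:R * m%:R) * (e / Q * (C * l) * (2 * C * l)) +
   (m%:R * m%:R) * (`|w (f p)| * (e / Q * l) * (2 * C * l)) +
   (m%:R * m%:R) * (`|w (f p)| * (C * l) * (e / Q * (2 * l)))))).
  rewrite ler_wpM2l ?invr_ge0// (le_trans (ler_normD _ _))// lerD//.
  by rewrite (le_trans (ler_normD _ _))// lerD.
have -> : (2^-1 * ((m%:R * m%:R) * (e / Q * (C * l) * (2 * C * l)) +
   (m%:R * m%:R) * (`|w (f p)| * (e / Q * l) * (2 * C * l)) +
   (m%:R * m%:R) * (`|w (f p)| * (C * l) * (e / Q * (2 * l))))) =
   (e * ((Q - 1) / Q)) * l ^+ 2.
  by rewrite /Q; field; rewrite -/Q gt_eqF.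
rewrite ler_wpM2r ?exprn_ge0// ler_piMr ?(ltW e0)//.
by rewrite ler_pdivrMr// mul1r lerBlDr lerDl.
Qed.

Hypotheses (aT : forall x, alternating (lin_mx T x))
  (hT : forall i j k, T i j k + T j k i + T k i j = 0).
Hypothesis aw : exists2 d, 0 < d & forall x, `|x - f p| < d -> alternating (w x).

(** Expand [w] to first order at [f a] with the derivative taken at [f p], which strict
    differentiability permits. The affine parts cancel over the four faces by [affine_stokes]; the
    remainder is small compared with [rho] and is multiplied by two edges of order [rho]. *)
Lemma tri_form_closed (e : R) : 0 < e -> exists2 r, 0 < r &
  forall a b c d, A a -> A b -> A c -> A d -> `|a - p| < r -> `|b - p| < r ->
    `|c - p| < r -> `|d - p| < r ->
  forall l, path3_le l a b c d -> `|cobd (tri_form w f) a b c d| <= e * l ^+ 3.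
Proof.
(* The face [bcd] has edges bounded by [2 * rho] and counts 4 times, the other faces once each: 7 in
   all, halved by the factor in [tri_form]. The 3 comes from the distance between [a] and [d], at
   most [3 * l]. *)
move=> e0; pose Q : R := (m%:R * m%:R) * (7 / 2 * (3 * C) ^+ 3) + 1.
have C0 : 0 < C by rewrite (lt_le_trans ltr01).
have Q1 : 0 < Q by rewrite ltr_wpDl// !(mulr_ge0, exprn_ge0)// ltW.
have eta0 : 0 < e / Q by rewrite divr_gt0.
have [d1 d10 h1] := wT eta0.
have [d0 d00 h0] := aw.
have d01 : 0 < Num.min d0 d1 by rewrite lt_min d00.
have [d2 d20 h2] := f_near d01.
have [d4 d40 h4] := f_lip.
exists (Num.min d2 d4); first by rewrite !lt_min d20.
move=> a b c d Aa Ab Ac Ad; rewrite !lt_min => /andP[a2 a4] /andP[b2 b4].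
move=> /andP[c2 c4] /andP[d2' d4'] l [lp cd].
have [ab bc] := lp; have ac := path2_13 lp.
have ad : `|d - a| <= 3 * l.
  rewrite -(subrK c d) -addrA (le_trans (ler_normD _ _))//; lra.
have l0 : 0 <= l by exact: le_trans ab.
pose rho := 3 * C * l; have rho0 : 0 <= rho by rewrite !mulr_ge0// ltW.
set u := f b - f a; set v := f c - f a; set z := f d - f a.
have hu : `|u| <= rho.
  rewrite (le_trans (h4 _ _ Ab Aa b4 a4))// /rho -mulrA mulrCA ler_wpM2l ?(ltW C0)//; lra.
have hv : `|v| <= rho.
  rewrite (le_trans (h4 _ _ Ac Aa c4 a4))// /rho -mulrA mulrCA ler_wpM2l ?(ltW C0)//; lra.
have hz : `|z| <= rho.
  by rewrite (le_trans (h4 _ _ Ad Aa d4' a4))// /rho -mulrA mulrCA ler_wpM2l ?(ltW C0).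
have near x : A x -> `|x - p| < d2 -> `|f x - f p| < Num.min d0 d1 by exact: h2.
have na := near _ Aa a2; have nb := near _ Ab b2; have nc := near _ Ac c2.
have nd := near _ Ad d2'.
have awa : alternating (w (f a)) by apply: h0; move: na; rewrite lt_min => /andP[].
have cen x y t : f x + f y + f t = 3 *: f a + ((f x - f a) + (f y - f a) + (f t - f a)).
  by apply/rowP => i; rewrite !mxE; ring.
have cen' x y t : 3^-1 *: (f x + f y + f t) - f a =
    3^-1 *: ((f x - f a) + (f y - f a) + (f t - f a)).
  by rewrite cen scalerDr scalerA mulVf// scale1r addrC addKr.
pose Er x := w x - (w (f a) + lin_mx T (x - f a)).
have hE x y t : `|f x - f p| < Num.min d0 d1 -> `|f y - f p| < Num.min d0 d1 ->
    `|f t - f p| < Num.min d0 d1 ->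
    `|f x - f a| <= rho -> `|f y - f a| <= rho -> `|f t - f a| <= rho ->
    `|Er (3^-1 *: (f x + f y + f t))| <= e / Q * rho.
  move=> nx ny nt hx hy ht; have := centroid_near nx ny nt; rewrite lt_min => /andP[_ n1].
  rewrite /Er opprD addrA (le_trans (h1 _ _ I I n1 _))//.
    by move: na; rewrite lt_min => /andP[].
  rewrite ler_wpM2l ?(ltW eta0)// cen' normrZ gtr0_norm ?invr_gt0// mulrC ler_pdivrMr//.
  have := ler_normD (f x - f a + (f y - f a)) (f t - f a).
  have := ler_normD (f x - f a) (f y - f a); lra.
have ra : `|f a - f a| <= rho by rewrite subrr normr0.
have E1 := hE b c d nb nc nd hu hv hz; have E2 := hE a c d na nc nd ra hv hz.
have E3 := hE a b d na nb nd ra hu hz; have E4 := hE a b c na nb nc ra hu hv.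
have F x s t g : x - f a = g -> form_eval (w x) s t =
    form_eval (w (f a) + lin_mx T g) s t + form_eval (Er x) s t.
  by move=> <-; rewrite -form_evalDm /Er addrC subrK.
have st := affine_stokes u v z awa aT hT.
have c1 : 3^-1 *: (f b + f c + f d) - f a = 3^-1 *: (u + v + z) by rewrite cen'.
have c2' : 3^-1 *: (f a + f c + f d) - f a = 3^-1 *: (v + z) by rewrite cen' subrr add0r.
have c3 : 3^-1 *: (f a + f b + f d) - f a = 3^-1 *: (u + z) by rewrite cen' subrr add0r.
have c4' : 3^-1 *: (f a + f b + f c) - f a = 3^-1 *: (u + v) by rewrite cen' subrr add0r.
have e1 : f c - f b = v - u by rewrite /u opprB addrA subrK.
have e2 : f d - f b = z - u by rewrite /u opprB addrA subrK.
rewrite /cobd /tri_form e1 e2 (F _ _ _ _ c1) (F _ _ _ _ c2') (F _ _ _ _ c3) (F _ _ _ _ c4').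
rewrite -/u -/v -/z.
move: E1 E2 E3 E4 st hu hv hz; set X1 := Er _; set X2 := Er _; set X3 := Er _; set X4 := Er _.
move: X1 X2 X3 X4 u v z {c1 c2' c3 c4' e1 e2} => X1 X2 X3 X4 u v z E1 E2 E3 E4 st hu hv hz.
have M (w' : 'M[R]_m) u' v' k1 k2 k3 : `|w'| <= k1 -> `|u'| <= k2 -> `|v'| <= k3 ->
    `|form_eval w' u' v'| <= (m%:R * m%:R) * (k1 * k2 * k3).
  move=> hw' hu' hv'; rewrite (le_trans (form_eval_le _ _ _))// -!mulrA.
  by rewrite !(ler_wpM2l, ler_pM, mulr_ge0)//.
have vu : `|v - u| <= 2 * rho.
  by rewrite (le_trans (ler_normB _ _))// mulr_natl mulr2n lerD.
have zu : `|z - u| <= 2 * rho.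
  by rewrite (le_trans (ler_normB _ _))// mulr_natl mulr2n lerD.
have B1 := M _ _ _ _ _ _ E1 vu zu; have B2 := M _ _ _ _ _ _ E2 hv hz.
have B3 := M _ _ _ _ _ _ E3 hu hz; have B4 := M _ _ _ _ _ _ E4 hu hv.
move: st B1 B2 B3 B4.
move: (form_eval (_ + _) (v - u) _) (form_eval (_ + _) v z) (form_eval (_ + _) u z) (form_eval (_ + _) u v).
move: (form_eval X1 _ _) (form_eval X2 _ _) (form_eval X3 _ _) (form_eval X4 _ _).
move=> x1 x2 x3 x4 y1 y2 y3 y4 st B1 B2 B3 B4.
have S : `|x1 - x2 + x3 - x4| <= m%:R * m%:R * (e / Q * rho * rho * rho) * 7.
  move: B1 B2 B3 B4; have -> : e / Q * rho * (2 * rho) * (2 * rho) =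
    4 * (e / Q * rho * rho * rho) by ring.
  move: (e / Q * rho * rho * rho) => k; rewrite mulrCA; move: (m%:R * m%:R * k) => k'.
  exact: norm_sum4.
rewrite (half_sum4 _ _ _ _ st).
rewrite normrM gtr0_norm ?invr_gt0//.
apply: (@le_trans _ _ (2^-1 * (m%:R * m%:R * (e / Q * rho * rho * rho) * 7))).
  by rewrite ler_wpM2l ?invr_ge0.
have -> : 2^-1 * (m%:R * m%:R * (e / Q * rho * rho * rho) * 7) =
    (e * ((Q - 1) / Q)) * l ^+ 3.
  have -> : Q - 1 = (m%:R * m%:R) * (7 / 2 * (3 * C) ^+ 3) by rewrite /Q addrK.
  rewrite /rho; move: (Q) (gt_eqF Q1) => Q' Qn; field; by rewrite Qn.
rewrite ler_wpM2r ?exprn_ge0// ler_piMr ?(ltW e0)//.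
by rewrite ler_pdivrMr// mul1r lerBlDr lerDl.
Qed.

End Estimates.
End LocalEstimates.

(** * Charts *)

Section StrictDerivatives.
Variable R : realType.

Lemma sdiff_sub (V W : normedModType R) (A B : set V) p (f L : V -> W) :
  A `<=` B -> sdiff B p f L -> sdiff A p f L.
Proof.
move=> AB h e /h[d d0 hd]; exists d => // x y /AB Bx /AB By; exact: hd.
Qed.

Lemma sdiff_eq_near (V W : normedModType R) (A : set V) p (f g L : V -> W) (d : R) :
  0 < d -> (forall x, A x -> `|x - p| < d -> f x = g x) -> sdiff A p f L -> sdiff A p g L.
Proof.
move=> d0 fg h e /h[d' d'0 hd]; exists (Num.min d d'); first by rewrite lt_min d0.
move=> x y Ax Ay; rewrite !lt_min => /andP[x1 x2] /andP[y1 y2].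
by rewrite -!fg//; apply: hd.
Qed.

Lemma sdiff_uniq_open (V W : normedModType R) (A : set V) p (f L L' : V -> W) :
  (forall (t : R) v, L (t *: v) = t *: L v) ->
  (forall (t : R) v, L' (t *: v) = t *: L' v) ->
  (exists2 r, 0 < r & forall x, `|x - p| < r -> A x) ->
  sdiff A p f L -> sdiff A p f L' -> forall v, L v = L' v.
Proof.
move=> Llin L'lin [r r0 hr] fL fL' v.
have v1 : 0 < `|v| + 1 by rewrite ltr_wpDl.
pose s := r / (`|v| + 1); have s0 : 0 < s by rewrite divr_gt0.
have Ap : A p by apply: hr; rewrite subrr normr0.
suff : L (s *: v) = L' (s *: v).
  by rewrite Llin L'lin => /(scalerI (lt0r_neq0 s0)).
apply: (sdiff_uniq Llin L'lin Ap _ fL fL') => t /andP[t0 t1]; apply: hr.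
rewrite [p + _]addrC addrK scalerA normrZ (ger0_norm (mulr_ge0 t0 (ltW s0))) -mulrA.
apply: (@le_lt_trans _ _ (s * `|v|)); first by rewrite ler_piMl// mulr_ge0// ltW.
by rewrite /s mulrAC ltr_pdivrMr// ltr_pM2l// ltrDl.
Qed.

Lemma mulmx_scaler N m (L : 'M[R]_(N, m)) (t : R) (v : 'rV[R]_N) : (t *: v) *m L = t *: (v *m L).
Proof. by rewrite scalemxAl. Qed.

(** The segments from [p] to the points of the simplex stay inside it, and their directions span
    [direction s], also when [p] lies on the boundary. *)
Lemma sdiff_hull_uniq N m (s : {fset 'rV[R]_N}) p (f : 'rV[R]_N -> 'rV[R]_m) L L' :
  hull s p -> sdiff (hull s) p f (mulmx^~ L) -> sdiff (hull s) p f (mulmx^~ L') ->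
  forall u, u \in direction s -> u *m L = u *m L'.
Proof.
move=> hp fL fL'.
have H y : hull s y -> (y - p) *m L = (y - p) *m L'.
  move=> hy; apply: (@sdiff_uniq _ _ _ _ p f (mulmx^~ L) (mulmx^~ L') (y - p)
    (mulmx_scaler L) (mulmx_scaler L') hp _ fL fL') => t t01.
  exact: hull_segment.
move=> u us; have /fset0Pn[w ws] := hull_nonempty hp.
have [c ->] := direction_span ws us.
rewrite !mulmx_suml big_seq [RHS]big_seq; apply: eq_bigr => v vs.
rewrite -!scalemxAl; congr (_ *: _).
have -> : v - w = (v - p) - (w - p) by rewrite opprB addrA subrK.
by rewrite [LHS]mulmxBl [RHS]mulmxBl !H//; apply: hull_vertex.
Qed.

Lemma Ck1_sdiff_row N m (U : set 'rV[R]_N) (f : 'rV[R]_N -> 'rV[R]_m) x :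
  open U -> U x -> smooth U f ->
  exists2 L : 'M[R]_(N, m), sdiff setT x f (mulmx^~ L) & forall u, 'D_u f x = u *m L.
Proof.
move=> oU Ux sf; exists (\matrix_i 'D_(delta_mx 0 i) f x).
  have := Ck1_sdiff oU Ux (sf 1%N).
  by rewrite (_ : (fun v => _) = mulmx^~ (\matrix_i 'D_(delta_mx 0 i) f x))//;
     apply/funext => v; rewrite sum_delta_mulmx.
move=> u; have := Ck1_sdiff oU Ux (sf 1%N) => /(sdiff_derive u) ->.
  by rewrite sum_delta_mulmx.
by move=> t v; rewrite scaler_sumr; apply: eq_bigr => i _; rewrite mxE scalerA.
Qed.

Lemma open_norm (V : normedModType R) (U : set V) p : open U -> U p ->
  exists2 r, 0 < r & forall x, `|x - p| < r -> U x.
Proof.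
move=> oU Up; have /nbhs_normP[r /= r0 hr] := open_nbhs_nbhs (conj oU Up).
by exists r => // x xp; apply: hr; rewrite /= distrC.
Qed.

End StrictDerivatives.

(** * The triangulation and its derivative read in charts *)

Section Charts.
Variables (R : realType) (N m : nat) (P : set 'rV[R]_N) (M : smooth_manifold R m).
Variables (omega : chart R M m -> 'rV[R]_m -> 'M[R]_m) (h : P -> M).
Hypotheses (sympl : symplectic_form omega) (hh : homeomorphism h).
Variable K : set {fset 'rV[R]_N}.
Hypotheses (trK : triangulation K P) (emb : forall s, K s -> smooth_embedding_on h s).
Local Notation V := 'rV[R]_N.
Implicit Types (c d : chart R M m) (x y p : V) (s : {fset V}).

(** [h] is defined on the subtype [P] only; the default value 0 makes its chart expression a map on
    the whole vector space, to which [sdiff] applies. *)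
Definition loc c x : 'rV[R]_m :=
  if pselect (P x) is left Px then chart_map c (h (SigSub (mem_set Px))) else 0.

Definition valid c x := exists2 z : P, val z = x & chart_dom c (h z).

Lemma locE c (z : P) : loc c (val z) = chart_map c (h z).
Proof.
rewrite /loc; case: pselect => [Px|[]]; last exact: set_valP.
by congr (chart_map c (h _)); apply: val_inj.
Qed.

Lemma hull_P s x : K s -> hull s x -> P x.
Proof. by move=> Ks hx; case: trK => _ <-; exists s. Qed.

Lemma P_val x : P x -> exists z : P, val z = x.
Proof. by move=> Px; exists (SigSub (mem_set Px)). Qed.

Lemma valid_cod c x : valid c x -> chart_cod c (loc c x).
Proof. by move=> [z <- dz]; rewrite locE; exact: chart_map_dom. Qed.

Lemma valid_exists x : P x -> exists2 c, atlas c & valid c x.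
Proof.
by move=> /P_val[z <-]; have [c ac dc] := atlas_cover (h z); exists c => //; exists z.
Qed.

Lemma loc_inj c x y : valid c x -> valid c y -> loc c x = loc c y -> x = y.
Proof.
move=> [z <- dz] [t <- dt]; rewrite !locE => e; congr (val _).
have [_ [g [_ hg _]]] := hh.
by apply: (can_inj hg); rewrite -(chart_mapK dz) e chart_mapK.
Qed.

Lemma valid_near c p : valid c p ->
  exists2 r, 0 < r & forall x, P x -> `|x - p| < r -> valid c x.
Proof.
move=> [z <- dz]; have [/continuousP ch _] := hh.
have [B oB BE] := ch _ (chart_dom_open c).
have Bz : B (val z).
  have : (h @^-1` chart_dom c) z by [].
  by rewrite -BE.
have [r r0 hr] := open_norm oB Bz.
exists r => // x /P_val[t <-] xz; exists t => //.
suff : (h @^-1` chart_dom c) t by [].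
by rewrite -BE; apply: hr.
Qed.

Lemma overlap_open c d : open (overlap c d).
Proof.
have := @chart_inv_cts _ _ _ c; rewrite continuous_open_subspace; last exact: chart_cod_open.
move=> /(continuous_inP _ (@chart_cod_open _ _ _ c)); apply; exact: chart_dom_open.
Qed.

Lemma transition_loc c d x : valid c x -> valid d x ->
  overlap c d (loc c x) /\ transition c d (loc c x) = loc d x.
Proof.
move=> [z <- dz] [t /val_inj-> dd]; rewrite /overlap /transition !locE chart_mapK//.
by split=> //; split; [exact: chart_map_dom|rewrite /= chart_mapK].
Qed.

Lemma transition_sdiff c d (x : 'rV[R]_m) : atlas c -> atlas d -> overlap c d x ->
  exists2 D : 'M[R]_m, sdiff setT x (transition c d) (mulmx^~ D) &
    forall u, 'D_u (transition c d) x = u *m D.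
Proof.
move=> ac ad ox; apply: Ck1_sdiff_row (@overlap_open c d) ox _.
exact: atlas_smooth.
Qed.

Lemma row_eq_mx n (A : 'M[R]_(n, n)) : (forall v : 'rV[R]_n, v *m A = v) -> A = 1%:M.
Proof.
by move=> hA; apply/row_matrixP => i; rewrite rowE hA -[LHS]mulmx1 -rowE.
Qed.

(** The two transition maps compose to the identity on the overlap, and strict derivatives along an
    open set are unique. *)
Lemma transition_unit c d (x : 'rV[R]_m) (D : 'M[R]_m) : atlas c -> atlas d -> overlap c d x ->
  sdiff setT x (transition c d) (mulmx^~ D) -> exists D' : 'M[R]_m, D *m D' = 1%:M.
Proof.
move=> ac ad ox hD; have [cx dx] := ox.
have ox' : overlap d c (transition c d x).
  split; first exact: chart_map_dom.
  by rewrite /= /transition chart_mapK//; exact: chart_inv_cod.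
have [D' hD' _] := transition_sdiff ad ac ox'.
exists D'; apply: row_eq_mx => v; rewrite mulmxA.
have [r r0 hr] := open_norm (@overlap_open c d) ox.
have id_sd : sdiff (overlap c d) x (transition d c \o transition c d) (fun v => v).
  apply: (@sdiff_eq_near _ _ _ _ x id _ _ 1 ltr01).
    move=> y [cy dy] _ /=; rewrite /transition chart_mapK// chart_invK//.
  move=> e e0; exists 1; rewrite ?ltr01// => y z _ _ _ _.
  by rewrite subrr normr0 mulr_ge0// ltW.
have comp_sd : sdiff (overlap c d) x (transition d c \o transition c d)
    (mulmx^~ D' \o mulmx^~ D).
  apply: (sdiff_comp (mulmx_lin_bound D) _ (mulmx_lin_bound D') _ _ ox _
    (sdiff_sub (@subsetT _ _) hD) hD').
  - by rewrite mulr_ge0.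
  - by rewrite mulr_ge0.
  - by move=> y z; rewrite mulmxBl.
  - by exists 1.
have := sdiff_uniq_open _ _ _ comp_sd id_sd v; apply => //.
- by move=> t w /=; rewrite -!scalemxAl.
- by exists r.
Qed.

Definition hdiff c s p (L : 'M[R]_(N, m)) := sdiff (hull s) p (loc c) (mulmx^~ L).

Lemma hdiff_change c d s p L : atlas c -> atlas d -> K s -> hull s p ->
  valid c p -> valid d p -> hdiff c s p L ->
  exists D : 'M[R]_m, [/\ hdiff d s p (L *m D), (exists D' : 'M[R]_m, D *m D' = 1%:M) &
    forall u, 'D_u (transition c d) (loc c p) = u *m D].
Proof.
move=> ac ad Ks hp vc vd hL.
have [oc Tp] := transition_loc vc vd.
have [D hD DE] := transition_sdiff ac ad oc.
exists D; split=> //; last exact: transition_unit hD.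
have [r r0 hr] := valid_near vc; have [r' r'0 hr'] := valid_near vd.
have comp_sd : sdiff (hull s) p (transition c d \o loc c) (mulmx^~ D \o mulmx^~ L).
  apply: (sdiff_comp (mulmx_lin_bound L) _ (mulmx_lin_bound D) _ _ hp _ hL hD).
  - by rewrite mulr_ge0.
  - by rewrite mulr_ge0.
  - by move=> y z; rewrite mulmxBl.
  - by exists 1.
have LD : mulmx^~ D \o mulmx^~ L = (mulmx^~ (L *m D) : 'rV[R]_N -> 'rV[R]_m).
  by apply/funext => v /=; rewrite mulmxA.
rewrite LD in comp_sd.
apply: (sdiff_eq_near (d := Num.min r r')) comp_sd; first by rewrite lt_min r0.
move=> x hx; rewrite lt_min => /andP[xr xr'].
have Px := hull_P Ks hx.
by have [_ /= ->] := transition_loc (hr _ Px xr) (hr' _ Px xr').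
Qed.

(** The local extension [F] in [smooth_embedding_on] comes with its own chart; the derivative is
    moved to [c] by the transition map and stays injective because that of the transition is
    invertible. *)
Lemma hdiff_exists c s p : atlas c -> K s -> hull s p -> valid c p ->
  exists2 L, hdiff c s p L & forall u, u \in direction s -> u *m L = 0 -> u = 0.
Proof.
move=> ac Ks hp vc; have [z zp] := P_val (hull_P Ks hp).
have [_ /(_ z)] := emb Ks; rewrite zp => /(_ hp)[c0 [W [F [ac0 [oW Wp] sF locF inj]]]].
have [L0 hL0 L0E] := Ck1_sdiff_row oW Wp sF.
have [r r0 hr] := open_norm oW Wp.
have vc0 : valid c0 p.
  by exists z => //; have [] := locF z; rewrite ?zp.
have h0 : hdiff c0 s p L0.
  apply: (sdiff_eq_near (d := r) r0 _ (sdiff_sub (@subsetT _ _) hL0)) => x hx xr.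
  have [t tx] := P_val (hull_P Ks hx); have Wx := hr _ xr.
  by have := locF t; rewrite tx => /(_ hx Wx)[_ <-]; rewrite -tx locE.
have [D [hD [D' DD'] _]] := hdiff_change ac0 ac Ks hp vc0 vc h0.
exists (L0 *m D) => // u us; rewrite mulmxA => uLD.
apply: inj => //; rewrite L0E.
have := congr1 (fun v => v *m D') uLD; rewrite /= mul0mx -[_ *m D *m D']mulmxA DD' mulmx1.
by [].
Qed.

Lemma hdiff_form c d s p L L' u v : atlas c -> atlas d -> K s -> hull s p ->
  valid c p -> valid d p -> hdiff c s p L -> hdiff d s p L' ->
  u \in direction s -> v \in direction s ->
  form_eval (omega c (loc c p)) (u *m L) (v *m L) =
  form_eval (omega d (loc d p)) (u *m L') (v *m L').
Proof.
move=> ac ad Ks hp vc vd hL hL' us vs.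
have [D [hD _ DE]] := hdiff_change ac ad Ks hp vc vd hL.
have [oc Tp] := transition_loc vc vd.
have [[_ tf] _ _] := sympl.
rewrite (tf c d ac ad _ oc) !DE Tp -!mulmxA.
by rewrite (sdiff_hull_uniq hp hD hL' us) (sdiff_hull_uniq hp hD hL' vs).
Qed.

Lemma pullback_exists s p : K s -> hull s p ->
  exists W : 'M[R]_N, alternating W /\ forall c L, atlas c -> valid c p -> hdiff c s p L ->
    forall u v, u \in direction s -> v \in direction s ->
    form_eval W u v = form_eval (omega c (loc c p)) (u *m L) (v *m L).
Proof.
move=> Ks hp; have [c0 ac0 vc0] := valid_exists (hull_P Ks hp).
have [L0 hL0 _] := hdiff_exists ac0 Ks hp vc0.
exists (L0 *m omega c0 (loc c0 p) *m L0^T); split.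
  have [[tf _] _ _] := sympl; have [_ alt] := tf _ ac0.
  have a0 := alt _ (valid_cod vc0).
  by rewrite /alternating !trmx_mul trmxK a0 mulNmx mulmxN mulmxA.
move=> c L ac vc hL u v us vs; rewrite form_eval_mul.
exact: (hdiff_form ac0 ac Ks hp vc0 vc hL0 hL us vs).
Qed.

Lemma omega_local c p : atlas c -> valid c p ->
  exists T : 'I_m -> 'M[R]_m, [/\ sdiff setT (loc c p) (omega c) (lin_mx T),
    forall x : 'rV[R]_m, alternating (lin_mx T x), forall i j k, T i j k + T j k i + T k i j = 0,
    (exists2 d, 0 < d & forall x : 'rV[R]_m, `|x - loc c p| < d -> alternating (omega c x)) &
    omega c (loc c p) \in unitmx].
Proof.
move=> ac vc; have [[tf _] cl nd] := sympl; have [sm alt] := tf _ ac.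
have cp := valid_cod vc; have oc := @chart_cod_open _ _ _ c.
have sd := Ck1_sdiff oc cp (sm 1%N).
have [r r0 hr] := open_norm oc cp.
exists (fun i => 'D_(delta_mx 0 i) (omega c) (loc c p)); split=> //; last exact: nd.
- move=> x; rewrite /alternating; apply/eqP; rewrite -subr_eq0 opprK; apply/eqP.
  pose T i := 'D_(delta_mx 0 i) (omega c) (loc c p).
  suff: (lin_mx T x)^T = - lin_mx T x by move=> ->; rewrite addNr.
  (* The negated transpose of the derivative is again a strict derivative of [omega c], as its
     values are alternating; uniqueness makes the derivative alternating. *)
  have := @sdiff_uniq_open _ _ _ (chart_cod c) (loc c p) (omega c) (lin_mx T)
     (fun x : 'rV[R]_m => - (lin_mx T x)^T).
  move=> /(_ (lin_mxZ T)) H; rewrite [X in _ = - X]H ?opprK//.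
  + by move=> t v; rewrite lin_mxZ linearZ/= scalerN.
  + by exists r.
  + exact: sdiff_sub (@subsetT _ _) sd.
  + move=> e e0; have [d d0 hd] := sd e e0; exists d => // y z cy cz yp zp.
    have -> : omega c y - omega c z - (- (lin_mx T (y - z))^T) =
        - (omega c y - omega c z - lin_mx T (y - z))^T.
      have /matrixP ay := alt y cy; have /matrixP az := alt z cz.
      move: (lin_mx T (y - z)) => X; apply/matrixP => i j.
      move: (ay i j) (az i j); rewrite !mxE => -> ->; ring.
    by rewrite normrN trmx_norm; exact: hd.
- move=> i j k; have := cl c ac _ cp i j k.
  have [_ hk] := sm 1%N.
  have E (l a b : 'I_m) :
      'D_(delta_mx 0 l) (fun y : 'rV[R]_m => omega c y a b : R) (loc c p) =
      'D_(delta_mx 0 l) (omega c) (loc c p) a b.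
    by have [dl _] := hk l; rewrite derive_mx ?mxE//; exact: dl.
  by rewrite !E.
- by exists r => // x /hr; exact: alt.
Qed.

End Charts.

(** * Orientation *)

Section Orientation.
Variable R : realType.

HB.instance Definition _ (p q : nat) := Complete.copy (matrix R p q) (matrix R p q).

(** The matrix determinant lemma, from two block triangular factorisations of one matrix. *)
Lemma det_1Dmul n (u : 'cV[R]_n) (v : 'rV[R]_n) :
  \det (1%:M + u *m v) = 1 + (v *m u) 0 0.
Proof.
pose A := block_mx (1%:M : 'M[R]_1) v (- u) 1%:M.
have E1 : A = block_mx (1%:M : 'M[R]_1) 0 (- u) 1%:M *m block_mx 1%:M v 0 (1%:M + u *m v).
  rewrite mulmx_block !mul1mx !mulmx1 !mul0mx ?mulmx0 !addr0 mulNmx.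
  by rewrite addrCA addNr addr0.
have E2 : A = block_mx (1%:M + v *m u) v 0 1%:M *m block_mx (1%:M : 'M[R]_1) 0 (- u) 1%:M.
  rewrite mulmx_block !mulmx1 !mul0mx ?mulmx0 mulmxN !add0r mul1mx.
  by rewrite addrK.
have := congr1 determinant E1; rewrite {1}E2 !det_mulmx !det_lblock !det_ublock.
rewrite !det1 !mulr1 !mul1r => <-.
by rewrite det_mx11 !mxE.
Qed.

Lemma closed_ball_fixpoint (X : completeNormedModType R) (x0 : X) (r : R) (f : X -> X) :
  0 <= r -> (forall x y, `|x - x0| <= r -> `|y - x0| <= r -> `|f x - f y| <= 2^-1 * `|x - y|) ->
  (forall x, `|x - x0| <= r -> `|f x - x0| <= r) ->
  exists2 x, `|x - x0| <= r & f x = x.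
Proof.
move=> r0 hc hf; pose U := [set x : X | `|x0 - x| <= r].
have fU : forall x, U x -> U (f x) by move=> x; rewrite /U /= distrC => /hf; rewrite distrC.
pose F : {fun U >-> U} := HB.pack f (isFun.Build _ _ U U f fU).
have [|||x Ux xF] := @banach_fixed_point R X U F.
- exists (2^-1)%:nng; split; first by rewrite /= invf_lt1// ltr1n.
  by move=> [x y] /= [Ux Uy]; apply: hc; rewrite distrC.
- exact: closed_closed_ball_.
- by exists x0; rewrite /U /= subrr normr0.
by exists x; rewrite // distrC.
Qed.

Lemma exists_small (c d : R) : 0 < d -> 0 <= c -> exists2 s, 0 < s <= 1 & s * c < d.
Proof.
move=> d0 c0; have c1 : 0 < c + 1 by rewrite ltr_wpDl.
exists (Num.min 1 (d / (c + 1))).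
  by rewrite lt_min ltr01 divr_gt0//= ge_min lexx.
apply: (@le_lt_trans _ _ (d / (c + 1) * c)).
  by rewrite ler_wpM2r// ge_min lexx orbT.
by rewrite mulrAC ltr_pdivrMr// ltr_pM2l// ltrDl.
Qed.

(** * Two simplices with a common facet *)

Section Sides.
Variables (N m : nat) (t : 'I_m -> 'rV[R]_N) (a b : 'rV[R]_N).
Variables (sa sb st : {fset 'rV[R]_N}) (f : 'rV[R]_N -> 'rV[R]_m) (La Lb : 'M[R]_(N, m)).
Hypotheses (m0 : (0 < m)%N) (asa : a \in sa) (bsb : b \in sb).
Hypotheses (tst : forall i, t i \in st) (sta : (st `<=` sa)%fset) (stb : (st `<=` sb)%fset).
Let x0 := \sum_i (m%:R^-1 : R) *: t i.
Hypotheses (fa : sdiff (hull sa) x0 f (mulmx^~ La)) (fb : sdiff (hull sb) x0 f (mulmx^~ Lb)).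
Let A := \matrix_i ((t i - a) *m La).
Let B := \matrix_i ((t i - b) *m Lb).
Hypotheses (uA : A \in unitmx) (uB : B \in unitmx).
Hypothesis f_inj : exists2 r, 0 < r & forall x y, hull sa x -> hull sb y ->
  `|x - x0| < r -> `|y - x0| < r -> f x = f y -> x = y.
Hypothesis apart : forall s, 0 < s <= 1 -> ~ hull sb (x0 + s *: (a - x0)).

Let mR : m%:R != 0 :> R. Proof. by rewrite pnatr_eq0 -lt0n. Qed.

Let hx0 : hull st x0.
Proof.
apply: hull_conv => [i _||i _ _]; rewrite ?invr_ge0//; last exact: hull_vertex.
by rewrite sumr_const card_ord -[LHS]mulr_natr mulVf.
Qed.

Let hax0 : hull sa x0.
Proof. by apply: hull_sub hx0 => v /(fsubsetP sta); exact: hull_vertex. Qed.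

Let hbx0 : hull sb x0.
Proof. by apply: hull_sub hx0 => v /(fsubsetP stb); exact: hull_vertex. Qed.

Let al := (x0 - a) *m La.
Let c := al *m invmx B.
(** The sum of the coordinates in the basis of rows of [B] is a linear functional equal to 1 on the
    image of every [t i - b], hence 0 on the facet directions. So [kappa] is positive when, to first
    order, the image of [a] lies on the side of [b]. *)
Let kappa := \sum_i c 0 i.

Lemma bary_matrix (L : 'M[R]_(N, m)) v :
  (x0 - v) *m L = const_mx m%:R^-1 *m \matrix_i ((t i - v) *m L).
Proof.
rewrite [RHS]mulmx_sum_row.
have -> : x0 - v = \sum_i m%:R^-1 *: (t i - v).
  under eq_bigr => i _ do rewrite scalerBr.
  by rewrite sumrB sumr_const card_ord -[X in _ = _ - X]scaler_nat scalerA mulfV// scale1r.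
rewrite mulmx_suml; apply: eq_bigr => i _.
by rewrite mxE rowK scalemxAl.
Qed.

(** The two derivatives agree along the facet, so each row of [A] is the matching row of [B] plus
    one fixed vector. This is a rank-one change, to which [det_1Dmul] applies. *)
Lemma det_sides : \det A = kappa * \det B.
Proof.
pose d := c - const_mx m%:R^-1.
have -> : A = (1%:M + const_mx 1 *m d) *m B.
  rewrite mulmxDl mul1mx -mulmxA mulmxBl /c mulmxKV// -bary_matrix.
  apply/row_matrixP => i; rewrite linearD/= !rowK row_mul.
  have -> : row i (const_mx 1 : 'cV[R]_m) = 1%:M.
    by apply/rowP => j; rewrite !mxE ord1.
  rewrite mul1mx /al.
  have E : (t i - x0) *m La = (t i - x0) *m Lb.
    have hs : hull st `<=` hull sa by apply: hull_sub => v /(fsubsetP sta); exact: hull_vertex.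
    have hs' : hull st `<=` hull sb by apply: hull_sub => v /(fsubsetP stb); exact: hull_vertex.
    apply: (sdiff_hull_uniq hx0 (sdiff_sub hs fa) (sdiff_sub hs' fb)).
    by apply: hull_direction => //; apply: hull_vertex.
  have -> : t i - a = (t i - x0) + (x0 - a) by rewrite addrA subrK.
  have -> : t i - b = (t i - x0) + (x0 - b) by rewrite addrA subrK.
  by rewrite mulmxDl E [X in _ = X + _]mulmxDl -addrA; congr (_ + _); rewrite addrC subrK.
rewrite det_mulmx det_1Dmul; congr (_ * _).
have -> : (d *m (const_mx 1 : 'cV_m)) 0 0 = \sum_i (c 0 i - m%:R^-1).
  by rewrite mxE; apply: eq_bigr => i _; rewrite [const_mx _ _ _]mxE mulr1 /d /c !mxE.
by rewrite sumrB sumr_const card_ord -[X in _ - X]mulr_natr mulVf// addrC subrK.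
Qed.

(** If [kappa] were positive, a point [xs] slightly off [x0] towards [a] would have nearly the same
    image as the point [x0 + eta0 *m E] of [hull sb]. A contraction corrects the latter so that the
    images agree exactly; injectivity then puts [xs] into [hull sb], against [apart]. *)
Lemma no_overlap : ~ 0 < kappa.
Proof.
move=> k0.
pose E := \matrix_i (t i - b).
have EB : E *m Lb = B by apply/row_matrixP => i; rewrite row_mul !rowK.
pose g eta := f (x0 + eta *m E).
pose CE : R := m%:R * `|E|; pose CI : R := m%:R * `|invmx B|.
have CE0 : 0 <= CE by rewrite mulr_ge0.
have CI0 : 0 <= CI by rewrite mulr_ge0.
(* On the ball of radius [s * rho] around [eta0] the sum of the [m] coordinates changes by at most
   [s * kappa / 2], so the weight of [b], equal to [s * kappa] at the centre, stays positive. *)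
pose rho := kappa / (2 * m%:R).
have rho0 : 0 < rho by rewrite divr_gt0// mulr_gt0// ltr0n.
pose Q := CI * (CE * `|c| + `|a - x0|).
have Q0 : 0 <= Q by rewrite mulr_ge0// addr_ge0// mulr_ge0.
have half0 : (0 : R) < 2^-1 by rewrite invr_gt0.
(* [e1] makes [Psi] contract by one half; [e2] makes it move the centre by at most half the
   radius. *)
have [e1 /andP[e10 _] he1] := exists_small half0 (mulr_ge0 CI0 CE0).
have [e2 /andP[e20 _] he2] := exists_small (divr_gt0 rho0 (ltr0n _ 2)) Q0.
pose e := Num.min e1 e2.
have e0 : 0 < e by rewrite lt_min e10.
have [d1 d10 h1] := fa e0; have [d2 d20 h2] := fb e0; have [r r0 hr] := f_inj.
pose d := Num.min (Num.min d1 d2) r.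
have d0 : 0 < d by rewrite !lt_min d10 d20.
have B0 : 0 <= CE * (`|c| + rho) + `|a - x0|.
  by apply: addr_ge0 => //; apply: mulr_ge0 => //; apply: addr_ge0 => //; exact: ltW.
(* [s1] keeps all points within [d] of [x0], where the estimates hold; [s2] keeps the weights
   [m%:R^-1 + eta 0 j] of the facet vertices positive. *)
have [s1 /andP[s10 s11] hs1] := exists_small d0 B0.
have m0' : 0 < (m%:R : R)^-1 by rewrite invr_gt0 ltr0n.
have [s2 /andP[s20 s21] hs2] := exists_small m0' (addr_ge0 (normr_ge0 c) (ltW rho0)).
pose s := Num.min s1 s2.
have s0 : 0 < s by rewrite lt_min s10.
have sle1 : s <= 1 by rewrite ge_min s11.
pose xs := x0 + s *: (a - x0).
have hxs : hull sa xs.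
  by apply: hull_segment => //; [exact: hull_vertex|rewrite (ltW s0)].
pose eta0 := - s *: c.
have hs1' : s * (CE * (`|c| + rho) + `|a - x0|) < d.
  by apply: le_lt_trans hs1; rewrite ler_wpM2r// ge_min lexx.
have hs2' : s * (`|c| + rho) < m%:R^-1.
  by apply: le_lt_trans hs2; rewrite ler_wpM2r ?ge_min ?lexx ?orbT// addr_ge0// ltW.
have eta0n : `|eta0| = s * `|c| by rewrite normrZ normrN gtr0_norm.
have etan eta : `|eta - eta0| <= s * rho -> `|eta| <= s * (`|c| + rho).
  move=> h; rewrite -(subrK eta0 eta) (le_trans (ler_normD _ _))// eta0n mulrDr addrC.
  by rewrite lerD2l.
have near eta : `|eta - eta0| <= s * rho -> `|x0 + eta *m E - x0| < d.
  move=> h; rewrite addrC addKr (le_lt_trans (mulmx_lin_bound E eta))//.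
  apply: le_lt_trans hs1'; rewrite (le_trans (ler_wpM2l CE0 (etan _ h)))//.
  by rewrite mulrCA ler_wpM2l ?(ltW s0)// lerDl.
have xsn : `|xs - x0| < d.
  rewrite /xs addrC addKr normrZ gtr0_norm//; apply: le_lt_trans hs1'.
  by rewrite ler_wpM2l ?(ltW s0)// lerDr mulr_ge0// addr_ge0// ltW.
have inb eta : `|eta - eta0| <= s * rho -> hull sb (x0 + eta *m E).
  move=> h.
  have -> : x0 + eta *m E = \sum_(i <- None :: map Some (index_enum 'I_m))
      (if i is Some j then m%:R^-1 + eta 0 j else - \sum_j eta 0 j) *:
      (if i is Some j then t j else b).
    rewrite big_cons big_map mulmx_sum_row.
    have -> : \sum_i eta 0 i *: row i E = \sum_i (eta 0 i *: t i - eta 0 i *: b).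
      by apply: eq_bigr => i _; rewrite rowK scalerBr.
    under [in RHS]eq_bigr => i _ do rewrite scalerDl.
    rewrite sumrB big_split/= -/x0 -scaler_suml scaleNr.
    by rewrite addrA [RHS]addrC.
  apply: hull_conv.
  - case=> [j _|_].
      have := etan _ h; have := mx_entry_le eta 0 j => h3 h4.
      have : `|eta 0 j| < m%:R^-1 by rewrite (le_lt_trans h3)// (le_lt_trans h4).
      by rewrite ltr_norml => /andP[h5 _]; rewrite -lerBlDl sub0r ltW// .
    have : \sum_j eta 0 j = - s * kappa + \sum_j (eta - eta0) 0 j.
      rewrite /kappa mulr_sumr -big_split/=; apply: eq_bigr => j _.
      by rewrite !mxE; ring.
    move=> ->; have : `|\sum_j (eta - eta0) 0 j| <= s * kappa / 2.
      rewrite (le_trans (ler_norm_sum _ _ _))//.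
      apply: (@le_trans _ _ (\sum_(j < m) s * rho)).
        by apply: ler_sum => j _; rewrite (le_trans (mx_entry_le _ _ _)).
      rewrite sumr_const card_ord -mulr_natl /rho le_eqVlt; apply/orP; left.
      by apply/eqP; field.
    have : 0 < s * kappa by rewrite mulr_gt0.
    rewrite ler_norml mulNr => ? /andP[_ ?]; lra.
  - rewrite big_cons big_map big_split/= sumr_const card_ord -(mulr_natr m%:R^-1) mulVf//.
    by rewrite addrCA addNr addr0.
  - by case=> [j|] _ _; apply: hull_vertex => //; exact: (fsubsetP stb).
have dd eta : `|eta - eta0| <= s * rho -> `|x0 + eta *m E - x0| < d2.
  by move=> /near; rewrite !lt_min => /andP[/andP[]].
have gdiff eta eta' : `|eta - eta0| <= s * rho -> `|eta' - eta0| <= s * rho ->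
    `|g eta - g eta' - (eta - eta') *m B| <= e * (CE * `|eta - eta'|).
  move=> h h'; have := h2 _ _ (inb _ h) (inb _ h') (dd _ h) (dd _ h').
  have -> : x0 + eta *m E - (x0 + eta' *m E) = (eta - eta') *m E.
    by rewrite opprD addrACA subrr add0r mulmxBl.
  rewrite -mulmxA EB => hh; apply: le_trans hh _.
  by rewrite ler_wpM2l ?(ltW e0)//; exact: mulmx_lin_bound.
(* Newton's iteration for [g eta = f xs] with the derivative frozen at [B]; its fixed points are the
   solutions. *)
pose Psi eta := eta - (g eta - f xs) *m invmx B.
have sr0 : 0 <= s * rho by rewrite mulr_ge0 ?(ltW s0)// ltW.
have eta00 : `|eta0 - eta0| <= s * rho by rewrite subrr normr0.
have hIb := mulmx_lin_bound (invmx B).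
have ctr eta eta' : `|eta - eta0| <= s * rho -> `|eta' - eta0| <= s * rho ->
    `|Psi eta - Psi eta'| <= 2^-1 * `|eta - eta'|.
  move=> h h'.
  have -> : Psi eta - Psi eta' = - ((g eta - g eta' - (eta - eta') *m B) *m invmx B).
    rewrite mulmxBl mulmxK// /Psi opprB.
    have -> : g eta - g eta' = (g eta - f xs) - (g eta' - f xs).
      by rewrite opprB addrA subrK.
    rewrite (mulmxBl (g eta - f xs)); move: ((g eta - f xs) *m _) ((g eta' - f xs) *m _) => y z.
    by apply/rowP => i; rewrite !mxE; ring.
  rewrite normrN (le_trans (hIb _))// -/CI.
  rewrite (le_trans (ler_wpM2l CI0 (gdiff _ _ h h')))//.
  have -> : CI * (e * (CE * `|eta - eta'|)) = e * (CI * CE) * `|eta - eta'| by ring.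
  rewrite ler_wpM2r// (le_trans _ (ltW he1))//.
  by rewrite ler_wpM2r ?mulr_ge0// ge_min lexx.
have Psi0 : `|Psi eta0 - eta0| <= s * rho / 2.
  have -> : Psi eta0 - eta0 = - ((g eta0 - f xs) *m invmx B).
    by rewrite /Psi addrAC subrr add0r.
  rewrite normrN (le_trans (hIb _))// -/CI.
  have F1 : `|g eta0 - f x0 + s *: al| <= e * (CE * (s * `|c|)).
    have := h2 _ _ (inb _ eta00) hbx0 (dd _ eta00); rewrite subrr normr0 => /(_ d20).
    have -> : x0 + eta0 *m E - x0 = eta0 *m E by rewrite addrC addKr.
    have -> : eta0 *m E *m Lb = - (s *: al).
      by rewrite -mulmxA EB /eta0 scaleNr mulNmx -scalemxAl /c mulmxKV.
    rewrite opprK => hh.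
    apply: le_trans hh _; rewrite ler_wpM2l ?(ltW e0)//.
    by rewrite -eta0n; exact: mulmx_lin_bound.
  have F2 : `|f xs - f x0 + s *: al| <= e * (s * `|a - x0|).
    have xs1 : `|xs - x0| < d1 by move: xsn; rewrite !lt_min => /andP[/andP[]].
    have := h1 _ _ hxs hax0 xs1; rewrite subrr normr0 => /(_ d10).
    have -> : xs - x0 = s *: (a - x0) by rewrite addrC addKr.
    have -> : s *: (a - x0) *m La = - (s *: al).
      by rewrite -(opprB x0 a) scalerN mulNmx -scalemxAl.
    by rewrite opprK normrZ (gtr0_norm s0).
  have -> : g eta0 - f xs = (g eta0 - f x0 + s *: al) - (f xs - f x0 + s *: al).
    by apply/rowP => i; rewrite !mxE; ring.
  apply: (@le_trans _ _ (CI * (e * (CE * (s * `|c|)) + e * (s * `|a - x0|)))).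
    by rewrite ler_wpM2l// (le_trans (ler_normB _ _))// lerD.
  have -> : CI * (e * (CE * (s * `|c|)) + e * (s * `|a - x0|)) = s * (e * Q).
    by rewrite /Q; ring.
  rewrite -mulrA ler_wpM2l ?(ltW s0)// (le_trans _ (ltW he2))// ler_wpM2r//.
  by rewrite ge_min lexx orbT.
have [|eta heta Peta] := @closed_ball_fixpoint 'rV[R]_m eta0 _ Psi sr0 ctr.
  move=> eta h; rewrite -(subrK (Psi eta0) (Psi eta)) -addrA (le_trans (ler_normD _ _))//.
  have := ctr _ _ h eta00; have : 2^-1 * `|eta - eta0| <= s * rho / 2.
    by rewrite mulrC ler_wpM2r.
  lra.
have gxs : g eta = f xs.
  move: Peta; rewrite /Psi => /eqP; rewrite eq_sym -subr_eq0 opprB addrCA subrr addr0.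
  move=> /eqP h; apply/eqP; rewrite -subr_eq0; apply/eqP.
  by rewrite -[LHS](mulmxKV uB) h mul0mx.
apply: (apart (s := s)); first by rewrite s0.
rewrite -/xs (hr _ _ hxs (inb _ heta)).
- exact: inb.
- by move: xsn; rewrite !lt_min => /andP[].
- by move: (near _ heta); rewrite !lt_min => /andP[].
- by rewrite -gxs.
Qed.

Lemma opposite_sides : \det A * \det B < 0.
Proof.
have dB : \det B != 0 by rewrite -unitfE -unitmxE.
have dA : \det A != 0 by rewrite -unitfE -unitmxE.
rewrite det_sides -mulrA pmulr_llt0; last by rewrite -expr2 exprn_even_gt0.
rewrite lt_neqAle leNgt; apply/andP; split; last by apply/negP; exact: no_overlap.
by apply: contra dA => /eqP k0; rewrite det_sides k0 mul0r.
Qed.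

End Sides.
End Orientation.

(** * Finiteness and continuity *)

Section Finiteness.
Variables (R : realType) (N : nat).
Implicit Types (s t : {fset 'rV[R]_N}) (K : set {fset 'rV[R]_N}).

Lemma mulmx_continuous p q (B : 'M[R]_(p, q)) : continuous (fun v : 'rV[R]_p => v *m B).
Proof.
move=> v; apply/(@cvgrPdist_lt _ _ _ (nbhs v) (nbhs_filter v)) => e e0; pose C := p%:R * `|B| + 1.
have C0 : 0 < C by rewrite ltr_wpDl// mulr_ge0.
have : nbhs v [set x | `|v - x| < e / C].
  by apply/(@nbhs_normP R 'rV[R]_p); exists (e / C); [rewrite /= divr_gt0|move=> x].
apply: filterS => x /= h; rewrite -mulmxBl (le_lt_trans (mulmx_lin_bound B _))//.
apply: (@le_lt_trans _ _ (C * `|v - x|)); first by rewrite ler_wpM2r// lerDl.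
by rewrite mulrC -ltr_pdivlMr.
Qed.

Lemma hull_compact s : compact (hull s).
Proof.
pose k := #|` s|; pose t (i : 'I_k) := nth 0 s i.
pose S := [set x : 'rV[R]_k | forall i, `[0, 1]%classic (x ord0 i)] `&`
          [set x : 'rV[R]_k | x *m (const_mx 1 : 'cV_k) = 1%:M].
have cS : compact S.
  apply: compact_closedI.
    by apply: (@rV_compact R k (fun=> `[0, 1]%classic)) => i; exact: segment_compact.
  apply: (@closed_comp _ _ (fun x : 'rV[R]_k => x *m (const_mx 1 : 'cV_k)) [set 1%:M]).
    by move=> x _; exact: mulmx_continuous.
  apply: compact_closed; [exact: norm_hausdorff|exact: compact_set1].
suff -> : hull s = (fun x : 'rV[R]_k => x *m \matrix_i t i) @` S.
  apply: continuous_compact => //; apply: continuous_subspaceT; exact: mulmx_continuous.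
have E (F : 'rV[R]_N -> 'rV[R]_N) : \sum_(v <- s) F v = \sum_(i < k) F (t i).
  by rewrite (big_nth 0) big_mkord.
have E1 (F : 'rV[R]_N -> R) : \sum_(v <- s) F v = \sum_(i < k) F (t i).
  by rewrite (big_nth 0) big_mkord.
have ts i : t i \in s by exact: mem_nth.
have cE (x : 'rV[R]_k) : (x *m (const_mx 1 : 'cV_k)) 0 0 = \sum_i x 0 i.
  by rewrite mxE; apply: eq_bigr => i _; rewrite mxE mulr1.
apply/seteqP; split => x /=.
- case=> a [a0 a1] ->; exists (\row_i a (t i)).
    have s1 : \sum_i (\row_i a (t i)) 0 i = 1.
      by under eq_bigr => i _ do rewrite mxE; rewrite -E1.
    split => [i|/=]; last by apply/matrixP => i j; rewrite !ord1 cE s1 mxE eqxx.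
    rewrite /= in_itv/= mxE a0//= -a1 E1 (bigD1 i)//= lerDl sumr_ge0// => j _.
    exact: a0.
  by rewrite E mulmx_sum_row; apply: eq_bigr => i _; rewrite mxE rowK.
- case=> a [a0 a1] <-; rewrite mulmx_sum_row.
  under eq_bigr => i _ do rewrite rowK.
  apply: hull_conv => [i _||i _ _]; last exact: hull_vertex.
    by have := a0 i; rewrite /= in_itv/= => /andP[].
  by rewrite -cE a1 mxE.
Qed.

Lemma hull_mid_closed s : mid_closed (hull s).
Proof.
move=> x y hx hy; have -> : mid x y = x + 2^-1 *: (y - x).
  by rewrite -midB1 addrC subrK.
by apply: hull_segment => //; rewrite invr_ge0 ler0n invf_le1// ler1n.
Qed.

Lemma complex_finite K : simplicial_complex K -> compact (body K) -> finite_set K.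
Proof.
move=> [hne _ _ hloc]; rewrite compact_cover => cP.
have /boolp.choice[U hU] : forall x, exists W, body K x ->
    nbhs x W /\ finite_set [set s | K s /\ hull s `&` W !=set0].
  move=> x.
  by have [/hloc[W ? ?]|nx] := pselect (body K x); [exists W|exists setT].
have [||D sD hD] := cP _ (body K) (fun x => (U x)^°).
- by move=> x _; exact: open_interior.
- by move=> x hx; exists x => //; have [] := hU _ hx.
apply: (@sub_finite_set _ _ (\bigcup_(x in [set` D]) [set s | K s /\ hull s `&` U x !=set0])).
  move=> s Ks; have [/fset0Pn[v vs] _] := hne _ Ks.
  have hv : hull s v by exact: hull_vertex.
  have [|x Dx xv] := hD v; first by exists s.
  exists x => //; split => //; exists v; split => //; exact: interior_subset xv.
apply: bigcup_finite => [|x /sD]; first exact: finite_fset.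
by rewrite inE => /hU[].
Qed.

End Finiteness.

(** * Perturbation of Gram matrices; constant forms from cocycles *)

Section MatrixLemmas.
Variable R : realType.

(** The common shape of the determinant and of [pf]: a weighted sum over permutations of products of
    entries. *)
Lemma leibniz_near (I J : finType) m (c : I -> R) (f g : I -> J -> 'I_m) (G0 : 'M[R]_m) (e : R) :
  0 < e -> exists2 d, 0 < d & forall G : 'M[R]_m, `|G - G0| < d ->
    `|\sum_i c i * \prod_j G (f i j) (g i j) - \sum_i c i * \prod_j G0 (f i j) (g i j)| < e.
Proof.
move=> e0; pose F (G : 'M[R]_m) := \sum_i c i * \prod_j G (f i j) (g i j).
have cF : continuous F.
  apply: continuous_big => [|i _]; first exact: add_continuous.
  move=> G; apply: (cvgM (FF := nbhs_filter G)); first exact: cvg_cst.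
  move: G; apply: (@continuous_big R _ *%R); first exact: mul_continuous.
  by move=> j _; exact: coord_continuous.
have /cvgrPdist_lt/(_ _ e0) /nbhs_normP[d d0 hd] := cF G0.
by exists d => // G hG; rewrite distrC; apply: hd; rewrite /= distrC.
Qed.

Lemma same_sign (x y : R) : y != 0 -> `|x - y| < `|y| -> 0 < x * y /\ x != 0.
Proof.
move=> y0; have [yp|yn|] := ltgtP 0 y; last by move=> /eqP; rewrite eq_sym (negPf y0).
- rewrite (gtr0_norm yp) ltr_norml => /andP[h _].
  have x0 : 0 < x by lra.
  by rewrite mulr_gt0// gt_eqF.
- rewrite (ltr0_norm yn) ltr_norml => /andP[_ h].
  have x0 : x < 0 by lra.
  by rewrite nmulr_rgt0// lt_eqF.
Qed.

Lemma pf_near n (G0 : 'M[R]_n.*2) : pf G0 != 0 -> exists2 d, 0 < d & forall G,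
  `|G - G0| < d -> 0 < pf G * pf G0.
Proof.
move=> p0; have [|d d0 hd] := @leibniz_near 'S_n.*2 'I_n n.*2 (fun p => (2 ^+ n)^-1 * (-1) ^+ p)
   (fun p i => p (ord_even i)) (fun p i => p (ord_odd i)) G0 `|pf G0|; first by rewrite normr_gt0.
exists d => // G /hd h; apply: (same_sign p0 _).1.
have E (G1 : 'M[R]_n.*2) : pf G1 = \sum_(p : 'S_n.*2) (2 ^+ n)^-1 * (-1) ^+ p *
    \prod_(i < n) G1 (p (ord_even i)) (p (ord_odd i)).
  by rewrite /pf mulr_sumr; apply: eq_bigr => p _; rewrite mulrA.
by rewrite !E in h *.
Qed.

Lemma unitmx_near m (G0 : 'M[R]_m) : G0 \in unitmx -> exists2 d, 0 < d & forall G,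
  `|G - G0| < d -> G \in unitmx.
Proof.
rewrite unitmxE unitfE => p0.
have [|d d0 hd] := @leibniz_near 'S_m 'I_m m (fun p => (-1) ^+ p) (fun p i => i)
   (fun p i => p i) G0 `|\det G0|; first by rewrite normr_gt0.
by exists d => // G /hd h; rewrite unitmxE unitfE; apply: (same_sign p0 _).2.
Qed.

Lemma edges_free N m (s : {fset 'rV[R]_N}) a (t : 'I_m -> 'rV[R]_N) :
  affinely_independent s -> a \in s -> (forall i, t i \in s) ->
  (forall i, t i != a) -> injective t -> row_free (\matrix_i (t i - a)).
Proof.
move=> hs sa st ta tI; apply: inj_row_free => x; rewrite mulmx_sum_row => hx.
(* [None] stands for the apex [a], whose weight balances the others; [sum_fibre] turns these weights
   into a function of the vertex. *)
pose q (o : option 'I_m) := if o is Some i then t i else a.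
pose c (o : option 'I_m) := if o is Some i then x 0 i else - \sum_i x 0 i.
pose r := None :: map Some (index_enum 'I_m).
have qs o : o \in r -> c o != 0 -> q o \in s by case: o => [i|] _ _ /=.
have c0 : \sum_(o <- r) c o = 0 by rewrite big_cons big_map addNr.
have cq : \sum_(o <- r) c o *: q o = 0.
  rewrite big_cons big_map /= -[RHS]hx.
  under [RHS]eq_bigr => i _ do rewrite rowK scalerBr.
  by rewrite sumrB -scaler_suml addrC scaleNr.
apply/rowP => j; rewrite [RHS]mxE.
have := hs (fun v => \sum_(o <- r | q o == v) c o) _ _ (t j) (st j).
have -> : \sum_(o <- r | q o == t j) c o = x 0 j.
  rewrite big_cons big_map/= eq_sym (negPf (ta j)).
  by rewrite (big_pred1 j)// => i; rewrite /= (inj_eq tI).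
apply.
- have := sum_fibre (W := R^o) (fun=> 1) qs; move=> h.
  transitivity (\sum_(v <- s) (\sum_(o <- r | q o == v) c o) *: (1 : R^o)).
    by apply: eq_bigr => v _; rewrite [RHS]mulr1.
  by rewrite h -[RHS]c0; apply: eq_bigr => o _; rewrite [LHS]mulr1.
- by rewrite (sum_fibre (W := 'rV[R]_N) id qs).
Qed.

(* [C a b c] is a 2-cochain on the vertices of [s]: being a cocycle, it is the
   area cochain of a constant form. *)
Lemma cocycle_form N (s : {fset 'rV[R]_N}) (C : 'rV[R]_N -> 'rV[R]_N -> 'rV[R]_N -> R) :
  affinely_independent s ->
  (forall a b c, a \in s -> b \in s -> c \in s -> C b a c = - C a b c /\ C a c b = - C a b c) ->
  (forall a b c d, a \in s -> b \in s -> c \in s -> d \in s -> cobd C a b c d = 0) ->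
  exists w : 'M[R]_N, alternating w /\ forall a b c, a \in s -> b \in s -> c \in s ->
    form_eval w (b - a) (c - a) = C a b c.
Proof.
move=> hs asym coc.
have [->|/fset0Pn[v0 sv0]] := eqVneq s fset0.
  by exists 0; split=> [|a b c]; rewrite ?inE// /alternating trmx0 oppr0.
pose s0 := (s `\ v0)%fset; pose k := #|` s0|; pose t (i : 'I_k) := nth 0 s0 i.
have ts0 i : t i \in s0 by exact: mem_nth.
have ts i : t i \in s by have := ts0 i; rewrite in_fsetD1 => /andP[].
have tv i : t i != v0 by have := ts0 i; rewrite in_fsetD1 => /andP[].
have tI : injective t.
  by move=> i j /eqP; rewrite nth_uniq ?fset_uniq// => /eqP /val_inj.
have fr := edges_free hs sv0 ts tv tI.
set E := \matrix_i (t i - v0) in fr.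
(* [Q] sends the edge [t i - v0] to the [i]-th basis vector, so [Q *m D *m Q^T] takes the values
   [D i j] on these edges. *)
have [Q EQ] : exists Q, E *m Q = 1%:M by exists (pinvmx E); exact: mulmxVp.
pose D := \matrix_(i, j) C v0 (t i) (t j).
have Dalt : D^T = - D.
  by apply/matrixP => i j; rewrite !mxE; have [_ ->] := asym v0 (t i) (t j) sv0 (ts i) (ts j).
exists (Q *m D *m Q^T); split.
  rewrite /alternating !trmx_mul trmxK Dalt mulNmx mulmxN; by rewrite mulmxA.
have C0 b : b \in s -> C v0 v0 b = 0.
  move=> sb; have [h _] := asym v0 v0 b sv0 sv0 sb; move/eqP: h.
  by rewrite -addr_eq0 -mulr2n mulrn_eq0 => /eqP.
have Cbb b : b \in s -> C v0 b v0 = 0.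
  by move=> sb; have [_ ->] := asym v0 v0 b sv0 sv0 sb; rewrite C0// oppr0.
have rowt b : b \in s -> b = v0 \/ exists i, b = t i.
  move=> sb; have [->|bv] := eqVneq b v0; [by left|right].
  have b0 : b \in s0 by rewrite in_fsetD1 bv.
  have ib : (index b s0 < k)%N by rewrite index_mem.
  by exists (Ordinal ib); rewrite /t/= nth_index.
have base b c : b \in s -> c \in s ->
    form_eval (Q *m D *m Q^T) (b - v0) (c - v0) = C v0 b c.
  move=> sb sc; have [->|[i ->]] := rowt _ sb; first by rewrite subrr form_eval0l C0.
  have [->|[j ->]] := rowt _ sc.
    by rewrite subrr Cbb// /form_eval trmx0 mulmx0 mxE.
  have rE l : (t l - v0) *m Q = row l (1%:M : 'M[R]_k).
    by rewrite -EQ row_mul rowK.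
  have /matrixP/(_ i j) := gram_mx (1%:M : 'M[R]_k) D.
  by rewrite form_eval_mul !rE mul1mx trmx1 mulmx1 !mxE => <-.
move=> a b c sa sb sc.
have -> : b - a = (b - v0) - (a - v0) by rewrite opprB addrA subrK.
have -> : c - a = (c - v0) - (a - v0) by rewrite opprB addrA subrK.
rewrite form_evalBl !(form_evalBr _ _ (c - v0)) !base//.
(* The cocycle identity reduces an arbitrary triangle to triangles based at [v0]. *)
have := coc v0 a b c sv0 sa sb sc; rewrite /cobd.
have [_ ha] := asym v0 a b sv0 sa sb.
have : C v0 a a = 0.
  have [_ h] := asym v0 a a sv0 sa sa; move/eqP: h.
  by rewrite -addr_eq0 -mulr2n mulrn_eq0 => /eqP.
lra.
Qed.

(** The right-hand side has barycentric coordinate [e] at [a], while points of the opposite face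
    have 0. *)
Lemma apex_coord N (s : {fset 'rV[R]_N}) a x y (e : R) :
  affinely_independent s -> a \in s -> hull (s `\ a)%fset x -> hull (s `\ a)%fset y ->
  y = x + e *: (a - x) -> e = 0.
Proof.
move=> hs sa [al [_ al1] ->] [be [_ be1] ->] h.
have := hs (fun v => if v == a then e else (1 - e) * al v - be v) _ _ a sa.
rewrite eqxx; apply; rewrite (big_fsetD1 a)//= eqxx.
  rewrite (eq_big_seq (fun v => (1 - e) * al v - be v)); last first.
    by move=> v; rewrite in_fsetD1 => /andP[/negPf ->].
  by rewrite sumrB -mulr_sumr al1 be1; ring.
rewrite (eq_big_seq (fun v => (1 - e) *: (al v *: v) - be v *: v)); last first.
  by move=> v; rewrite in_fsetD1 => /andP[/negPf -> _]; rewrite scalerBl scalerA.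
rewrite sumrB -scaler_sumr h; apply/rowP => i; rewrite !mxE; ring.
Qed.

End MatrixLemmas.

(** * The area cocycle and its constant forms *)

Section LocalModel.
Variables (R : realType) (N m : nat) (P : set 'rV[R]_N) (M : smooth_manifold R m).
Variables (omega : chart R M m -> 'rV[R]_m -> 'M[R]_m) (h : P -> M).
Hypotheses (sympl : symplectic_form omega) (hh : homeomorphism h).
Variable K : set {fset 'rV[R]_N}.
Hypotheses (trK : triangulation K P) (emb : forall s, K s -> smooth_embedding_on h s).
Local Notation V := 'rV[R]_N.
Implicit Types (c : chart R M m) (s : {fset V}) (A : set V) (p q x : V).

Definition loc_tri c := tri_form (omega c) (loc h c).

(** [W s p] is pinned down on [direction s] only; the quantification over [c] and [L] records its
    independence of the chart and of the chosen derivative. *)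
Definition pullback (W : {fset V} -> V -> 'M[R]_N) := forall s p, K s -> hull s p ->
  alternating (W s p) /\ forall c L, atlas c -> valid h c p -> hdiff h c s p L ->
    forall u v, u \in direction s -> v \in direction s ->
    form_eval (W s p) u v = form_eval (omega c (loc h c p)) (u *m L) (v *m L).

Lemma pullback_choice : exists W, pullback W.
Proof.
have /boolp.choice[W hW] : forall sp : {fset V} * V, exists W : 'M[R]_N,
    K sp.1 -> hull sp.1 sp.2 -> alternating W /\ forall c L, atlas c -> valid h c sp.2 ->
    hdiff h c sp.1 sp.2 L ->
    forall u v, u \in direction sp.1 -> v \in direction sp.1 ->
    form_eval W u v = form_eval (omega c (loc h c sp.2)) (u *m L) (v *m L).
  move=> [s p] /=; have [Ks|nK] := pselect (K s); last by exists 0.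
  have [sp|ns] := pselect (hull s p); last by exists 0.
  by have [W hW] := pullback_exists sympl hh trK emb Ks sp; exists W.
by exists (fun s p => W (s, p)) => s p; exact: hW (s, p).
Qed.

Variable W : {fset V} -> V -> 'M[R]_N.
Hypothesis hW : pullback W.

Lemma chart_flat c s p (e : R) : atlas c -> K s -> hull s p -> valid h c p -> 0 < e ->
  exists2 r, 0 < r & forall x y z, hull s x -> hull s y -> hull s z ->
    `|x - p| < r -> `|y - p| < r -> `|z - p| < r -> forall l, path2_le l x y z ->
    `|loc_tri c x y z - flat_form (W s p) x y z| <= e * l ^+ 2.
Proof.
move=> ac Ks sp vp e0.
have [L hL _] := hdiff_exists hh trK emb ac Ks sp vp.
have [T [hT _ _ _ _]] := omega_local sympl ac vp.
have [r r0 hr] := tri_form_flat sp hL hT e0.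
exists r => // x y z sx sy sz xr yr zr l hl.
have := hr x y z sx sy sz xr yr zr l hl.
by rewrite /flat_form form_eval_mul -((hW Ks sp).2 c L)//; exact: hull_direction.
Qed.

Lemma chart_closed c s p (e : R) : atlas c -> K s -> hull s p -> valid h c p -> 0 < e ->
  exists2 r, 0 < r & forall x y z t, hull s x -> hull s y -> hull s z -> hull s t ->
    `|x - p| < r -> `|y - p| < r -> `|z - p| < r -> `|t - p| < r ->
    forall l, path3_le l x y z t -> `|cobd (loc_tri c) x y z t| <= e * l ^+ 3.
Proof.
move=> ac Ks sp vp e0.
have [L hL _] := hdiff_exists hh trK emb ac Ks sp vp.
have [T [hT aT cT aw _]] := omega_local sympl ac vp.
exact: (tri_form_closed sp hL hT aT cT aw e0).
Qed.

Section InChart.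
Variables (c : chart R M m) (s : {fset V}) (A : set V).
Hypotheses (ac : atlas c) (Ks : K s) (As : A `<=` hull s) (vA : forall x, A x -> valid h c x).

Lemma chart_approx : loc_approx A (loc_tri c) (fun p => flat_form (W s p)).
Proof.
move=> p Ap e e0; have [r r0 hr] := chart_flat ac Ks (As Ap) (vA Ap) e0.
by exists r => // x y z Ax Ay Az; apply: hr; exact: As.
Qed.

Lemma chart_loc_closed : loc_closed A (loc_tri c).
Proof.
move=> p Ap e e0; have [r r0 hr] := chart_closed ac Ks (As Ap) (vA Ap) e0.
by exists r => // x y z t Ax Ay Az At; apply: hr; exact: As.
Qed.

Lemma W_subdiv p : A p -> forall x y z,
  subdiv (flat_form (W s p)) x y z = flat_form (W s p) x y z.
Proof. by move=> /As sp x y z; apply: flat_form_subdiv; have [] := hW Ks sp. Qed.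

End InChart.

Definition fits s c x y z := [/\ K s, atlas c &
  forall q, hull [fset x; y; z]%fset q -> hull s q /\ valid h c q].

(** One function of three points for all simplices and charts: a triangle in a common face of two
    simplices of [K] gets the same area from both. *)
Definition area (I : V -> V -> V -> R) := forall s c x y z, fits s c x y z ->
  I x y z = tri_int (loc_tri c) x y z.

Lemma area_choice : exists I, area I.
Proof.
have /boolp.choice[I hI] : forall t : V * V * V, exists v, forall s c, fits s c t.1.1 t.1.2 t.2 ->
    v = tri_int (loc_tri c) t.1.1 t.1.2 t.2.
  move=> [[x y] z] /=.
  have [[s [c [Ks ac hc]]]|ne] := pselect (exists s c, fits s c x y z); last first.
    by exists 0 => s c hf; case: ne; exists s, c.
  exists (tri_int (loc_tri c) x y z) => s' c' [_ ac' hc'].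
  pose A := hull [fset x; y; z]%fset.
  have As : A `<=` hull s by move=> q /hc[].
  apply: (tri_int_eq (A := A) (B := fun p => flat_form (W s p))).
  - exact: hull_compact.
  - exact: hull_mid_closed.
  - exact: W_subdiv As.
  - by apply: chart_approx => // q /hc[].
  - by apply: chart_approx => // q /hc'[].
  - by apply: hull_vertex; rewrite !inE eqxx.
  - by apply: hull_vertex; rewrite !inE eqxx ?orbT.
  - by apply: hull_vertex; rewrite !inE eqxx ?orbT.
by exists (fun x y z => I (x, y, z)) => s c x y z; exact: hI (x, y, z) s c.
Qed.

Variable I : V -> V -> V -> R.
Hypothesis hI : area I.

Lemma flat_form_homothety (Q : 'M[R]_N) q (e : R) x y z :
  flat_form Q (q + e *: (x - q)) (q + e *: (y - q)) (q + e *: (z - q)) =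
  e ^+ 2 * flat_form Q x y z.
Proof.
have E u v : q + e *: (u - q) - (q + e *: (v - q)) = e *: (u - v).
  by rewrite opprD addrACA subrr add0r -scalerBr opprB addrA subrK.
by rewrite /flat_form !E form_evalZl form_evalZr; ring.
Qed.

(* Near [p] the pullbacks [W s q] are within [2 e] of [W s p]: both approximate the same
   chart expression on small triangles homothetic to the given one, with centre [q]. *)
Lemma pullback_near c s p (e r : R) : atlas c -> K s -> 0 < e ->
  (forall x, hull s x -> `|x - p| < r -> valid h c x) ->
  (forall x y z, hull s x -> hull s y -> hull s z ->
    `|x - p| < r -> `|y - p| < r -> `|z - p| < r -> forall l, path2_le l x y z ->
    `|loc_tri c x y z - flat_form (W s p) x y z| <= e * l ^+ 2) ->
  forall q, hull s q -> `|q - p| < r ->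
  forall x y z l, hull s x -> hull s y -> hull s z -> path2_le l x y z ->
    `|flat_form (W s q) x y z - flat_form (W s p) x y z| <= 2 * e * l ^+ 2.
Proof.
move=> ac Ks e0 vr hr q sq qr x y z l sx sy sz [l1 l2].
have [r' r'0 hr'] := chart_flat ac Ks sq (vr _ sq qr) e0.
pose d := Num.min r' (r - `|q - p|).
have d0 : 0 < d by rewrite lt_min r'0 subr_gt0.
pose D := `|x - q| + `|y - q| + `|z - q|.
have DD0 : 0 <= D by apply: addr_ge0 => //; exact: addr_ge0.
have [t /andP[t0 t1] tD] := exists_small d0 DD0.
pose H u := q + t *: (u - q).
have Hs u : hull s u -> hull s (H u).
  by move=> su; apply: hull_segment => //; rewrite (ltW t0).
have HB u v : H u - H v = t *: (u - v).
  by rewrite /H opprD addrACA subrr add0r -scalerBr opprB addrA subrK.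
have Hn u : `|u - q| <= D -> `|H u - q| < d.
  move=> uD; rewrite addrC addKr normrZ (gtr0_norm t0); apply: le_lt_trans tD.
  by rewrite ler_wpM2l// ltW.
have Dx : `|x - q| <= D by rewrite /D -addrA lerDl addr_ge0.
have Dy : `|y - q| <= D by rewrite /D addrAC lerDr addr_ge0.
have Dz : `|z - q| <= D by rewrite /D lerDr addr_ge0.
have Hr u : `|u - q| <= D -> `|H u - q| < r'.
  by move=> /Hn; rewrite lt_min => /andP[].
have Hp u : `|u - q| <= D -> `|H u - p| < r.
  move=> /Hn; rewrite lt_min => /andP[_ h1].
  rewrite -(subrK q (H u)) -addrA (le_lt_trans (ler_normD _ _))//.
  by rewrite -ltrBrDr.
have pl : path2_le (t * l) (H x) (H y) (H z).
  by split; rewrite HB normrZ (gtr0_norm t0) ler_wpM2l// ltW.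
have h1 := hr' _ _ _ (Hs _ sx) (Hs _ sy) (Hs _ sz) (Hr _ Dx) (Hr _ Dy) (Hr _ Dz) _ pl.
have h2 := hr _ _ _ (Hs _ sx) (Hs _ sy) (Hs _ sz) (Hp _ Dx) (Hp _ Dy) (Hp _ Dz) _ pl.
have t20 : 0 < t ^+ 2 by rewrite exprn_gt0.
rewrite -(ler_pM2l t20) -{1}(gtr0_norm t20) -normrM mulrBr -!(flat_form_homothety _ q t).
rewrite -/(H x) -/(H y) -/(H z).
move: h1 h2; rewrite exprMn; move: (loc_tri c _ _ _) (flat_form _ _ _ _) (flat_form _ _ _ _).
move=> u v w; rewrite !ler_norml => /andP[? ?] /andP[? ?]; apply/andP; split; lra.
Qed.

(** All of [hull T] lies in one chart domain, so on the vertices of [T] the cochain [I] is [tri_int]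
    of a single chart expression and the lemmas on compact sets apply. *)
Lemma local_estimates s p (e : R) : K s -> hull s p -> 0 < e ->
  exists2 r, 0 < r & forall T : {fset V}, (forall x, hull T x -> hull s x /\ `|x - p| < r) ->
  [/\ forall x y z, x \in T -> y \in T -> z \in T -> I y x z = - I x y z /\ I x z y = - I x y z,
    forall x y z t, x \in T -> y \in T -> z \in T -> t \in T -> cobd I x y z t = 0,
    forall x y z l, x \in T -> y \in T -> z \in T -> path2_le l x y z ->
      `|I x y z - flat_form (W s p) x y z| <= e * l ^+ 2 &
    forall q x y z l, hull T q -> x \in T -> y \in T -> z \in T -> path2_le l x y z ->
      `|flat_form (W s q) x y z - flat_form (W s p) x y z| <= 2 * e * l ^+ 2].
Proof.
move=> Ks sp e0; have Pp := hull_P trK Ks sp.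
have [c ac vp] := valid_exists h Pp.
have [r1 r10 h1] := valid_near hh vp.
have [L hL _] := hdiff_exists hh trK emb ac Ks sp vp.
have [_ [_ _ _ [d d0 hd] _]] := omega_local sympl ac vp.
have [r2 r20 h2] := sdiff_near (mulmx_lin_bound L) (mulr_ge0 (ler0n _ _) (normr_ge0 _)) sp hL d0.
have [r3 r30 h3] := chart_flat ac Ks sp vp e0.
pose r := Num.min (Num.min r1 r2) r3.
have r0 : 0 < r by rewrite !lt_min r10 r20.
have rr : r / 2 < r by rewrite ltr_pdivrMr// mulr_natr mulr2n ltrDl.
(* A closed ball inside the open one of radius [r], since the limit lemmas need a compact set stable
   under midpoints. *)
pose A := hull s `&` [set x | `|p - x| <= r / 2].
have Ar x : A x -> `|x - p| < r by move=> [_]; rewrite /= distrC => /le_lt_trans; apply.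
have As : A `<=` hull s by move=> x [].
have Ap : A p by split; rewrite //= subrr normr0 divr_ge0// ltW.
have vr x : hull s x -> `|x - p| < r -> valid h c x.
  by move=> sx; rewrite !lt_min => /andP[/andP[? _] _]; apply: h1 => //; apply: (hull_P trK Ks).
have vA x : A x -> valid h c x by move=> Ax; apply: vr; [exact: As|exact: Ar].
have cA : compact A by apply: compact_closedI; [exact: hull_compact|exact: closed_closed_ball_].
have mA : mid_closed A.
  move=> x y [sx /= xr] [sy /= yr]; split; first exact: hull_mid_closed.
  rewrite /=; have -> : p - mid x y = 2^-1 *: ((p - x) + (p - y)).
    by apply/rowP => i; rewrite !mxE; field.
  rewrite normrZ gtr0_norm ?invr_gt0// ler_pdivrMl//.
  by have := ler_normD (p - x) (p - y); lra.
have hB := W_subdiv Ks As; have ap := chart_approx ac Ks As vA.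
have hr3 : forall x y z, hull s x -> hull s y -> hull s z ->
    `|x - p| < r -> `|y - p| < r -> `|z - p| < r -> forall l, path2_le l x y z ->
    `|loc_tri c x y z - flat_form (W s p) x y z| <= e * l ^+ 2.
  move=> x y z sx sy sz; rewrite !lt_min => /andP[_ ?] /andP[_ ?] /andP[_ ?].
  exact: h3.
have aw x y z : A x -> A y -> A z ->
    alternating (omega c (3^-1 *: (loc h c x + loc h c y + loc h c z))).
  move=> Ax Ay Az; apply: hd; apply: centroid_near; apply: h2; try exact: As.
  - by have := Ar _ Ax; rewrite !lt_min => /andP[/andP[]].
  - by have := Ar _ Ay; rewrite !lt_min => /andP[/andP[]].
  - by have := Ar _ Az; rewrite !lt_min => /andP[/andP[]].
exists (r / 2); first by rewrite divr_gt0.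
move=> T hT.
have TA q : hull T q -> A q.
  by move=> /hT[? ?]; split; rewrite //= distrC ltW.
have VA x : x \in T -> A x by move=> xT; apply: TA; exact: hull_vertex.
have IE x y z : x \in T -> y \in T -> z \in T -> I x y z = tri_int (loc_tri c) x y z.
  move=> xT yT zT; apply: (hI (s := s)); split=> // q hq.
  have Aq : A q.
    apply: TA; apply: hull_sub hq => v; rewrite !inE => /orP[/orP[]|] /eqP->; exact: hull_vertex.
  by split; [exact: As|exact: vA].
split.
- move=> x y z xT yT zT; rewrite !IE//.
  apply: (tri_int_swap cA mA hB ap) => //; try exact: VA.
    by move=> a b d' Aa Ab Ad; apply: tri_form_swap12; exact: aw.
  by move=> a b d' Aa Ab Ad; apply: tri_form_swap23; exact: aw.
- move=> x y z t xT yT zT tT; rewrite /cobd !IE//.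
  by apply: (tri_int_cocycle cA mA hB ap (chart_loc_closed ac Ks As vA)); exact: VA.
- move=> x y z l xT yT zT hl; rewrite IE//.
  apply: (tri_int_near cA mA hB (r := r) Ap ap) => //; try exact: VA; try (apply: Ar; exact: VA).
  by move=> a b d' Aa Ab Ad; apply: hr3; exact: As.
- move=> q x y z l hq xT yT zT; apply: (pullback_near ac Ks e0 vr hr3); try (apply: As; exact: VA).
    by apply: As; exact: TA.
  by apply: Ar; exact: TA.
Qed.

End LocalModel.

(** * Nondegeneracy and sign on small simplices *)

Section Assembly.
Variables (R : realType) (N n : nat) (P : set 'rV[R]_N) (M : smooth_manifold R n.*2).
Local Notation m := n.*2.
Variables (omega : chart R M m -> 'rV[R]_m -> 'M[R]_m) (h : P -> M).
Hypotheses (sympl : symplectic_form omega) (hh : homeomorphism h).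
Variable K : set {fset 'rV[R]_N}.
Hypotheses (trK : triangulation K P) (emb : forall s, K s -> smooth_embedding_on h s).
Local Notation V := 'rV[R]_N.
Implicit Types (c : chart R M m) (s T : {fset V}) (p q x : V).
Variable W : {fset V} -> V -> 'M[R]_N.
Hypothesis hW : pullback omega h K W.
Variable I : V -> V -> V -> R.
Hypothesis hI : area omega h K I.
Variables (r : nat) (vs : 'I_r -> V).

Lemma edges_unit s (L : 'M[R]_(N, m)) (A : 'M[R]_(m, N)) : row_free A ->
  (forall i, row i A \in direction s) ->
  (forall u, u \in direction s -> u *m L = 0 -> u = 0) -> A *m L \in unitmx.
Proof.
move=> fA As hL; rewrite -row_free_unit; apply: inj_row_free => v; rewrite mulmxA => /hL h0.
apply: (row_free_inj fA); rewrite mul0mx; apply: h0.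
by rewrite mulmx_sum_row; apply: memv_suml => i _; apply: memvZ.
Qed.

Lemma gram_pullback c s p (L : 'M[R]_(N, m)) (A : 'M[R]_(m, N)) :
  K s -> hull s p -> atlas c -> valid h c p -> hdiff h c s p L ->
  (forall i, row i A \in direction s) ->
  A *m W s p *m A^T = (A *m L) *m omega c (loc h c p) *m (A *m L)^T.
Proof.
move=> Ks sp ac vp hL As; rewrite !gram_mx; apply/matrixP => i j; rewrite !mxE !row_mul.
exact: (hW Ks sp).2.
Qed.

(** [L] times an edge of the subdivision, in the code of [freudenthal_shape]; the type of codes is
    finite and independent of [L]. *)
Definition edge_vec (e : {ffun 'I_r -> 'I_3}) : V := \sum_j ((e j)%:R - 1) *: vs j.
Definition shape_mx (E : {ffun 'I_m -> {ffun 'I_r -> 'I_3}}) := \matrix_i edge_vec (E i).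

Let D := \sum_j `|vs j| + 1.

Let D0 : 0 < D. Proof. by rewrite ltr_wpDl// sumr_ge0. Qed.

Lemma edge_vec_le e : `|edge_vec e| <= D.
Proof.
rewrite (le_trans (ler_norm_sum _ _ _))// (@le_trans _ _ (\sum_j `|vs j|)) ?lerDl//.
apply: ler_sum => j _; rewrite normrZ -[leRHS]mul1r ler_wpM2r// ler_norml.
have := ltn_ord (e j); rewrite ltnS -(ler_nat R) => h2.
by have := ler0n R (e j) => h3; apply/andP; split; lra.
Qed.

(** Invertibility and the sign of [pf] are open conditions for each shape, and [fin_delta] finds a
    common [d] for the finitely many codes. *)
Lemma model_near s p : K s -> hull s p -> exists2 d, 0 < d & forall E,
  row_free (shape_mx E) -> (forall i, row i (shape_mx E) \in direction s) ->
  forall G, `|G - shape_mx E *m W s p *m (shape_mx E)^T| < d ->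
  G \in unitmx /\ 0 < pf G * pf (shape_mx E *m W s p *m (shape_mx E)^T).
Proof.
move=> Ks sp; apply: fin_delta => [E|E d d' dd' hd fE sE G hG]; last first.
  by apply: hd => //; exact: lt_le_trans dd'.
have [fE|nf] := pselect (row_free (shape_mx E)); last by exists 1.
have [sE|nE] := pselect (forall i, row i (shape_mx E) \in direction s); last by exists 1.
have [c ac vp] := valid_exists h (hull_P trK Ks sp).
have [L hL Li] := hdiff_exists hh trK emb ac Ks sp vp.
have [_ [_ _ _ [d d0 hd] uw]] := omega_local sympl ac vp.
have aw : alternating (omega c (loc h c p)) by apply: hd; rewrite subrr normr0.
have uE := edges_unit fE sE Li.
have G0E := gram_pullback Ks sp ac vp hL sE.
have [|d1 d10 h1] := @pf_near _ _ (shape_mx E *m W s p *m (shape_mx E)^T).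
  by rewrite G0E pf_congr mulf_neq0 ?pf_neq0// -unitfE -unitmxE.
have [|d2 d20 h2] := @unitmx_near _ _ (shape_mx E *m W s p *m (shape_mx E)^T).
  by rewrite G0E !unitmx_mul uE uw unitmx_tr.
exists (Num.min d1 d2); first by rewrite lt_min d10.
by move=> _ _ G; rewrite lt_min => /andP[/h1 ? /h2 ?].
Qed.

Definition frame T (a : V) (t : 'I_m -> V) :=
  [/\ a \in T, forall i, t i \in T, forall i, t i != a & injective t].

Definition edge_mx (a : V) (t : 'I_m -> V) := \matrix_i (t i - a).

(** Quantified over every [L], so that the radius is fixed before the fineness of the subdivision.
    The factor 2 undoes the [2^-1] of [flat_form]. *)
Definition good s p (rho : R) := forall T (L : nat), (0 < L)%N -> affinely_independent T ->
  (forall x, hull T x -> hull s x /\ `|x - p| < rho) ->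
  (forall u v, u \in T -> v \in T -> exists e, L%:R *: (u - v) = edge_vec e) ->
  exists w, [/\ alternating w, forall x y z, x \in T -> y \in T -> z \in T ->
      form_eval w (y - x) (z - x) = 2 * I x y z &
    forall a t, frame T a t -> edge_mx a t *m w *m (edge_mx a t)^T \in unitmx /\
      forall q, hull T q -> 0 < pf (edge_mx a t *m w *m (edge_mx a t)^T) *
                                pf (edge_mx a t *m W s q *m (edge_mx a t)^T)].

Lemma good_radius s p : K s -> hull s p -> exists2 rho, 0 < rho & good s p rho.
Proof.
move=> Ks sp; have [d d0 hd] := model_near Ks sp.
(* A Gram entry of the scaled edges is [2 * L%:R ^+ 2] times a flat area, and edges are at most
   [D / L%:R], so an area error of [k * (D / L%:R) ^+ 2] becomes [2 * (k * D ^+ 2)], free of [L]. It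
   is needed for [k = e] and, for the pullback at [q], for [k = 2 * e], where it equals [d / 2]. *)
pose e := d / (8 * D ^+ 2).
have D20 : 0 < D ^+ 2 by rewrite exprn_gt0.
have e0 : 0 < e by rewrite divr_gt0// mulr_gt0.
have eD : e * D ^+ 2 = d / 8 by rewrite /e; field; rewrite gt_eqF.
have [rho rho0 hr] := local_estimates sympl hh trK emb hW hI Ks sp e0.
exists rho => // T L L0 aT hT shT; have [asym coc near near'] := hr T hT.
have LR0 : 0 < L%:R :> R by rewrite ltr0n.
have [||w [aw wE]] := cocycle_form (C := fun x y z => 2 * I x y z) aT.
- by move=> x y z xT yT zT; have [-> ->] := asym x y z xT yT zT; rewrite !mulrN.
- move=> x y z t xT yT zT tT; have := coc x y z t xT yT zT tT.
  by rewrite /cobd; lra.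
exists w; split=> // a t [aT' tT ta tI].
have [f hf] := fin_all_exists (fun i => shT _ _ (tT i) aT').
pose E : {ffun 'I_m -> {ffun 'I_r -> 'I_3}} := [ffun i => f i].
(* The shape is [L] times the edge matrix; as [\det S] is positive, passing between the two changes
   neither invertibility nor the sign of [pf]. *)
set A := edge_mx a t; set S := (L%:R%:M : 'M[R]_m).
have EA : shape_mx E = S *m A.
  by apply/row_matrixP => i; rewrite mul_scalar_mx linearZ/= !rowK ffunE hf.
have uS : S \in unitmx by rewrite unitmxE det_scalar unitrX// unitfE gt_eqF.
have fE : row_free (shape_mx E).
  by rewrite EA /row_free mxrankMfree ?mxrank_unit//; exact: edges_free aT aT' tT ta tI.
have sE i : row i (shape_mx E) \in direction s.
  rewrite EA mul_scalar_mx linearZ/= rowK; apply: memvZ.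
  by apply: hull_direction; [apply: (hT _ _).1..]; exact: hull_vertex.
have GE (Q : 'M[R]_N) : shape_mx E *m Q *m (shape_mx E)^T = S *m (A *m Q *m A^T) *m S^T.
  by rewrite EA trmx_mul !mulmxA.
have pfS (Q : 'M[R]_N) : pf (shape_mx E *m Q *m (shape_mx E)^T) = \det S * pf (A *m Q *m A^T).
  by rewrite GE pf_congr.
have dS : 0 < \det S by rewrite det_scalar exprn_gt0.
have path i j : path2_le (D / L%:R) a (t i) (t j).
  have le u v : u \in T -> v \in T -> `|u - v| <= D / L%:R.
    move=> uT vT; have [g hg] := shT _ _ uT vT; have := edge_vec_le g.
    by rewrite -hg normrZ gtr0_norm// mulrC -ler_pdivlMr.
  by split; apply: le.
have close (Q : 'M[R]_N) k : (forall i j, `|flat_form Q a (t i) (t j) -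
      flat_form (W s p) a (t i) (t j)| <= k * (D / L%:R) ^+ 2) -> k * D ^+ 2 <= d / 4 ->
    `|shape_mx E *m Q *m (shape_mx E)^T - shape_mx E *m W s p *m (shape_mx E)^T| < d.
  move=> hQ hk; apply: (@le_lt_trans _ _ (d / 2)); last by rewrite ltr_pdivrMr// ltr_pMr// ltr1n.
  apply: mx_norm_le => [|i j]; first by rewrite divr_ge0// ltW.
  rewrite !gram_mx !mxE !rowK !ffunE -!hf !form_evalZl !form_evalZr.
  have -> (y z : R) : L%:R * (L%:R * y) - L%:R * (L%:R * z) =
    2 * L%:R ^+ 2 * (2^-1 * y - 2^-1 * z) by field.
  rewrite normrM gtr0_norm ?mulr_gt0 ?exprn_gt0//.
  apply: (@le_trans _ _ (2 * L%:R ^+ 2 * (k * (D / L%:R) ^+ 2))).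
    by rewrite ler_pM2l ?mulr_gt0 ?exprn_gt0//; exact: hQ.
  have -> : 2 * L%:R ^+ 2 * (k * (D / L%:R) ^+ 2) = 2 * (k * D ^+ 2).
    by field; rewrite gt_eqF.
  lra.
have [|uw sw] := hd E fE sE (shape_mx E *m w *m (shape_mx E)^T).
  apply: (close w e) => [i j|]; last by rewrite eD ler_pM2l// lef_pV2 ?posrE// ler_nat.
  rewrite {1}/flat_form wE// mulrA mulVf ?mul1r ?pnatr_eq0//.
  by apply: near => //.
split.
  by move: uw; rewrite GE !unitmx_mul => /andP[/andP[_ ->]].
move=> q hq.
have [|_ sq] := hd E fE sE (shape_mx E *m W s q *m (shape_mx E)^T).
  apply: (close _ (2 * e)) => [i j|]; last by rewrite -mulrA eD; lra.
  exact: near'.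
move: sw sq; rewrite !pfS => sw sq.
have := mulr_gt0 sw sq.
move: (pf (A *m w *m _)) (pf (A *m W s q *m _)) (pf (A *m W s p *m _)) => x y z hxyz.
(* The values for [w] and for the pullback at [q] both have the sign of the one at [p], hence equal
   signs. *)
have : 0 < (x * y) * (\det S ^+ 4 * z ^+ 2).
  by rewrite (_ : _ * (_ ^+ 4 * _) = \det S * x * (\det S * z) * (\det S * y * (\det S * z))) //; ring.
have [->|z0] := eqVneq z 0; first by rewrite expr0n/= !mulr0 ltxx.
by rewrite pmulr_lgt0// mulr_gt0//; [exact: exprn_gt0|rewrite exprn_even_gt0].
Qed.

Lemma lebesgue_good : finite_set K -> exists2 d, 0 < d & forall s, K s -> forall x, hull s x ->
  exists p rho, [/\ hull s p, good s p rho & forall y, `|y - x| < d -> `|y - p| < rho].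
Proof.
move=> fK.
have [|k d d' dd' hd x sx|d d0 hd] := @fin_delta R (fset_set K) (fun k d =>
  forall x, hull (val k) x -> exists p rho,
    [/\ hull (val k) p, good (val k) p rho & forall y, `|y - x| < d -> `|y - p| < rho]).
- move=> [s /= Ks']; have Ks : K s by move: Ks'; rewrite in_fset_set// inE.
  have /boolp.choice[rho hrho] : forall p, exists rho, hull s p -> 0 < rho /\ good s p rho.
    move=> p; have [sp|] := pselect (hull s p); last by exists 0.
    by have [rho ? ?] := good_radius Ks sp; exists rho.
  have [|d d0 hd] := lebesgue_number (@hull_compact _ _ s) (r := rho).
    by move=> p /hrho[].
  exists d => // x /hd[p sp hp]; exists p, (rho p); split => //.
  by have [] := hrho _ sp.
- have [p [rho [sp gp hp]]] := hd x sx; exists p, rho; split => // y yx.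
  by apply: hp; exact: lt_le_trans dd'.
exists d => // s Ks; have Ks' : s \in fset_set K by rewrite in_fset_set// inE.
exact: (hd (FSetSub Ks')).
Qed.

Lemma hull_diam T x y (k : R) : (forall v, v \in T -> `|v - x| <= k) -> hull T y -> `|y - x| <= k.
Proof.
move=> hk [al [al0 al1] ->].
have -> : \sum_(v <- T) al v *: v - x = \sum_(v <- T) al v *: (v - x).
  under [RHS]eq_bigr => v _ do rewrite scalerBr.
  by rewrite sumrB -scaler_suml al1 scale1r.
rewrite (le_trans (ler_norm_sum _ _ _))//.
apply: (@le_trans _ _ (\sum_(v <- T) al v * k)); last by rewrite -mulr_suml al1 mul1r.
rewrite big_seq [leRHS]big_seq; apply: ler_sum => v vT.
by rewrite normrZ ger0_norm ?al0// ler_wpM2l ?al0// hk.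
Qed.

Lemma form_direction T (w w' : 'M[R]_N) : (forall x y z, x \in T -> y \in T -> z \in T ->
    form_eval w (y - x) (z - x) = form_eval w' (y - x) (z - x)) ->
  forall u v, u \in direction T -> v \in direction T -> form_eval w u v = form_eval w' u v.
Proof.
move=> hw u v; have [->|/fset0Pn[x xT]] := eqVneq T fset0.
  have -> : direction fset0 = 0%VS :> {vspace V}.
    by rewrite /direction (size0nil (cardfs0 _)) span_nil.
  by rewrite memv0 => /eqP->; rewrite !form_eval0l.
move=> /(direction_span xT)[al ->] /(direction_span xT)[be ->].
rewrite !form_eval_suml [LHS]big_seq [RHS]big_seq; apply: eq_bigr => y yT.
rewrite !form_eval_sumr [LHS]big_seq [RHS]big_seq; apply: eq_bigr => z zT.
by rewrite !form_evalZl !form_evalZr hw.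
Qed.

Lemma frame_direction T a t u : frame T a t -> #|` T| = m.+1 -> u \in direction T ->
  exists v : 'rV[R]_m, u = v *m edge_mx a t.
Proof.
move=> [aT tT ta tI] cT /(direction_span aT)[al ->].
exists (\row_i al (t i)); rewrite mulmx_sum_row (big_fsetD1 a)//= subrr scaler0 add0r.
have tU : uniq [seq t i | i <- enum 'I_m] by rewrite map_inj_uniq// enum_uniq.
transitivity (\sum_(v <- [seq t i | i <- enum 'I_m]) al v *: (v - a)).
  apply: perm_big; apply: uniq_perm; rewrite ?fset_uniq//.
  have sub : {subset [seq t i | i <- enum 'I_m] <= (T `\ a)%fset}.
    by move=> v /mapP[i _ ->]; rewrite in_fsetD1 ta tT.
  have [|_ e v] := uniq_min_size tU sub; last by rewrite e.
  by rewrite size_map size_enum_ord; move: cT; rewrite (cardfsD1 a) aT add1n => -[->].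
by rewrite big_map big_enum/=; apply: eq_bigr => i _; rewrite mxE rowK.
Qed.

End Assembly.

(** * The symplectic structure on the subdivision *)

Section SymplecticSubdivision.
Variables (R : realType) (N n : nat) (P : set 'rV[R]_N) (M : smooth_manifold R n.*2).
Local Notation m := n.*2.
Variables (omega : chart R M m -> 'rV[R]_m -> 'M[R]_m) (h : P -> M).
Hypotheses (sympl : symplectic_form omega) (hh : homeomorphism h).
Variable K : set {fset 'rV[R]_N}.
Hypotheses (trK : triangulation K P) (emb : forall s, K s -> smooth_embedding_on h s).
Local Notation V := 'rV[R]_N.
Implicit Types (c : chart R M m) (s T : {fset V}) (p q x : V).
Variable W : {fset V} -> V -> 'M[R]_N.
Hypothesis hW : pullback omega h K W.
Variable I : V -> V -> V -> R.
Hypothesis hI : area omega h K I.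

(** The simplex [s] of [K] is remembered because the pullback [W s q] is defined along simplices of
    [K], not of the subdivision. *)
Definition carried T s (w : 'M[R]_N) := [/\ K s, hull T `<=` hull s, alternating w,
  forall x y z, x \in T -> y \in T -> z \in T -> form_eval w (y - x) (z - x) = 2 * I x y z &
  forall a t, @frame _ _ n T a t -> edge_mx a t *m w *m (edge_mx a t)^T \in unitmx /\
    forall q, hull T q -> 0 < pf (edge_mx a t *m w *m (edge_mx a t)^T) *
                              pf (edge_mx a t *m W s q *m (edge_mx a t)^T)].

Lemma fine_subdivision (r : nat) (vs : 'I_r -> V) : injective vs ->
  (forall s, K s -> forall v, v \in s -> exists i, vs i = v) -> finite_set K ->
  exists2 L, (0 < L)%N & forall T, freudenthal K vs L T -> exists s w, carried T s w.
Proof.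
move=> vs_inj vs_cov fK; have [hK _] := trK.
have [d d0 hd] := lebesgue_good sympl hh trK emb hW hI vs fK.
pose D := \sum_j `|vs j| + 1.
have D0 : 0 < D by rewrite ltr_wpDl// sumr_ge0.
have Dd : 0 < D / d by rewrite divr_gt0.
(* Edges of the subdivision have length at most [D / L%:R], which has to fall below the Lebesgue
   number [d]. *)
have hL := archi_boundP (ltW Dd); set L := Num.bound _ in hL.
have LR : 0 < L%:R :> R by apply: lt_trans hL.
have L0 : (0 < L)%N by move: LR; rewrite ltr0n.
exists L => // T [A [s [hA TE]]].
have Ks : K s by case: hA.
have aT : affinely_independent T by rewrite TE; exact: (freudenthal_aff hK vs_inj vs_cov L0 hA).
have Ts : hull T `<=` hull s by rewrite TE; apply: freudenthal_hull_sub hA.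
have shT u v : u \in T -> v \in T -> exists e, L%:R *: (u - v) = edge_vec vs e.
  rewrite TE => /imfsetP[/= a aA ->] /imfsetP[/= b bA ->].
  exact: (freudenthal_shape L0 hA).
have [x xT] : exists x, x \in T.
  by case: hA => _ /fset0Pn[a aA] _ _; exists (pos vs L a); rewrite TE in_imfset.
have [p [rho [sp gp hp]]] := hd s Ks x (Ts _ (hull_vertex xT)).
have [|//|w [aw wE hw]] := gp T L L0 aT.
  move=> y yT; split; first exact: Ts.
  apply: hp; apply: (@le_lt_trans _ _ (D / L%:R)); last by rewrite ltr_pdivrMr// mulrC -ltr_pdivrMr.
  apply: hull_diam yT => v vT; have [e he] := shT _ _ vT xT.
  by have := edge_vec_le vs e; rewrite -he normrZ gtr0_norm// mulrC -ler_pdivlMr.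
by exists s, w.
Qed.

Lemma carried_edges T s w a t i : carried T s w -> @frame _ _ n T a t ->
  row i (edge_mx a t) \in direction s.
Proof.
move=> [_ Ts _ _ _] [aT tT _ _]; rewrite rowK.
by apply: hull_direction; apply: Ts; exact: hull_vertex.
Qed.

(** Congruence splits the Pfaffian of the pullback into a determinant of edges read in the chart and
    the Pfaffian of [omega] at the image point; the second factor is common to all simplices through
    [q]. *)
Lemma carried_sign T s w a t q c : affinely_independent T -> carried T s w ->
  @frame _ _ n T a t -> hull T q -> atlas c -> valid h c q ->
  exists2 L, sdiff (hull T) q (loc h c) (mulmx^~ L) & edge_mx a t *m L \in unitmx /\
    0 < pf (edge_mx a t *m w *m (edge_mx a t)^T) *
        (\det (edge_mx a t *m L) * pf (omega c (loc h c q))).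
Proof.
move=> aT cT fT Tq ac vq; have [Ks Ts aw wE hw] := cT.
have [L hL Li] := hdiff_exists hh trK emb ac Ks (Ts _ Tq) vq.
have As i := carried_edges i cT fT.
exists L; first exact: sdiff_sub hL.
have [_ /(_ q Tq)] := hw a t fT.
rewrite (gram_pullback hW Ks (Ts _ Tq) ac vq hL As) pf_congr => sgn; split => //.
apply: edges_unit Li => //.
by case: fT => aT' tT ta tI; exact: edges_free aT aT' tT ta tI.
Qed.

Lemma carried_nondegenerate T s w : carried T s w -> #|` T| = m.+1 -> nondegenerate_on T w.
Proof.
move=> [_ _ _ _ hw] cT.
have [a aT] : exists a, a \in T by apply/fset0Pn; rewrite -cardfs_gt0 cT.
pose t (i : 'I_m) := nth a (T `\ a)%fset i.
have sT : size (T `\ a)%fset = m by move: cT; rewrite (cardfsD1 a) aT add1n => -[].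
have t0 i : t i \in (T `\ a)%fset by apply: mem_nth; rewrite sT.
have fT : frame T a t.
  split=> // [i|i|i j /eqP].
  - by have := t0 i; rewrite in_fsetD1 => /andP[].
  - by have := t0 i; rewrite in_fsetD1 => /andP[].
  - by rewrite nth_uniq ?sT ?fset_uniq// => /eqP /val_inj.
have [uG _] := hw a t fT.
move=> u /(frame_direction fT cT)[v ->] hu.
have E0 : v *m (edge_mx a t *m w *m (edge_mx a t)^T) = 0.
  apply/rowP => j; rewrite [RHS]mxE -(hu (row j (edge_mx a t))); last first.
    by rewrite rowK; case: fT => ? ? _ _; exact: direction_sub.
  rewrite /form_eval tr_row !mulmxA [LHS]mxE [RHS]mxE.
  by apply: eq_bigr => k _; congr (_ * _); rewrite [RHS]mxE.
by rewrite -(mulmxK uG v) E0 mul0mx mul0mx.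
Qed.

(** Both signs are read at the barycentre of the common facet in one chart by [carried_sign]; what
    differs between them is the two determinants compared in [opposite_sides]. *)
Lemma carried_orientation K' (w : {fset V} -> 'M[R]_N) : simplicial_complex K' -> body K' = P ->
  (forall T, K' T -> exists s, carried T s (w T)) -> induces_orientation n K' w.
Proof.
move=> hK' bK' hw t a b sa sb ut Kt Ka Kb.
have [hne _ hcap _] := hK'.
move: ut; rewrite /= !inE negb_or => /and3P[/andP[ab nat] nbt ut].
set st := [fset v in tval t]%fset in Kt.
(* The facet is a simplex of [K'], hence nonempty, and [m] is the length of [t]. *)
have m0 : (0 < m)%N.
  have [/fset0Pn[v]] := hne _ Kt; rewrite /st !inE /= => vt _.
  by have := size_tuple t; case: (tval t) vt => [|? ?]; rewrite // => _ <-.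
have st_t i : tnth t i \in st by rewrite /st !inE mem_tnth.
have fr e (se := [fset v in e :: t]%fset) : e \notin tval t -> frame se e (tnth t).
  move=> net; split=> [|i|i|i j]; rewrite ?inE ?eqxx ?mem_tnth ?orbT//.
    by apply: contraNneq net => <-; exact: mem_tnth.
  by move=> hij; apply/eqP; move/(tuple_uniqP _): ut => /(_ i j hij) ->.
have sub e : (st `<=` [fset v in e :: t])%fset.
  by apply/fsubsetP => v; rewrite !inE => ->; rewrite orbT.
pose x0 := \sum_i (m%:R^-1 : R) *: tnth t i.
have mR : m%:R != 0 :> R by rewrite pnatr_eq0 -lt0n.
have hx0 : hull st x0.
  apply: hull_conv => [i _||i _ _]; rewrite ?invr_ge0//; last exact: hull_vertex.
  by rewrite sumr_const card_ord -[LHS]mulr_natr mulVf.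
have hsub e : hull st `<=` hull [fset v in e :: t]%fset.
  by apply: hull_sub => v /(fsubsetP (sub e)); exact: hull_vertex.
have Px0 : P x0 by rewrite -bK'; exists st.
have [c ac vc] := valid_exists h Px0.
have [sA hA] := hw _ Ka; have [sB hB] := hw _ Kb.
have [La fa [uA pA]] := carried_sign (hne _ Ka).2 hA (fr a nat) (hsub a _ hx0) ac vc.
have [Lb fb [uB pB]] := carried_sign (hne _ Kb).2 hB (fr b nbt) (hsub b _ hx0) ac vc.
have mE (L : 'M[R]_(N, m)) e : edge_mx e (tnth t) *m L = \matrix_i ((tnth t i - e) *m L).
  by apply/row_matrixP => i; rewrite row_mul !rowK.
have wE e : wedge_power (w [fset v in e :: t]%fset) (fun i => tnth t i - e) =
    pf (edge_mx e (tnth t) *m w [fset v in e :: t]%fset *m (edge_mx e (tnth t))^T).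
  rewrite wedge_powerE gram_mx; congr pf; apply/matrixP => i j; rewrite !mxE.
  by rewrite !rowK.
have capE : (sa `&` sb)%fset = st.
  apply/fsetP => v; rewrite !inE; case: (eqVneq v a) => [->|va] /=.
    by rewrite (negPf ab) /=.
  by case: (v \in t); rewrite ?orbT.
have [r r0 hr] := valid_near hh vc.
have inP e x : K' [fset v in e :: t]%fset -> hull [fset v in e :: t]%fset x -> P x.
  by move=> Ke hx; rewrite -bK'; exists [fset v in e :: t]%fset.
have aDt : (sa `\ a)%fset = st.
  apply/fsetP => v; rewrite !inE; case: (eqVneq v a) => [->|//] /=.
  by rewrite (negPf nat).
rewrite !wE.
have := opposite_sides (La := La) (Lb := Lb) (f := loc h c) (sa := sa) (sb := sb) m0
  (t := tnth t) (a := a) (b := b) (st := st).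
move: pA pB uA uB; rewrite !mE => pA pB uA uB.
move=> /(_ _ _ st_t (sub a) (sub b) fa fb uA uB) opp.
have {opp} : \det (\matrix_i ((tnth t i - a) *m La)) * \det (\matrix_i ((tnth t i - b) *m Lb)) < 0.
  apply: opp; rewrite ?inE ?eqxx//.
    exists r => // x y hx hy xr yr; apply: (loc_inj hh); apply: hr => //.
      exact: inP Ka _.
    exact: inP Kb _.
  (* A point of [sb] on the way from [x0] to [a] lies in [sa] too, hence in the common facet, where
     its coordinate [e] at [a] would vanish. *)
  move=> e /andP[e0 e1] hb.
  have ha : hull sa (x0 + e *: (a - x0)).
    apply: hull_segment; [exact: hsub|apply: hull_vertex|by rewrite ltW].
    by rewrite !inE eqxx.
  have : hull st (x0 + e *: (a - x0)) by rewrite -capE -hcap.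
  move=> he; have asa : a \in sa by rewrite !inE eqxx.
  have := apex_coord (hne _ Ka).2 asa (x := x0) (y := x0 + e *: (a - x0)) (e := e).
  rewrite aDt => /(_ hx0 he erefl) e00; by rewrite e00 ltxx in e0.
move: pA pB; move: (pf (edge_mx a _ *m _ *m _)) (pf (edge_mx b _ *m _ *m _)) => x y.
move: (pf (omega _ _)) (\det _) (\det _) => o dB dA h1 h2 h3.
(* The factor [o] of [omega] occurs twice in the product, so the sign of [x * y] is that of
   [dA * dB]. *)
have h4 := mulr_gt0 h1 h2.
rewrite ltNge; apply/negP => xy.
have : (x * (dA * o)) * (y * (dB * o)) <= 0.
  have -> : (x * (dA * o)) * (y * (dB * o)) = (x * y) * o ^+ 2 * (dA * dB) by ring.
  by rewrite mulr_ge0_le0 ?(ltW h3)// mulr_ge0// sqr_ge0.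
by rewrite leNgt h4.
Qed.

(** The areas of the vertex triples of a common face do not depend on the simplex, and they
    determine a form on the direction space of the face. *)
Lemma carried_two_form K' (w : {fset V} -> 'M[R]_N) :
  (forall T, K' T -> exists s, carried T s (w T)) -> PL_two_form K' w.
Proof.
move=> hw; split=> [T /hw[s []//]|T T' KT KT'].
have [s [_ _ _ wE _]] := hw _ KT; have [s' [_ _ _ wE' _]] := hw _ KT'.
apply: form_direction => x y z; rewrite !in_fsetI => /andP[? ?] /andP[? ?] /andP[? ?].
by rewrite wE// wE'.
Qed.

End SymplecticSubdivision.

Theorem corollary6p4 (R : realType) (N n : nat) (P : set 'rV[R]_N)
    (hP : closed_PL_manifold n.*2 P) (hM : admits_symplectic_smoothing n P) :
  supports_PL_symplectic n P.
Proof.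
have [_ cP _] := hP.
have [M [omega [h [sympl [hh [K trK emb]]]]]] := hM.
have [hK bK] := trK.
have fK : finite_set K by apply: complex_finite => //; rewrite bK.
(* Compactness makes [K] finite, so its vertices form one finite list, whose order is the one used
   in every simplex. *)
pose vert : {fset 'rV[R]_N} := (\bigcup_(s <- fset_set K) s)%fset.
pose vs (i : 'I_(size vert)) := nth 0 vert i.
have vs_inj : injective vs.
  by move=> i j /eqP; rewrite nth_uniq ?fset_uniq// => /eqP /val_inj.
have vs_cov s : K s -> forall v, v \in s -> exists i, vs i = v.
  move=> Ks v vs'; have vv : v \in vert.
    have Ks' : s \in fset_set K by rewrite in_fset_set// inE.
    by apply/bigfcupP; exists s; rewrite ?Ks'.
  have iv : (index v vert < size vert)%N by rewrite index_mem.
  by exists (Ordinal iv); rewrite /vs/= nth_index.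
have [W hW] := pullback_choice sympl hh trK emb.
have [I hI] := area_choice sympl hh trK emb hW.
have [L L0 hL] := fine_subdivision sympl hh trK emb hW hI vs_inj vs_cov fK.
have hK' := freudenthal_complex hK vs_inj vs_cov L0.
have bK' : body (freudenthal K vs L) = P by rewrite freudenthal_body.
have /boolp.choice[w hw] : forall T, exists w, freudenthal K vs L T ->
    exists s, carried n K W I T s w.
  move=> T; have [/hL[s [w hw]]|] := pselect (freudenthal K vs L T); last by exists 0.
  by exists w => _; exists s.
exists (freudenthal K vs L) => //; exists w; split.
- exact: carried_two_form hw.
- by move=> T /hw[s hT] cT; exact: (carried_nondegenerate hT cT).
- exact: (carried_orientation hh trK emb hW hK' bK' hw).
Qed.
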